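(* Let $$\cdots \to X_{n+1} \xrightarrow{p_{n+1}} X_n \xrightarrow{p_n} X_{n-1} \xrightarrow{p_{n-1}} \cdots \xrightarrow{p_1} X_0$$ be a tower of fibrations of pointed spaces. For every choice of basepoint in $\lim_n X_n$ (whose image is then taken as the basepoint in each $X_n$ for $n\ge 0$) and every $k\ge 0$ there is a natural short exact sequence $$1 \to \mathrm{lim}^1_n\, \pi_{k+1}X_n \to \pi_k \lim_n X_n \xrightarrow{P} \lim_n \pi_k X_n \to 1$$ of abelian groups if $k\ge 2$, of groups if $k=1$, and of pointed sets if $k=0$. If $k=0$, all of the spaces $X_n$ are H-spaces, and all of the maps $p_n$ are H-maps, then this is a short exact sequence of groups.
   Context: $\lim_n X_n$ is the inverse limit of the tower of topological spaces. A fibration is a map with the homotopy lifting property with respect to all cubes $I^k$, $k\ge 0$. The map $P$ is the natural map induced by the projections $P_i\colon \lim_n X_n\to X_i$, i.e. $P([\alpha]) = ([P_n\circ\alpha])_{n\ge 0}$. Natural means natural with respect to maps of towers of fibrations, i.e. families of maps $f_n\colon X_n\to Y_n$ commuting with the structure maps and preserving the chosen basepoints. $\mathrm{lim}^1$: for a tower of (not necessarily abelian) groups $\cdots\to G_{n+1}\xrightarrow{p_{n+1}}G_n\to\cdots\xrightarrow{p_1}G_0$, the group $\prod_{n\ge0}G_n$ acts on the left on the set $\prod_{n\ge 0}G_n$ by letting $(g_n)_{n\ge0}$ send $(h_n)_{n\ge0}$ to $\bigl(g_n h_n\, p_{n+1}(g_{n+1}^{-1})\bigr)_{n\ge0}$.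 Then $\mathrm{lim}^1_n G_n$ is the set of orbits of this action, pointed by the orbit of the identity element. If all $G_n$ are abelian, $\mathrm{lim}^1_n G_n$ is isomorphic to the underlying pointed set of the cokernel of the homomorphism $\prod_n G_n\to\prod_n G_n$, $(g_n)_n\mapsto (g_n\,p_{n+1}(g_{n+1}^{-1}))_n$, and so has a natural abelian group structure. A short exact sequence of pointed sets $1\to A\to B\xrightarrow{P} C\to 1$ means: $P$ is surjective, $A\to B$ is injective, and its image is the kernel of $P$ (the preimage of the basepoint of $C$). H-space and H-map have their usual meanings: an H-space is a pointed space $X$ with a basepoint-preserving continuous multiplication $X\times X\to X$ for which the basepoint is a two-sided unit up to homotopy, and an H-map is a basepoint-preserving map $f\colon X\to Y$ of H-spaces that is compatible with the multiplications up to homotopy, i.e. the maps $(x,x')\mapsto f(xx')$ and $(x,x')\mapsto f(x)f(x')$ are homotopic. The multiplication on $\pi_0$ is the one defined using the H-space product.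
   Formalization: For k=0 with H-spaces, π_0 need not be a group: lim^1 π_1 X_n is proved an abelian group and both maps homomorphisms; lim π_0 X_n is a group if all π_0 X_n are, and π_0 lim X_n if also its product (via H-map homotopies with null-homotopic basepoint loop) is associative and unital. *)

(* Defs.v *)
From HB Require Import structures.
From mathcomp Require Import all_boot all_order all_algebra generic_quotient.
From mathcomp Require Import monoid.
From mathcomp Require Import all_classical all_reals all_analysis.
From mathcomp Require Import ring lra.

Set Implicit Arguments.
Unset Strict Implicit.
Unset Printing Implicit Defensive.

Import Order.TTheory GRing.Theory Num.Theory.
Import numFieldNormedType.Exports.

Local Open Scope classical_set_scope.
Local Open Scope ring_scope.
Local Open Scope quotient_scope.

Section ContinuityTools.

Lemma cont_comp (A B C : topologicalType) (f : A -> B) (g : B -> C) :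
  continuous f -> continuous g -> continuous (fun a => g (f a)).
Proof. by move=> cf cg a; apply: continuous_comp; [exact: cf|exact: cg]. Qed.

Lemma cont_pair (A B C : topologicalType) (f : A -> B) (g : A -> C) :
  continuous f -> continuous g -> continuous (fun a => (f a, g a)).
Proof. by move=> cf cg a; apply: cvg_pair; [exact: cf|exact: cg]. Qed.

Lemma cont_fst (A B : topologicalType) : continuous (fst : A * B -> A).
Proof. by move=> p; exact: cvg_fst. Qed.

Lemma cont_snd (A B : topologicalType) : continuous (snd : A * B -> B).
Proof. by move=> p; exact: cvg_snd. Qed.

Lemma cont_coord (I : eqType) (K : I -> topologicalType) i :
  continuous (fun f : prod_topology K => f i).
Proof. exact: proj_continuous. Qed.

Lemma cont_prod (I : eqType) (K : I -> topologicalType) (A : topologicalType)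
    (f : A -> prod_topology K) :
  (forall i, continuous (fun a => f a i)) -> continuous f.
Proof.
move=> cf a; apply/cvg_sup => i U [_ [[W oW <-] Wfa] sWU].
have nW : nbhs a [set b | W (f b i)] := cf i a W (open_nbhs_nbhs (conj oW Wfa)).
by apply: (@filterS _ (nbhs a) _ _ _ _ nW) => b /=; exact: sWU.
Qed.

Lemma cont_sub (A X : topologicalType) (Y : set X) (f : A -> Y) :
  continuous (fun a => val (f a)) -> continuous f.
Proof. by move=> cf; apply: continuous_comp_initial. Qed.

Lemma cont_val (X : topologicalType) (Y : set X) :
  continuous (fun y : Y => val y : X).
Proof. exact: initial_continuous. Qed.

Lemma cont_glue (R : realType) (A B : topologicalType) (f g : A -> B)
    (c : A -> R) : continuous f -> continuous g -> continuous c ->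
  (forall a, c a = 0 -> f a = g a) ->
  continuous (fun a => if c a <= 0 then f a else g a).
Proof.
move=> cf cg cc fg a U Ua.
have Hf V : nbhs (f a) V -> nbhs a [set b | V (f b)] by exact: cf.
have Hg V : nbhs (g a) V -> nbhs a [set b | V (g b)] by exact: cg.
have Hc V : nbhs (c a) V -> nbhs a [set b | V (c b)] by exact: cc.
change (nbhs a [set b | U (if c b <= 0 then f b else g b)]).
have [c0|c0|c0] := ltgtP (c a) 0.
- have /Hc : nbhs (c a) [set r : R | r < 0].
    by apply: open_nbhs_nbhs; split => //; exact: open_lt.
  have /Hf : nbhs (f a) U by move: Ua; rewrite (ltW c0).
  by apply: filterS2 => b /= Ub cb; rewrite (ltW cb).
- have /Hc : nbhs (c a) [set r : R | 0 < r].
    by apply: open_nbhs_nbhs; split => //; exact: open_gt.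
  have /Hg : nbhs (g a) U by move: Ua; rewrite leNgt c0.
  by apply: filterS2 => b /= Ub cb; rewrite leNgt cb.
- have Uf : nbhs (f a) U by move: Ua; rewrite c0 lexx.
  have /Hg : nbhs (g a) U by rewrite -fg.
  by have /Hf := Uf; apply: filterS2 => b /= Ub cb; case: ifP.
Qed.

End ContinuityTools.

Definition unit_interval (R : realType) : topologicalType :=
  set_type (`[0, 1]%classic : set R).

Definition cube (R : realType) (k : nat) : topologicalType :=
  prod_topology (fun _ : 'I_k => unit_interval R).

Section UnitInterval.
Variable R : realType.
Notation I := (unit_interval R).

Definition ival (t : I) : R := \val t.

Lemma ival_ge0 t : 0 <= ival t.
Proof. by have := set_valP t; rewrite /= in_itv /= => /andP[]. Qed.

Lemma ival_le1 t : ival t <= 1.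
Proof. by have := set_valP t; rewrite /= in_itv /= => /andP[]. Qed.

Lemma ival_inj : injective ival.
Proof. exact: val_inj. Qed.

Lemma clamp_subproof (r : R) : Num.max 0 (Num.min 1 r) \in (`[0, 1]%classic : set R).
Proof.
rewrite inE /= in_itv /= le_max lexx /= ge_max ler01 /=.
by rewrite ge_min lexx.
Qed.

(* The nearest point of [0, 1]; the identity on [0, 1]. *)
Definition clamp (r : R) : I :=
  exist (fun r : R => r \in `[0, 1]%classic) _ (clamp_subproof r).

Lemma ival_clamp r : 0 <= r <= 1 -> ival (clamp r) = r.
Proof. by move=> /andP[r0 r1]; rewrite /ival /= (min_r r1) max_r. Qed.

Lemma clamp_ival t : clamp (ival t) = t.
Proof. by apply: ival_inj; rewrite ival_clamp // ival_ge0 ival_le1. Qed.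

Definition I0 : I := clamp 0.
Definition I1 : I := clamp 1.

Lemma ival0 : ival I0 = 0. Proof. by rewrite ival_clamp // lexx ler01. Qed.
Lemma ival1 : ival I1 = 1. Proof. by rewrite ival_clamp // lexx ler01. Qed.

Lemma clamp_le0 r : r <= 0 -> clamp r = I0.
Proof.
move=> r0; apply: ival_inj; rewrite ival0 /ival /= min_r.
  by rewrite max_l.
by rewrite (le_trans r0).
Qed.

Lemma clamp_ge1 r : 1 <= r -> clamp r = I1.
Proof. by move=> r0; apply: ival_inj; rewrite ival1 /ival /= min_l // max_r. Qed.

Lemma cont_ival : continuous ival.
Proof. exact: cont_val. Qed.

Lemma cont_clamp : continuous clamp.
Proof.
apply: cont_sub => /= r; apply: continuous_max; first exact: cst_continuous.
by apply: continuous_min; [exact: cst_continuous|exact: cvg_id].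
Qed.

Lemma cont_affine (u v : R) : continuous (fun t : I => clamp (u * ival t + v)).
Proof.
have cf : continuous (fun t : I => u * ival t + v).
  move=> t; apply: (@continuousD _ _ _ (fun t => u * ival t) (fun=> v)).
    by apply: (@continuousM _ _ (fun=> u) ival);
      [exact: cst_continuous|exact: cont_ival].
  exact: cst_continuous.
exact: cont_comp cf cont_clamp.
Qed.

Definition flip (t : I) : I := clamp (-1 * ival t + 1).
Definition lo_half (t : I) : I := clamp (2 * ival t + 0).
Definition hi_half (t : I) : I := clamp (2 * ival t + -1).

Lemma ival_flip t : ival (flip t) = 1 - ival t.
Proof.
have := ival_ge0 t; have := ival_le1 t; move=> t1 t0.
by rewrite ival_clamp; [lra|apply/andP; split; lra].
Qed.

Lemma ival_lo t : ival t <= 2^-1 -> ival (lo_half t) = 2 * ival t.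
Proof.
have := ival_ge0 t; have := ival_le1 t; move=> t1 t0 th.
by rewrite ival_clamp; [lra|apply/andP; split; lra].
Qed.

Lemma ival_hi t : 2^-1 <= ival t -> ival (hi_half t) = 2 * ival t - 1.
Proof.
have := ival_ge0 t; have := ival_le1 t; move=> t1 t0 th.
by rewrite ival_clamp; [lra|apply/andP; split; lra].
Qed.

Lemma flip0 : flip I0 = I1.
Proof. by apply: ival_inj; rewrite ival_flip ival0 ival1 subr0. Qed.

Lemma flip1 : flip I1 = I0.
Proof. by apply: ival_inj; rewrite ival_flip ival0 ival1 subrr. Qed.

Lemma half_I0 : ival I0 <= 2^-1. Proof. by rewrite ival0; lra. Qed.
Lemma half_I1 : ival I1 <= 2^-1 = false.
Proof. by apply/negbTE; rewrite -ltNge ival1; lra. Qed.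

Lemma lo0 : lo_half I0 = I0.
Proof. by apply: ival_inj; rewrite ival_lo ?half_I0 // ival0 mulr0. Qed.

Lemma hi1 : hi_half I1 = I1.
Proof. by apply: ival_inj; rewrite ival_hi ival1; lra. Qed.

Lemma lo_half1 t : ival t = 2^-1 -> lo_half t = I1.
Proof. by move=> t2; apply: ival_inj; rewrite ival_lo t2 ?ival1; lra. Qed.

Lemma hi_half0 t : ival t = 2^-1 -> hi_half t = I0.
Proof. by move=> t2; apply: ival_inj; rewrite ival_hi t2 ?ival0; lra. Qed.

Lemma lo1 : lo_half I1 = I1.
Proof. by apply: clamp_ge1; rewrite ival1; lra. Qed.

Lemma hi0 : hi_half I0 = I0.
Proof. by apply: clamp_le0; rewrite ival0; lra. Qed.

Lemma cont_flip : continuous flip. Proof. exact: cont_affine. Qed.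
Lemma cont_lo : continuous lo_half. Proof. exact: cont_affine. Qed.
Lemma cont_hi : continuous hi_half. Proof. exact: cont_affine. Qed.

Lemma cont_glue_half (A B : topologicalType) (f g : A -> B) (c : A -> I) :
  continuous f -> continuous g -> continuous c ->
  (forall a, ival (c a) = 2^-1 -> f a = g a) ->
  continuous (fun a => if ival (c a) <= 2^-1 then f a else g a).
Proof.
move=> cf cg cc fg; under eq_fun do rewrite -subr_le0.
apply: cont_glue => // [|a /eqP]; last by rewrite subr_eq0 => /eqP/fg.
have ch : continuous (fun t : I => ival t - 2^-1).
  by move=> t; apply: continuousB; [exact: cont_ival|exact: cst_continuous].
exact: cont_comp cc ch.
Qed.

End UnitInterval.

Record pointed_map (X Y : topologicalType) (x : X) (y : Y) := PointedMap {
  pmap_fun :> X -> Y;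
  pmap_cont : continuous pmap_fun;
  pmap_pt : pmap_fun x = y }.

Arguments pmap_cont {X Y x y} _.
Arguments pmap_pt {X Y x y} _.

Section Spheres.
Variables (R : realType).
Notation I := (unit_interval R).
Implicit Types (k : nat) (X Y : topologicalType).

Definition cube_boundary k (s : cube R k) : Prop :=
  exists i, s i = I0 R \/ s i = I1 R.

Record sphere k (X : topologicalType) (x : X) := Sphere {
  sphere_fun :> cube R k -> X;
  sphere_cont : continuous sphere_fun;
  sphere_bdry : forall s, cube_boundary s -> sphere_fun s = x }.

Arguments sphere_cont {k X x} _.
Arguments sphere_bdry {k X x} _.

HB.instance Definition _ k (X : topologicalType) (x : X) := gen_eqMixin (@sphere k X x).
HB.instance Definition _ k (X : topologicalType) (x : X) := gen_choiceMixin (@sphere k X x).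

Definition sphere_homotopic k X (x : X) (a b : sphere k x) : Prop :=
  exists h : cube R k * I -> X,
    [/\ continuous h, forall s, h (s, I0 R) = a s, forall s, h (s, I1 R) = b s
      & forall s t, cube_boundary s -> h (s, t) = x].

Lemma sphere_homotopic_ext k X (x : X) (a b : sphere k x) :
  a =1 b -> sphere_homotopic a b.
Proof.
move=> ab; exists (fun z => a z.1); split=> //.
- exact: cont_comp (@cont_fst _ _) (sphere_cont a).
- by move=> s t /sphere_bdry.
Qed.

Lemma sphere_homotopic_refl k X (x : X) (a : sphere k x) : sphere_homotopic a a.
Proof. exact: sphere_homotopic_ext. Qed.

Lemma sphere_homotopic_sym k X (x : X) (a b : sphere k x) :
  sphere_homotopic a b -> sphere_homotopic b a.
Proof.
move=> [h [ch h0 h1 hb]]; exists (fun z => h (z.1, flip z.2)); split.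
- apply: cont_comp ch; apply: cont_pair; first exact: cont_fst.
  exact: cont_comp (@cont_snd _ _) (@cont_flip R).
- by move=> s /=; rewrite flip0.
- by move=> s /=; rewrite flip1.
- by move=> s t bs /=; rewrite hb.
Qed.

Lemma sphere_homotopic_trans k X (x : X) (a b c : sphere k x) :
  sphere_homotopic a b -> sphere_homotopic b c -> sphere_homotopic a c.
Proof.
move=> [h [ch h0 h1 hb]] [g [cg g0 g1 gb]].
exists (fun z => if ival z.2 <= 2^-1 then h (z.1, lo_half z.2)
                 else g (z.1, hi_half z.2)); split.
- apply: cont_glue_half.
  + apply: cont_comp ch; apply: cont_pair; first exact: cont_fst.
    exact: cont_comp (@cont_snd _ _) (@cont_lo R).
  + apply: cont_comp cg; apply: cont_pair; first exact: cont_fst.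
    exact: cont_comp (@cont_snd _ _) (@cont_hi R).
  + exact: cont_snd.
  + by move=> [s t] /= t2; rewrite lo_half1 // hi_half0 // h1 g0.
- by move=> s /=; rewrite half_I0 lo0 h0.
- by move=> s /=; rewrite half_I1 hi1 g1.
- by move=> s t bs /=; case: ifP => _; rewrite ?hb ?gb.
Qed.

Definition sphere_homotopicb k X (x : X) : rel (sphere k x) :=
  fun a b => `[< sphere_homotopic a b >].

Lemma sphere_homotopicb_refl k X (x : X) : reflexive (@sphere_homotopicb k X x).
Proof. by move=> a; apply/asboolP; exact: sphere_homotopic_refl. Qed.

Lemma sphere_homotopicb_sym k X (x : X) : symmetric (@sphere_homotopicb k X x).
Proof.
by move=> a b; apply/asboolP/asboolP; exact: sphere_homotopic_sym.
Qed.

Lemma sphere_homotopicb_trans k X (x : X) :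
  transitive (@sphere_homotopicb k X x).
Proof.
move=> b a c /asboolP ab /asboolP bc; apply/asboolP.
exact: sphere_homotopic_trans bc.
Qed.

Canonical sphere_homotopy_equiv k X (x : X) := EquivRel (@sphere_homotopicb k X x)
  (@sphere_homotopicb_refl k X x) (@sphere_homotopicb_sym k X x)
  (@sphere_homotopicb_trans k X x).

End Spheres.

Arguments sphere_cont {R k X x} _.
Arguments sphere_bdry {R k X x} _.

(* [homotopy_group R k x] is the set of homotopy classes of maps
   (I^k, bd I^k) -> (X, x); for k = 0 these are the path components of X. *)
Definition homotopy_group (R : realType) k (X : topologicalType) (x : X) : Type :=
  {eq_quot (@sphere_homotopicb R k X x)}.

HB.instance Definition _ (R : realType) k (X : topologicalType) (x : X) :=
  Quotient.copy (homotopy_group R k x) {eq_quot (@sphere_homotopicb R k X x)}.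
HB.instance Definition _ (R : realType) k (X : topologicalType) (x : X) :=
  Choice.copy (homotopy_group R k x) {eq_quot (@sphere_homotopicb R k X x)}.

Section SphereClass.
Variables (R : realType) (k : nat) (X : topologicalType) (x : X).

Definition sphere_class (a : sphere R k x) : homotopy_group R k x := \pi a.

Lemma sphere_classP (a b : sphere R k x) :
  sphere_class a = sphere_class b <-> sphere_homotopic a b.
Proof.
split=> [|] ab; last by apply/eqmodP/asboolP.
by apply/asboolP; apply/(@eqmodP _ (sphere_homotopy_equiv R k x)).
Qed.

Lemma repr_classK (A : homotopy_group R k x) : sphere_class (repr A) = A.
Proof. exact: reprK. Qed.

Lemma repr_class (a : sphere R k x) :
  sphere_homotopic (repr (sphere_class a)) a.
Proof. by apply/sphere_classP; rewrite repr_classK. Qed.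

Definition sphere_cst : sphere R k x :=
  @Sphere R k X x (fun=> x) (@cst_continuous _ _ x) (fun _ _ => erefl).

Definition hg_base : homotopy_group R k x := sphere_class sphere_cst.

End SphereClass.

Section GroupStructure.
Variables (R : realType) (k : nat).
Notation I := (unit_interval R).
Implicit Types (X : topologicalType).

Definition set_first (s : cube R k.+1) (t : I) : cube R k.+1 :=
  fun i => if i == ord0 then t else s i.

Lemma set_first_id s : set_first s (s ord0) = s.
Proof. by apply/funext => i; rewrite /set_first; case: eqP => // ->. Qed.

Lemma set_first_at s t : set_first s t ord0 = t.
Proof. by rewrite /set_first eqxx. Qed.

Lemma set_firstK s t u : set_first (set_first s t) u = set_first s u.
Proof. by apply/funext => i; rewrite /set_first; case: eqP. Qed.

Lemma cont_set_first (A : topologicalType) (f : A -> cube R k.+1) (g : A -> I) :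
  continuous f -> continuous g -> continuous (fun a => set_first (f a) (g a)).
Proof.
move=> cf cg; apply: (@cont_prod 'I_k.+1 (fun=> I)) => i.
rewrite /set_first; case: eqP => _ //.
exact: cont_comp cf (@cont_coord _ (fun _ : 'I_k.+1 => I) i).
Qed.

Definition endpoint (t : I) : Prop := t = I0 R \/ t = I1 R.

Lemma set_first_endpoint s t : endpoint t -> cube_boundary (set_first s t).
Proof. by move=> et; exists ord0; rewrite set_first_at. Qed.

Lemma set_first_bdry s t : cube_boundary s ->
  (endpoint (s ord0) -> endpoint t) -> cube_boundary (set_first s t).
Proof.
move=> [i si] st; have [i0|i0] := eqVneq i ord0.
  by apply: set_first_endpoint; apply: st; rewrite -i0.
by exists i; rewrite /set_first (negbTE i0).
Qed.

Lemma cont_first : continuous (fun s : cube R k.+1 => s ord0).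
Proof. exact: (@cont_coord _ (fun _ : 'I_k.+1 => I) ord0). Qed.

Lemma cont_set_first_map (phi : I -> I) : continuous phi ->
  continuous (fun s : cube R k.+1 => set_first s (phi (s ord0))).
Proof.
move=> cphi; apply: cont_set_first; first by move=> ?.
exact: cont_comp cont_first cphi.
Qed.

Section Ops.
Context {X : topologicalType} {x : X}.
Implicit Types (a b c : sphere R k.+1 x).

Definition cat_fun a b (s : cube R k.+1) : X :=
  if ival (s ord0) <= 2^-1 then a (set_first s (lo_half (s ord0)))
  else b (set_first s (hi_half (s ord0))).

Lemma cat_cont a b : continuous (cat_fun a b).
Proof.
apply: cont_glue_half.
- exact: cont_comp (cont_set_first_map (@cont_lo R)) (sphere_cont a).
- exact: cont_comp (cont_set_first_map (@cont_hi R)) (sphere_cont b).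
- exact: cont_first.
- move=> s s2; rewrite lo_half1 // hi_half0 //.
  by rewrite !sphere_bdry //; apply: set_first_endpoint; [left|right].
Qed.

Lemma lo_endpoint (t : I) : endpoint t -> endpoint (lo_half t).
Proof. by move=> [] ->; rewrite ?lo0 ?lo1; [left|right]. Qed.

Lemma hi_endpoint (t : I) : endpoint t -> endpoint (hi_half t).
Proof. by move=> [] ->; rewrite ?hi0 ?hi1; [left|right]. Qed.

Lemma flip_endpoint (t : I) : endpoint t -> endpoint (flip t).
Proof. by move=> [] ->; rewrite ?flip0 ?flip1; [right|left]. Qed.

Lemma cat_bdry a b s : cube_boundary s -> cat_fun a b s = x.
Proof.
rewrite /cat_fun => bs; case: ifP => _; apply: sphere_bdry;
  apply: set_first_bdry => //; [exact: lo_endpoint|exact: hi_endpoint].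
Qed.

Definition sphere_cat a b : sphere R k.+1 x :=
  Sphere (@cat_cont a b) (@cat_bdry a b).

Definition rev_fun a (s : cube R k.+1) : X :=
  a (set_first s (flip (s ord0))).

Lemma rev_cont a : continuous (rev_fun a).
Proof. exact: cont_comp (cont_set_first_map (@cont_flip R)) (sphere_cont a). Qed.

Lemma rev_bdry a s : cube_boundary s -> rev_fun a s = x.
Proof.
move=> bs; apply: sphere_bdry; apply: set_first_bdry => //.
exact: flip_endpoint.
Qed.

Definition sphere_rev a : sphere R k.+1 x :=
  Sphere (@rev_cont a) (@rev_bdry a).

Lemma sphere_cat_homotopic a a' b b' :
  sphere_homotopic a a' -> sphere_homotopic b b' ->
  sphere_homotopic (sphere_cat a b) (sphere_cat a' b').
Proof.
move=> [h [ch h0 h1 hb]] [g [cg g0 g1 gb]].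
exists (fun z => if ival (z.1 ord0) <= 2^-1
                 then h (set_first z.1 (lo_half (z.1 ord0)), z.2)
                 else g (set_first z.1 (hi_half (z.1 ord0)), z.2)); split.
- apply: cont_glue_half.
  + apply: cont_comp ch; apply: cont_pair; last exact: cont_snd.
    exact: cont_comp (@cont_fst _ _) (cont_set_first_map (@cont_lo R)).
  + apply: cont_comp cg; apply: cont_pair; last exact: cont_snd.
    exact: cont_comp (@cont_fst _ _) (cont_set_first_map (@cont_hi R)).
  + exact: cont_comp (@cont_fst _ _) cont_first.
  + move=> [s t] /= s2; rewrite lo_half1 // hi_half0 //.
    by rewrite hb ?gb //; apply: set_first_endpoint; [left|right].
- by move=> s /=; rewrite h0 g0.
- by move=> s /=; rewrite h1 g1.
- move=> s t bs /=; case: ifP => _; rewrite ?hb ?gb //;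
    apply: set_first_bdry => //; [exact: lo_endpoint|exact: hi_endpoint].
Qed.

Lemma sphere_rev_homotopic a a' :
  sphere_homotopic a a' -> sphere_homotopic (sphere_rev a) (sphere_rev a').
Proof.
move=> [h [ch h0 h1 hb]].
exists (fun z => h (set_first z.1 (flip (z.1 ord0)), z.2)); split.
- apply: cont_comp ch; apply: cont_pair; last exact: cont_snd.
  exact: cont_comp (@cont_fst _ _) (cont_set_first_map (@cont_flip R)).
- by move=> s /=; rewrite h0.
- by move=> s /=; rewrite h1.
- move=> s t bs /=; rewrite hb //; apply: set_first_bdry => //.
  exact: flip_endpoint.
Qed.

Definition mix (p q t : I) : I :=
  clamp (ival t * ival q + (1 - ival t) * ival p).

Lemma mix0 p q : mix p q (I0 R) = p.
Proof. by rewrite /mix ival0 mul0r add0r subr0 mul1r clamp_ival. Qed.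

Lemma mix1 p q : mix p q (I1 R) = q.
Proof. by rewrite /mix ival1 subrr mul0r addr0 mul1r clamp_ival. Qed.

Lemma mixx p t : mix p p t = p.
Proof.
have e : ival t * ival p + (1 - ival t) * ival p = ival p by ring.
by rewrite /mix e clamp_ival.
Qed.

Lemma cont_mix (A : topologicalType) (p q t : A -> I) :
  continuous p -> continuous q -> continuous t ->
  continuous (fun u => mix (p u) (q u) (t u)).
Proof.
move=> cp cq ct; pose f r : A -> R := fun u => ival (r u).
have cf r : continuous r -> continuous (f r).
  by move=> cr; exact: cont_comp cr (@cont_ival R).
suff : continuous (f t * f q + ((fun=> 1) - f t) * f p).
  by move=> c; exact: cont_comp c (@cont_clamp R).
move=> a; apply: continuousD; apply: continuousM; try exact: cf.
by apply: continuousB; [exact: cst_continuous|exact: cf].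
Qed.

Lemma reparam_homotopic a b c (phi psi : I -> I) :
  continuous phi -> continuous psi ->
  phi (I0 R) = psi (I0 R) -> phi (I1 R) = psi (I1 R) ->
  endpoint (phi (I0 R)) -> endpoint (phi (I1 R)) ->
  (forall s, b s = a (set_first s (phi (s ord0)))) ->
  (forall s, c s = a (set_first s (psi (s ord0)))) ->
  sphere_homotopic b c.
Proof.
move=> cphi cpsi e0 e1 p0 p1 bE cE.
exists (fun z => a (set_first z.1 (mix (phi (z.1 ord0)) (psi (z.1 ord0)) z.2))).
split.
- apply: cont_comp (sphere_cont a); apply: cont_set_first; first exact: cont_fst.
  have c0 : continuous (fun z : cube R k.+1 * I => z.1 ord0).
    exact: cont_comp (@cont_fst _ _) cont_first.
  apply: cont_mix; last exact: cont_snd.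
    exact: cont_comp c0 cphi.
  exact: cont_comp c0 cpsi.
- by move=> s /=; rewrite mix0 bE.
- by move=> s /=; rewrite mix1 cE.
- move=> s t bs /=; apply: sphere_bdry; apply: set_first_bdry => //.
  by move=> [] ->; rewrite -?e0 -?e1 mixx.
Qed.

Lemma sphere_cat1 a : sphere_homotopic (sphere_cat a (sphere_cst R k.+1 x)) a.
Proof.
apply: (@reparam_homotopic a _ _ (@lo_half R) id (@cont_lo R)).
- by move=> t.
- exact: lo0.
- exact: lo1.
- by left; exact: lo0.
- by right; exact: lo1.
- move=> s /=; rewrite /cat_fun; case: ifPn => // s2.
  rewrite /lo_half clamp_ge1; last by move: s2; rewrite -ltNge => s2; lra.
  by rewrite /= (sphere_bdry a) //; apply: set_first_endpoint; right.
- by move=> s; rewrite set_first_id.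
Qed.

Lemma sphere_cat1l a : sphere_homotopic (sphere_cat (sphere_cst R k.+1 x) a) a.
Proof.
apply: (@reparam_homotopic a _ _ (@hi_half R) id (@cont_hi R)).
- by move=> t.
- exact: hi0.
- exact: hi1.
- by left; exact: hi0.
- by right; exact: hi1.
- move=> s /=; rewrite /cat_fun; case: ifPn => // s2.
  rewrite /hi_half clamp_le0; last by lra.
  by rewrite /= (sphere_bdry a) //; apply: set_first_endpoint; left.
- by move=> s; rewrite set_first_id.
Qed.

Lemma sphere_catV a :
  sphere_homotopic (sphere_cat a (sphere_rev a)) (sphere_cst R k.+1 x).
Proof.
apply: (@reparam_homotopic a _ _
  (fun t => if ival t <= 2^-1 then lo_half t else flip (hi_half t)) (fun=> I0 R)).
- apply: cont_glue_half; first exact: cont_lo.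
  + exact: cont_comp (@cont_hi R) (@cont_flip R).
  + by move=> t.
  + by move=> t t2; rewrite lo_half1 // hi_half0 // flip0.
- exact: cst_continuous.
- by rewrite half_I0 lo0.
- by rewrite half_I1 hi1 flip1.
- by rewrite half_I0 lo0; left.
- by rewrite half_I1 hi1 flip1; left.
- move=> s /=; rewrite /cat_fun; case: ifP => // _.
  by rewrite /= /rev_fun set_firstK set_first_at.
- by move=> s /=; rewrite sphere_bdry //; apply: set_first_endpoint; left.
Qed.

Lemma sphere_catVl a :
  sphere_homotopic (sphere_cat (sphere_rev a) a) (sphere_cst R k.+1 x).
Proof.
apply: (@reparam_homotopic a _ _
  (fun t => if ival t <= 2^-1 then flip (lo_half t) else hi_half t) (fun=> I1 R)).
- apply: cont_glue_half; last 1 first.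
  + by move=> t t2; rewrite lo_half1 // hi_half0 // flip1.
  + exact: cont_comp (@cont_lo R) (@cont_flip R).
  + exact: cont_hi.
  + by move=> t.
- exact: cst_continuous.
- by rewrite half_I0 lo0 flip0.
- by rewrite half_I1 hi1.
- by rewrite half_I0 lo0 flip0; right.
- by rewrite half_I1 hi1; right.
- move=> s /=; rewrite /cat_fun; case: ifP => // _.
  by rewrite /= /rev_fun set_firstK set_first_at.
- by move=> s /=; rewrite sphere_bdry //; apply: set_first_endpoint; right.
Qed.

Lemma sphere_catA a b c : sphere_homotopic
  (sphere_cat a (sphere_cat b c)) (sphere_cat (sphere_cat a b) c).
Proof.
apply: sphere_homotopic_sym.
pose m (t : I) : R := Num.min (2 * ival t)
  (Num.min (ival t + 4^-1) (2^-1 * ival t + 2^-1)).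
have m1 (t : I) : ival t <= 4^-1 -> m t = 2 * ival t.
  by move=> t4; rewrite /m min_l // le_min; apply/andP; split; lra.
have m2 (t : I) : 4^-1 <= ival t <= 2^-1 -> m t = ival t + 4^-1.
  move=> /andP[t4 t2]; rewrite /m [X in Num.min _ X]min_l; last by lra.
  by rewrite min_r //; lra.
have m3 (t : I) : 2^-1 <= ival t -> m t = 2^-1 * ival t + 2^-1.
  move=> t2; rewrite /m [X in Num.min _ X]min_r; last by lra.
  by rewrite min_r //; have := ival_le1 t; lra.
apply: (@reparam_homotopic (sphere_cat a (sphere_cat b c)) _ _
  (fun t => clamp (m t)) id).
- have ca (u v : R) : continuous (fun t : I => u * ival t + v).
    move=> t; apply: (@continuousD _ _ _ (fun t => u * ival t) (fun=> v)).
      by apply: (@continuousM _ _ (fun=> u) (@ival R));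
        [exact: cst_continuous|exact: cont_ival].
    exact: cst_continuous.
  have cm : continuous m.
    rewrite (_ : m = fun t => Num.min (2 * ival t + 0)
      (Num.min (1 * ival t + 4^-1) (2^-1 * ival t + 2^-1))); last first.
      by apply/funext => t; rewrite addr0 mul1r.
    have cmin (f g : I -> R) : continuous f -> continuous g ->
        continuous (fun t => Num.min (f t) (g t)).
      by move=> cf cg t; apply: continuous_min; [exact: cf|exact: cg].
    exact: cmin (ca _ _) (cmin _ _ (ca _ _) (ca _ _)).
  exact: cont_comp cm (@cont_clamp R).
- by move=> t.
- by rewrite m1 ival0 ?mulr0; [|lra].
- by rewrite m3 ival1; [rewrite clamp_ge1 //; lra|lra].
- by rewrite m1 ival0 ?mulr0; [left|lra].
- by rewrite m3 ival1; [rewrite clamp_ge1 //; [right|lra]|lra].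
- move=> s /=; rewrite /cat_fun /= /cat_fun !set_first_at !set_firstK.
  set t := s ord0; have t0 := ival_ge0 t; have t1 := ival_le1 t.
  have [t2|t2] := leP (ival t) 2^-1.
    rewrite ival_lo //; have [t4|t4] := leP (2 * ival t) 2^-1.
      have cmE : clamp (m t) = lo_half t.
        by rewrite m1 /lo_half ?addr0 //; lra.
      by rewrite cmE ival_lo // t4.
    have cmE : ival (clamp (m t)) = ival t + 4^-1.
      by rewrite m2 ?ival_clamp //; apply/andP; split; lra.
    rewrite cmE ifF; last by apply/negbTE; rewrite -ltNge; lra.
    have hE : ival (hi_half (clamp (m t))) = 2 * ival t - 2^-1.
      by rewrite ival_hi cmE; lra.
    rewrite hE ifT; last by lra.
    congr (b (set_first s _)); apply: ival_inj.
    have lE := ival_lo t2.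
    have h1 : 2^-1 <= ival (lo_half t) by rewrite lE; lra.
    have h2 : ival (hi_half (clamp (m t))) <= 2^-1 by rewrite hE; lra.
    by rewrite (ival_hi h1) (ival_lo h2) lE hE; lra.
  have cmE : ival (clamp (m t)) = 2^-1 * ival t + 2^-1.
    by rewrite m3 ?ival_clamp //; [apply/andP; split; lra|lra].
  rewrite cmE ifF; last by apply/negbTE; rewrite -ltNge; lra.
  have hE : hi_half (clamp (m t)) = t.
    by apply: ival_inj; rewrite ival_hi cmE; lra.
  by rewrite hE ifF //; apply/negbTE; rewrite -ltNge; lra.
- by move=> s; rewrite set_first_id.
Qed.

End Ops.
End GroupStructure.

Section GroupOnClasses.
Variables (R : realType) (k : nat) (X : topologicalType) (x : X).
Notation G := (homotopy_group R k.+1 x).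

Definition hg_mul (A B : G) : G := sphere_class (sphere_cat (repr A) (repr B)).
Definition hg_inv (A : G) : G := sphere_class (sphere_rev (repr A)).

Lemma hg_mulE (a b : sphere R k.+1 x) :
  hg_mul (sphere_class a) (sphere_class b) = sphere_class (sphere_cat a b).
Proof.
by apply/sphere_classP; apply: sphere_cat_homotopic; exact: repr_class.
Qed.

Lemma hg_invE (a : sphere R k.+1 x) :
  hg_inv (sphere_class a) = sphere_class (sphere_rev a).
Proof. by apply/sphere_classP; apply: sphere_rev_homotopic; exact: repr_class. Qed.

Lemma hg_mulA : associative hg_mul.
Proof.
move=> A B C; rewrite -[A]repr_classK -[B]repr_classK -[C]repr_classK.
by rewrite !hg_mulE; apply/sphere_classP; exact: sphere_catA.
Qed.

Lemma hg_mul1 : left_id (hg_base R k.+1 x) hg_mul.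
Proof.
move=> A; rewrite -[A]repr_classK hg_mulE.
by apply/sphere_classP; exact: sphere_cat1l.
Qed.

Lemma hg_mulr1 : right_id (hg_base R k.+1 x) hg_mul.
Proof.
move=> A; rewrite -[A]repr_classK hg_mulE.
by apply/sphere_classP; exact: sphere_cat1.
Qed.

Lemma hg_mulV : left_inverse (hg_base R k.+1 x) hg_inv hg_mul.
Proof.
move=> A; rewrite -[A]repr_classK hg_invE hg_mulE.
by apply/sphere_classP; exact: sphere_catVl.
Qed.

Lemma hg_mulrV : right_inverse (hg_base R k.+1 x) hg_inv hg_mul.
Proof.
move=> A; rewrite -[A]repr_classK hg_invE hg_mulE.
by apply/sphere_classP; exact: sphere_catV.
Qed.

HB.instance Definition _ :=
  isGroup.Build G hg_mulA hg_mul1 hg_mulr1 hg_mulV hg_mulrV.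

End GroupOnClasses.

Section InducedMaps.
Variables (R : realType) (k : nat) (X Y : topologicalType) (x : X) (y : Y).
Variable f : pointed_map x y.

Lemma sphere_map_cont (a : sphere R k x) : continuous (fun s => f (a s)).
Proof. exact: cont_comp (sphere_cont a) (pmap_cont f). Qed.

Lemma sphere_map_bdry (a : sphere R k x) s : cube_boundary s -> f (a s) = y.
Proof. by move=> bs; rewrite sphere_bdry // pmap_pt. Qed.

Definition sphere_map (a : sphere R k x) : sphere R k y :=
  Sphere (@sphere_map_cont a) (@sphere_map_bdry a).

Definition hg_map (A : homotopy_group R k x) : homotopy_group R k y :=
  sphere_class (sphere_map (repr A)).

Lemma hg_mapE (a : sphere R k x) :
  hg_map (sphere_class a) = sphere_class (sphere_map a).
Proof.
apply/sphere_classP; have [h [ch h0 h1 hb]] := repr_class a.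
exists (fun z => f (h z)); split.
- exact: cont_comp ch (pmap_cont f).
- by move=> s; rewrite h0.
- by move=> s; rewrite h1.
- by move=> s t bs; rewrite hb // pmap_pt.
Qed.

Lemma hg_map_base : hg_map (hg_base R k x) = hg_base R k y.
Proof.
rewrite hg_mapE; apply/sphere_classP; apply: sphere_homotopic_ext => s /=.
exact: pmap_pt.
Qed.

End InducedMaps.

Lemma hg_map_mul (R : realType) k (X Y : topologicalType) (x : X) (y : Y)
    (f : pointed_map x y) :
  {morph @hg_map R k.+1 X Y x y f : A B / (A * B)%g}.
Proof.
move=> A B; rewrite -[A]repr_classK -[B]repr_classK.
rewrite [(sphere_class _ * _)%g]hg_mulE !hg_mapE [RHS]hg_mulE.
apply/sphere_classP; apply: sphere_homotopic_ext => s /=.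
by rewrite /cat_fun; case: ifP.
Qed.

HB.instance Definition _ (R : realType) k (X Y : topologicalType) (x : X) (y : Y)
    (f : pointed_map x y) :=
  isMultiplicative.Build _ _ (@hg_map R k.+1 X Y x y f) (hg_map_mul f).

Lemma hg_map_comp (R : realType) k (X Y Z : topologicalType) (x : X) (y : Y)
    (z : Z) (f : pointed_map x y) (g : pointed_map y z) (h : pointed_map x z)
    (A : homotopy_group R k x) : (forall u, g (f u) = h u) ->
  hg_map g (hg_map f A) = hg_map h A.
Proof.
move=> gf; rewrite -[A]repr_classK !hg_mapE.
by apply/sphere_classP; apply: sphere_homotopic_ext => s /=.
Qed.

Definition threads (S : nat -> Type) (q : forall n, S n.+1 -> S n) :
  set (forall n, S n) := [set a | forall n, q n (a n.+1) = a n].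

Definition invlim (S : nat -> Type) (q : forall n, S n.+1 -> S n) : Type :=
  set_type (threads q).

HB.instance Definition _ (S : nat -> Type) (q : forall n, S n.+1 -> S n) :=
  gen_eqMixin (invlim q).
HB.instance Definition _ (S : nat -> Type) (q : forall n, S n.+1 -> S n) :=
  gen_choiceMixin (invlim q).

Section InverseLimit.
Variables (S : nat -> Type) (q : forall n, S n.+1 -> S n).

Definition lim_proj n (a : invlim q) : S n := val a n.

Lemma lim_projP n (a : invlim q) : q (lim_proj n.+1 a) = lim_proj n a.
Proof. exact: (set_valP a). Qed.

Definition mk_lim (a : forall n, S n) (aP : forall n, q (a n.+1) = a n) :
  invlim q := exist (fun a => a \in threads q) a (mem_set aP).

Lemma lim_eqP (a b : invlim q) : (forall n, lim_proj n a = lim_proj n b) -> a = b.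
Proof. by move=> ab; apply: val_inj; apply: functional_extensionality_dep. Qed.

End InverseLimit.

Section InverseLimitMap.
Variables (S T : nat -> Type) (q : forall n, S n.+1 -> S n)
  (r : forall n, T n.+1 -> T n) (f : forall n, S n -> T n).
Hypothesis fqr : forall n (s : S n.+1), r (f s) = f (q s).

Lemma lim_map_subproof (a : invlim q) n :
  r (f (lim_proj n.+1 a)) = f (lim_proj n a).
Proof. by rewrite fqr lim_projP. Qed.

Definition lim_map (a : invlim q) : invlim r := mk_lim (lim_map_subproof a).

End InverseLimitMap.

Lemma gmul1_mult (G H : groupType) (f : {multiplicative G -> H}) :
  f 1%g = 1%g.
Proof. by apply: (mulgI (f 1%g)); rewrite -gmulfM !mulg1. Qed.

Lemma gmulV_mult (G H : groupType) (f : {multiplicative G -> H}) g :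
  f (g^-1)%g = ((f g)^-1)%g.
Proof. by apply: (mulgI (f g)); rewrite -gmulfM !mulgV gmul1_mult. Qed.

Section GroupTower.
Variables (G : nat -> groupType) (q : forall n, {multiplicative G n.+1 -> G n}).
Local Open Scope group_scope.
Notation L := (@invlim G (fun n => q n)).

Lemma glim_mul_subproof (a b : L) n :
  q n (lim_proj n.+1 a * lim_proj n.+1 b) = lim_proj n a * lim_proj n b.
Proof. by rewrite gmulfM; congr (_ * _); exact: lim_projP. Qed.

Lemma glim_one_subproof n : q n 1 = 1. Proof. exact: gmul1_mult. Qed.

Lemma glim_inv_subproof (a : L) n :
  q n (lim_proj n.+1 a)^-1 = (lim_proj n a)^-1.
Proof. by rewrite gmulV_mult; congr (_^-1); exact: lim_projP. Qed.

Definition glim_mul (a b : L) : L := mk_lim (glim_mul_subproof a b).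
Definition glim_one : L := mk_lim glim_one_subproof.
Definition glim_inv (a : L) : L := mk_lim (glim_inv_subproof a).

Lemma glim_mulA : associative glim_mul.
Proof. by move=> a b c; apply: lim_eqP => n; exact: mulgA. Qed.
Lemma glim_mul1 : left_id glim_one glim_mul.
Proof. by move=> a; apply: lim_eqP => n; exact: mul1g. Qed.
Lemma glim_mulr1 : right_id glim_one glim_mul.
Proof. by move=> a; apply: lim_eqP => n; exact: mulg1. Qed.
Lemma glim_mulV : left_inverse glim_one glim_inv glim_mul.
Proof. by move=> a; apply: lim_eqP => n; exact: mulVg. Qed.
Lemma glim_mulrV : right_inverse glim_one glim_inv glim_mul.
Proof. by move=> a; apply: lim_eqP => n; exact: mulgV. Qed.

HB.instance Definition _ :=
  isGroup.Build L glim_mulA glim_mul1 glim_mulr1 glim_mulV glim_mulrV.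

Definition lim1_act (g h : forall n, G n) : forall n, G n :=
  fun n => g n * h n * q n (g n.+1)^-1.

Definition lim1_rel (h h' : forall n, G n) : bool :=
  `[< exists g, h' = lim1_act g h >].

Lemma lim1_refl : reflexive lim1_rel.
Proof.
move=> h; apply/asboolP; exists (fun=> 1); apply: functional_extensionality_dep => n.
by rewrite /lim1_act mul1g invg1 gmul1_mult mulg1.
Qed.

Lemma lim1_sym : symmetric lim1_rel.
Proof.
suff s h h' : lim1_rel h h' -> lim1_rel h' h by move=> h h'; apply/idP/idP; exact: s.
move=> /asboolP[g ->]; apply/asboolP; exists (fun n => (g n)^-1).
apply: functional_extensionality_dep => n.
by rewrite /lim1_act invgK !mulgA mulVg mul1g -mulgA -gmulfM mulVg gmul1_mult mulg1.
Qed.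

Lemma lim1_trans : transitive lim1_rel.
Proof.
move=> h h1 h2 /asboolP[g ->] /asboolP[g' ->]; apply/asboolP.
exists (fun n => g' n * g n); apply: functional_extensionality_dep => n.
by rewrite /lim1_act invgM gmulfM !mulgA.
Qed.

Canonical lim1_equiv := EquivRel lim1_rel lim1_refl lim1_sym lim1_trans.

Definition lim1 : Type := {eq_quot lim1_rel}.

HB.instance Definition _ := Quotient.copy lim1 {eq_quot lim1_rel}.
HB.instance Definition _ := Choice.copy lim1 {eq_quot lim1_rel}.

Definition lim1_class (h : forall n, G n) : lim1 := \pi h.

Lemma lim1_classP (h h' : forall n, G n) :
  lim1_class h = lim1_class h' <-> exists g, h' = lim1_act g h.
Proof.
split=> [|] hh; last by apply/eqmodP/asboolP.
by apply/asboolP; apply/(@eqmodP _ lim1_equiv).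
Qed.

Definition lim1_base : lim1 := lim1_class (fun=> 1).

(* For abelian G_n this is the group law of the cokernel of
   (g_n) |-> (g_n q(g_{n+1}^-1)). *)
Definition lim1_mul (A B : lim1) : lim1 :=
  lim1_class (fun n => repr A n * repr B n).

Lemma lim1_mulE (h h' : forall n, G n) :
  (forall n (u v : G n), commute u v) ->
  lim1_mul (lim1_class h) (lim1_class h') = lim1_class (fun n => h n * h' n).
Proof.
move=> cG.
have [g gE] := (lim1_classP _ _).1 (reprK (lim1_class h)).
have [g' gE'] := (lim1_classP _ _).1 (reprK (lim1_class h')).
apply/lim1_classP; exists (fun n => g n * g' n).
apply: functional_extensionality_dep => n; rewrite {1}gE {1}gE' /lim1_act.
move: (repr _ n) (repr _ n) => v u; rewrite invgM gmulfM.
move: (q _ _) (q _ _) => c' c; move: (g n) (g' n) => d d'.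
rewrite -!mulgA; congr (_ * _).
rewrite (cG _ c (d' * (v * c'))) -!mulgA.
by rewrite [LHS]mulgA (cG _ u d') -[LHS]mulgA.
Qed.

End GroupTower.

Definition fibration (R : realType) (E B : topologicalType) (p : E -> B) : Prop :=
  forall k (f : cube R k -> E) (h : cube R k * unit_interval R -> B),
    continuous f -> continuous h -> (forall s, h (s, I0 R) = p (f s)) ->
    exists H : cube R k * unit_interval R -> E,
      [/\ continuous H, forall s, H (s, I0 R) = f s & forall z, p (H z) = h z].

Record fibration_tower (R : realType) := FibrationTower {
  ft_space :> nat -> topologicalType;
  ft_map : forall n, ft_space n.+1 -> ft_space n;
  ft_cont : forall n, continuous (@ft_map n);
  ft_fib : forall n, fibration R (@ft_map n) }.

Arguments ft_map {R} _ {n}.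
Arguments ft_cont {R} _ _.

Section LimitSpace.
Variables (R : realType) (X : fibration_tower R).

(* The set of threads with the subspace topology of the product. *)
Definition lim_space : topologicalType :=
  set_type (threads (fun n => @ft_map R X n) : set (prod_topology (fun n => X n))).

Definition lim_coord (x : lim_space) n : X n := (val x : prod_topology (fun n => X n)) n.

Lemma coordP (x : lim_space) n : ft_map X (lim_coord x n.+1) = lim_coord x n.
Proof. exact: (set_valP x). Qed.

Lemma cont_lim_coord n : continuous (fun x : lim_space => lim_coord x n).
Proof.
have c0 : continuous (fun x : lim_space => val x : prod_topology (fun n => X n)).
  exact: cont_val.
exact: cont_comp c0 (@cont_coord nat (fun n => X n) n).
Qed.

Variable x : lim_space.

Definition proj_pmap n : pointed_map x (lim_coord x n) :=
  PointedMap (@cont_lim_coord n) erefl.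

Definition ft_pmap n : pointed_map (lim_coord x n.+1) (lim_coord x n) :=
  PointedMap (ft_cont X n) (coordP x n).

Definition hg_lim k : Type :=
  @invlim (fun n => homotopy_group R k (lim_coord x n))
    (fun n => hg_map (ft_pmap n)).

Lemma hg_lim_base_subproof k n :
  hg_map (ft_pmap n) (hg_base R k (lim_coord x n.+1)) = hg_base R k (lim_coord x n).
Proof. exact: hg_map_base. Qed.

Definition hg_lim_base k : hg_lim k := mk_lim (@hg_lim_base_subproof k).

Lemma hg_to_lim_subproof k (A : homotopy_group R k x) n :
  hg_map (ft_pmap n) (hg_map (proj_pmap n.+1) A) = hg_map (proj_pmap n) A.
Proof. by apply: hg_map_comp => u; exact: coordP. Qed.

Definition hg_to_lim k (A : homotopy_group R k x) : hg_lim k :=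
  mk_lim (hg_to_lim_subproof A).

Definition hg_lim1 k : Type :=
  @lim1 (fun n => homotopy_group R k.+1 (lim_coord x n))
    (fun n => hg_map (ft_pmap n)).

Definition hg_lim1_base k : hg_lim1 k := lim1_base _.
Definition hg_lim1_mul k : hg_lim1 k -> hg_lim1 k -> hg_lim1 k := @lim1_mul _ _.

End LimitSpace.

HB.instance Definition _ (R : realType) (X : fibration_tower R) (x : lim_space X) k :=
  Group.copy (hg_lim x k.+1)
    (@invlim (fun n => homotopy_group R k.+1 (lim_coord x n))
      (fun n => hg_map (ft_pmap x n))).

Record tower_map (R : realType) (X Y : fibration_tower R) (x : lim_space X)
    (y : lim_space Y) := TowerMap {
  tm_map :> forall n, pointed_map (lim_coord x n) (lim_coord y n);
  tm_comm : forall n (u : X n.+1),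
    ft_map Y (tm_map n.+1 u) = tm_map n (ft_map X u) }.

Section TowerMaps.
Variables (R : realType) (X Y : fibration_tower R).
Variables (x : lim_space X) (y : lim_space Y) (f : tower_map x y).

Definition lim_space_map (u : lim_space X) : lim_space Y :=
  @lim_map (fun n => X n) (fun n => Y n) _ _ (fun n => f n) (tm_comm f) u.

Lemma lim_space_map_cont : continuous lim_space_map.
Proof.
apply: cont_sub; apply: cont_prod => n.
exact: cont_comp (@cont_lim_coord R X n) (pmap_cont (f n)).
Qed.

Lemma lim_space_map_pt : lim_space_map x = y.
Proof. by apply: lim_eqP => n; exact: (pmap_pt (f n)). Qed.

Definition lim_pmap : pointed_map x y :=
  PointedMap lim_space_map_cont lim_space_map_pt.

Lemma hg_tower_comm k n (A : homotopy_group R k (lim_coord x n.+1)) :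
  hg_map (ft_pmap y n) (hg_map (f n.+1) A) = hg_map (f n) (hg_map (ft_pmap x n) A).
Proof.
have c : continuous (fun u => f n (ft_map X u)).
  exact: cont_comp (ft_cont X n) (pmap_cont (f n)).
have p : f n (ft_map X (lim_coord x n.+1)) = lim_coord y n by rewrite coordP pmap_pt.
rewrite (@hg_map_comp _ _ _ _ _ _ _ _ _ _ (PointedMap c p)); last exact: tm_comm.
by rewrite (@hg_map_comp _ _ _ _ _ _ _ _ _ _ (PointedMap c p)).
Qed.

Definition hg_lim_map k : hg_lim x k -> hg_lim y k :=
  lim_map (f := fun n => hg_map (f n)) (@hg_tower_comm k).

Definition hg_lim1_map k (A : hg_lim1 x k) : hg_lim1 y k :=
  lim1_class _ (fun n => hg_map (f n) (repr A n)).

Lemma hg_lim1_mapE k (h : forall n, homotopy_group R k.+1 (lim_coord x n)) :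
  hg_lim1_map (lim1_class _ h) = lim1_class _ (fun n => hg_map (f n) (h n)).
Proof.
have [g gE] := (lim1_classP _ _ _).1 (reprK (lim1_class _ h : hg_lim1 x k)).
apply/lim1_classP; exists (fun n => hg_map (f n) (g n)).
apply: functional_extensionality_dep => n.
rewrite {1}gE /lim1_act !gmulfM; congr (_ * _)%g.
transitivity (hg_map (ft_pmap y n) (hg_map (f n.+1) (g n.+1)^-1)%g).
  exact/esym/hg_tower_comm.
by congr (hg_map _ _); exact: gmulV_mult.
Qed.

End TowerMaps.

Definition short_exact (A B C : Type) (a0 : A) (b0 : B) (c0 : C)
    (i : A -> B) (P : B -> C) : Prop :=
  [/\ i a0 = b0, P b0 = c0, injective i, range i = P @^-1` [set c0]
    & range P = setT].

Definition is_group (T : Type) (mul : T -> T -> T) (e : T) : Prop :=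
  [/\ associative mul, left_id e mul, right_id e mul
    & exists inv : T -> T, left_inverse e inv mul /\ right_inverse e inv mul].

Definition is_abelian_group (T : Type) (mul : T -> T -> T) (e : T) : Prop :=
  is_group mul e /\ commutative mul.

Definition homotopic (R : realType) (A B : topologicalType) (f g : A -> B) : Prop :=
  exists h : A * unit_interval R -> B,
    [/\ continuous h, forall a, h (a, I0 R) = f a & forall a, h (a, I1 R) = g a].

Record hspace (R : realType) (X : topologicalType) (x : X) := HSpace {
  hs_mul :> X * X -> X;
  hs_cont : continuous hs_mul;
  hs_pt : hs_mul (x, x) = x;
  hs_unitl : homotopic R (fun u => hs_mul (x, u)) id;
  hs_unitr : homotopic R (fun u => hs_mul (u, x)) id }.

Section HMaps.
Variables (R : realType) (X Y : topologicalType) (x : X) (y : Y).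
Variables (f : pointed_map x y) (m : hspace R x) (m' : hspace R y).

Definition is_hmap : Prop :=
  homotopic R (fun u => f (m u)) (fun u => m' (f u.1, f u.2)).

Definition hmap_homotopy (h : (X * X) * unit_interval R -> Y) : Prop :=
  [/\ continuous h, forall u, h (u, I0 R) = f (m u)
    & forall u, h (u, I1 R) = m' (f u.1, f u.2)].

End HMaps.

Section PathComponents.
Variables (R : realType) (X : topologicalType) (x : X).

Lemma no_boundary (s : cube R 0) : ~ cube_boundary s.
Proof. by case; case. Qed.

Definition pt_sphere (u : X) : sphere R 0 x :=
  Sphere (@cst_continuous _ _ u) (fun s bs => False_ind _ (no_boundary bs)).

Definition pi0_class (u : X) : homotopy_group R 0 x := sphere_class (pt_sphere u).

Definition pi0_point (A : homotopy_group R 0 x) : X := repr A (fun=> I0 R).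

Lemma pi0_pointK A : pi0_class (pi0_point A) = A.
Proof.
rewrite -[RHS]repr_classK; apply/sphere_classP; apply: sphere_homotopic_ext => s.
by rewrite /pi0_point /=; congr (repr A _); apply/funext => -[].
Qed.

Variable m : hspace R x.

Definition pi0_mul (A B : homotopy_group R 0 x) : homotopy_group R 0 x :=
  pi0_class (m (pi0_point A, pi0_point B)).

Lemma pi0_mulE u v : pi0_mul (pi0_class u) (pi0_class v) = pi0_class (m (u, v)).
Proof.
have [h [ch h0 h1 _]] := repr_class (pt_sphere u).
have [g [cg g0 g1 _]] := repr_class (pt_sphere v).
apply/sphere_classP; exists (fun z => m (h z, g z)); split.
- exact: cont_comp (cont_pair ch cg) (@hs_cont _ _ _ m).
- move=> s; rewrite h0 g0 /= /pi0_point.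
  by rewrite (_ : s = fun=> I0 R) //; apply/funext => -[].
- by move=> s; rewrite h1 g1.
- by move=> s t /no_boundary.
Qed.

End PathComponents.

Section Paths.
Variables (R : realType) (X : topologicalType).
Implicit Types g : unit_interval R -> X.

Definition path_cat g g' : unit_interval R -> X :=
  fun t => if ival t <= 2^-1 then g (lo_half t) else g' (hi_half t).

Definition path_homotopic g g' : Prop :=
  exists h : unit_interval R * unit_interval R -> X,
    [/\ continuous h, forall s, h (s, I0 R) = g s, forall s, h (s, I1 R) = g' s
      & forall t, h (I0 R, t) = g (I0 R) /\ h (I1 R, t) = g (I1 R)].

End Paths.

Section LimitProduct.
Variables (R : realType) (X : fibration_tower R) (x : lim_space X).
Variable m : forall n, hspace R (lim_coord x n).

(* Homotopies exhibiting the maps of the tower as H-maps, normalized so that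
   the loop traced out by the base point is null-homotopic. *)
Definition hmap_homotopies
    (h : forall n, (X n.+1 * X n.+1) * unit_interval R -> X n) : Prop :=
  forall n, hmap_homotopy (ft_pmap x n) (m n.+1) (m n) (h n) /\
    path_homotopic (fun t => h n ((lim_coord x n.+1, lim_coord x n.+1), t))
                   (fun=> lim_coord x n).

Variable h : forall n, (X n.+1 * X n.+1) * unit_interval R -> X n.

(* Since the maps of the tower preserve the products only up to the homotopies
   [h], the sequence (u_n v_n) need not be a point of the limit.  The point w
   of the limit is a product of u and v when its coordinates are joined to
   u_n v_n by paths that match under the maps of the tower, up to [h].  If the
   maps of the tower are strictly multiplicative and the homotopies constant,
   then w = (u_n v_n) is a product, with constant paths. *)
Definition lim_product (u v w : lim_space X) : Prop :=
  exists g : forall n, unit_interval R -> X n, forall n,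
    [/\ continuous (g n), g n (I0 R) = lim_coord w n,
        g n (I1 R) = m n (lim_coord u n, lim_coord v n)
      & path_homotopic
          (path_cat (fun t => ft_map X (g n.+1 t))
                    (fun t => @h n ((lim_coord u n.+1, lim_coord v n.+1), t)))
          (g n)].

End LimitProduct.

(* Main.v *)
Require Import Defs.
From HB Require Import structures.
From mathcomp Require Import all_boot all_order all_algebra.
From mathcomp Require Import monoid.
From mathcomp Require Import all_classical all_reals all_analysis.
From mathcomp Require Import ring lra.

Set Implicit Arguments.
Unset Strict Implicit.
Unset Printing Implicit Defensive.

Import Order.TTheory GRing.Theory Num.Theory.
Import numFieldNormedType.Exports.

Local Open Scope classical_set_scope.
Local Open Scope ring_scope.

(** A k-sphere can be viewed as a point, and a homotopy of k-spheres relative to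
the boundary of the cube as a path, called a track here.  Tracks up to homotopy
relative to their ends form a groupoid.  Its isomorphism classes are the
elements of pi_k, and the automorphisms of the constant sphere are pi_(k+1)
[hg_arrow].  A fibration lifts arrows of this groupoid with prescribed source
[lift_arrow] and lifts homotopies of tracks [lift_track_homotopy]; both come
from homotopy lifting relative to the boundary of the cube [rel_lift].

Surjectivity of P: a coherent sequence of classes is turned into a coherent
sequence of spheres by lifting one homotopy after the other.  The kernel of P:
a sphere w of the limit is in the kernel when each of its coordinates w_n has a
contraction C_n.  If the C_n matched under the maps p of the tower, w would be
contractible; in general they miss by loops om_n with om_n p(C_(n+1)) = C_n.
Other contractions g_n C_n replace om_n by g_n om_n p(g_(n+1))^-1, which is
the action that defines lim^1.  Every sequence om occurs, by successive
lifting [represents_ex], and two sequences are in the same orbit exactly when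
their spheres are homotopic [represents_class].  The map iota sends the class
of om to the class of w.  The step from coordinatewise homotopies to a homotopy
in the limit is [lim_arrow].

For k >= 1, the product of spheres is a juxtaposition that commutes with the
concatenation of tracks, so that contractions can be juxtaposed, and the
Eckmann-Hilton argument identifies the juxtaposition of loops with their product
[hg_arrow_jux].

For H-spaces and k = 0, products of paths play the role of juxtaposition.  The
homotopies h_n that make the maps of the tower H-maps are natural in paths
[hmap_natural].  Hence, if C and C' contract the coordinates of u and v, and
the paths G_n join a product w of u and v to the points u_n v_n, then the
paths (C_n C'_n) G_n^-1 contract w and miss being compatible by the products
of the loops of u and v [represents_product].  This needs the base point to
run through a null-homotopic loop under h_n; since an H-space has, for every
loop, a homotopy of the identity to itself under which the base point runs
through that loop [self_homotopy], such homotopies exist. *)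

(** * Continuity of real functions and coordinates of cubes *)

Section RealFunctions.
Variables (R : realType) (A : topologicalType).
Implicit Types f g : A -> R.

Lemma cont_addr f g : continuous f -> continuous g ->
  continuous (fun a => f a + g a).
Proof. by move=> cf cg a; apply: continuousD; [exact: cf|exact: cg]. Qed.

Lemma cont_mulr f g : continuous f -> continuous g ->
  continuous (fun a => f a * g a).
Proof. by move=> cf cg a; apply: continuousM; [exact: cf|exact: cg]. Qed.

Lemma cont_oppr f : continuous f -> continuous (fun a => - f a).
Proof. by move=> cf a; apply: continuousN; exact: cf. Qed.

Lemma cont_invr f : (forall a, f a != 0) -> continuous f ->
  continuous (fun a => (f a)^-1).
Proof. by move=> f0 cf a; apply: continuousV; [exact: f0|exact: cf]. Qed.

Lemma cont_maxr f g : continuous f -> continuous g ->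
  continuous (fun a => Num.max (f a) (g a)).
Proof. by move=> cf cg a; apply: continuous_max; [exact: cf|exact: cg]. Qed.

Lemma cont_minr f g : continuous f -> continuous g ->
  continuous (fun a => Num.min (f a) (g a)).
Proof. by move=> cf cg a; apply: continuous_min; [exact: cf|exact: cg]. Qed.

Lemma cont_absr f : continuous f -> continuous (fun a => `|f a|).
Proof. by move=> cf; exact: cont_comp cf (@norm_continuous _ R). Qed.

Lemma cont_bigmaxr (J : Type) (r : seq J) (f : J -> A -> R) :
  (forall j, continuous (f j)) ->
  continuous (fun a => \big[Num.max/0]_(j <- r) f j a).
Proof.
move=> cf; elim: r => [|j r IH].
  by under eq_fun do rewrite big_nil; exact: cst_continuous.
by under eq_fun do rewrite big_cons; exact: cont_maxr.
Qed.

End RealFunctions.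

Section Cubes.
Variables (R : realType) (k : nat).
Notation I := (unit_interval R).

Definition cube_cons (t : I) (s : cube R k) : cube R k.+1 :=
  fun i => if unlift ord0 i is Some j then s j else t.

Definition cube_tail (s : cube R k.+1) : cube R k := fun j => s (lift ord0 j).

Lemma cube_cons0 t s : cube_cons t s ord0 = t.
Proof. by rewrite /cube_cons unlift_none. Qed.

Lemma cube_consS t s j : cube_cons t s (lift ord0 j) = s j.
Proof. by rewrite /cube_cons liftK. Qed.

Lemma cube_tail_cons t s : cube_tail (cube_cons t s) = s.
Proof. by apply/funext => j; rewrite /cube_tail cube_consS. Qed.

Lemma cube_cons_tail s : cube_cons (s ord0) (cube_tail s) = s.
Proof.
by apply/funext => i; rewrite /cube_cons; case: unliftP => [j|] ->.
Qed.

Lemma set_first_cons u t s : set_first (cube_cons t s) u = cube_cons u s.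
Proof.
by apply/funext => i; rewrite /set_first /cube_cons; case: unliftP => [j|] ->.
Qed.

Lemma cont_cube_cons (A : topologicalType) (f : A -> I) (g : A -> cube R k) :
  continuous f -> continuous g -> continuous (fun a => cube_cons (f a) (g a)).
Proof.
move=> cf cg; apply: (@cont_prod 'I_k.+1 (fun=> I)) => i.
rewrite /cube_cons; case: unliftP => [j|] _ //.
exact: cont_comp cg (@cont_coord _ (fun _ : 'I_k => I) j).
Qed.

Lemma cont_cube_tail : continuous cube_tail.
Proof.
apply: (@cont_prod 'I_k (fun=> I)) => j.
exact: (@cont_coord _ (fun _ : 'I_k.+1 => I) (lift ord0 j)).
Qed.

Lemma cube_cons_bdry t s :
  cube_boundary (cube_cons t s) <-> endpoint t \/ cube_boundary s.
Proof.
split.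
  move=> [i]; rewrite /cube_cons; case: unliftP => [j|] _ si; last by left.
  by right; exists j.
move=> [et|[j sj]]; first by exists ord0; rewrite cube_cons0.
by exists (lift ord0 j); rewrite cube_consS.
Qed.

End Cubes.

(** * Homotopy lifting relative to the boundary of a cube *)

Section RelativeLifting.
Variable R : realType.
Notation I := (unit_interval R).

Section Projection.
Variable k : nat.
Notation Y := (cube R k * I)%type.
Implicit Types (s : cube R k) (y : Y) (u : I).

(** Distance to the center in the maximum norm; it is 1/2 on the boundary. *)
Definition center_dist s : R := \big[Num.max/0]_(i < k) `|ival (s i) - 2^-1|.

(** The open box is the bottom of the cylinder together with its sides.  The
factor [1 / open_box_gauge y] stretches the segment from the point of height 2
above the center to [y] until it meets the open box, where the gauge is 1. *)
Definition open_box_gauge y : R :=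
  Num.max (1 - ival y.2 / 2) (2 * center_dist y.1).

Definition box_scale y u : R := Num.min 1 (open_box_gauge y + ival u).

(** Movement along the rays that come from the point of height 2 above the
center: it starts on the open box and rests at [y] from time
[1 - open_box_gauge y] on. *)
Definition box_push y u : Y :=
  (fun i => clamp (2^-1 + (ival (y.1 i) - 2^-1) / box_scale y u),
   clamp (2 - (2 - ival y.2) / box_scale y u)).

Lemma center_dist_ge s i : `|ival (s i) - 2^-1| <= center_dist s.
Proof. by rewrite /center_dist (bigD1 i) //= le_max lexx. Qed.

Lemma center_dist_half s : center_dist s <= 2^-1.
Proof.
apply: (big_ind (fun r : R => r <= 2^-1)) => [|a b a0 b0|i _].
- by rewrite invr_ge0.
- by rewrite ge_max a0.
by have := ival_ge0 (s i); have := ival_le1 (s i) => ? ?;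
  rewrite ler_norml; apply/andP; split; lra.
Qed.

Lemma center_dist_attained s : 0 < center_dist s ->
  exists i, center_dist s = `|ival (s i) - 2^-1|.
Proof.
suff : center_dist s = 0 \/ exists i, center_dist s = `|ival (s i) - 2^-1|.
  by move=> [->|//]; rewrite ltxx.
apply: (big_ind (fun r : R => r = 0 \/ exists i, r = `|ival (s i) - 2^-1|)).
- by left.
- by move=> a b Ka Kb; have [_|_] := leP a b.
by move=> i _; right; exists i.
Qed.

Lemma gauge_half y : 2^-1 <= open_box_gauge y.
Proof. by rewrite le_max; apply/orP; left; have := ival_le1 y.2; lra. Qed.

Lemma gauge_le1 y : open_box_gauge y <= 1.
Proof.
by rewrite ge_max; have := ival_ge0 y.2; have := center_dist_half y.1 => ? ?;
  apply/andP; split; lra.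
Qed.

Lemma gauge_bottom y : y.2 = I0 R -> open_box_gauge y = 1.
Proof.
move=> y0; apply/eqP; rewrite eq_le gauge_le1 /= le_max y0 ival0.
by apply/orP; left; lra.
Qed.

Lemma gauge_bdry y : cube_boundary y.1 -> open_box_gauge y = 1.
Proof.
move=> [i yi]; apply/eqP; rewrite eq_le gauge_le1 /= le_max; apply/orP; right.
have := center_dist_ge y.1 i.
have -> : `|ival (y.1 i) - 2^-1| = 2^-1.
  case: yi => ->; rewrite ?ival0 ?ival1 ?sub0r ?normrN ger0_norm ?invr_ge0 //; lra.
lra.
Qed.

Lemma scale_half y u : 2^-1 <= box_scale y u.
Proof.
by rewrite le_min; have := gauge_half y; have := ival_ge0 u => ? ?;
  apply/andP; split; lra.
Qed.

Lemma scale_neq0 y u : box_scale y u != 0.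
Proof. by have := scale_half y u => ?; apply: lt0r_neq0; lra. Qed.

Lemma scale0 y : box_scale y (I0 R) = open_box_gauge y.
Proof. by rewrite /box_scale ival0 addr0 min_r ?gauge_le1. Qed.

Lemma box_push_id y u : box_scale y u = 1 -> box_push y u = y.
Proof.
move=> N1; rewrite /box_push N1 divr1 [RHS]surjective_pairing; congr pair.
  apply/funext => i; rewrite divr1 addrC subrK; exact: clamp_ival.
by rewrite opprB addrC subrK clamp_ival.
Qed.

(** The maximum that defines the gauge is attained by the height or by some
coordinate of the cube; that coordinate is the one that becomes extreme. *)
Lemma box_push0 y : (box_push y (I0 R)).2 = I0 R \/ cube_boundary (box_push y (I0 R)).1.
Proof.
rewrite /box_push /= scale0; set M := open_box_gauge y.
have M2 := gauge_half y; rewrite -/M in M2.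
have M0 : M != 0 by apply: lt0r_neq0; lra.
have [Me|Me] := leP (2 * center_dist y.1) (1 - ival y.2 / 2).
  left; have {}Me : M = 1 - ival y.2 / 2 by rewrite /M /open_box_gauge max_l.
  have e : (2 - ival y.2) = 2 * M by rewrite Me; lra.
  by rewrite e mulfK // subrr; apply: clamp_le0.
right; have {}Me : M = 2 * center_dist y.1.
  by rewrite /M /open_box_gauge max_r // ltW.
have [|i iE] := @center_dist_attained y.1; first lra.
have ME : M = 2 * `|ival (y.1 i) - 2^-1| by rewrite -iE.
exists i => /=; have [i0|i0] := leP 0 (ival (y.1 i) - 2^-1).
  rewrite ger0_norm // in ME; right; apply: clamp_ge1.
  have -> : ival (y.1 i) - 2^-1 = 2^-1 * M by lra.
  by rewrite mulfK //; lra.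
rewrite ltr0_norm // in ME; left; apply: clamp_le0.
have -> : ival (y.1 i) - 2^-1 = - 2^-1 * M by lra.
by rewrite mulfK //; lra.
Qed.

Lemma cont_gauge : continuous open_box_gauge.
Proof.
have c1 : continuous (fun y : Y => ival y.2).
  exact: cont_comp (@cont_snd _ _) (@cont_ival R).
have cc (r : R) : continuous (fun _ : Y => r) by exact: cst_continuous.
apply: cont_maxr; first by apply: cont_addr => //; apply/cont_oppr/cont_mulr.
apply: cont_mulr => //; apply: cont_bigmaxr => i.
apply: cont_absr; apply: cont_addr => //.
apply: cont_comp (@cont_ival R).
exact: cont_comp (@cont_fst _ _) (@cont_coord _ (fun _ : 'I_k => I) i).
Qed.

Lemma cont_box_push : continuous (fun z : Y * I => box_push z.1 z.2).
Proof.
have c1 : continuous (fun z : Y * I => ival z.2).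
  exact: cont_comp (@cont_snd _ _) (@cont_ival R).
have c2 : continuous (fun z : Y * I => ival z.1.2).
  apply: cont_comp (@cont_ival R).
  exact: cont_comp (@cont_fst _ _) (@cont_snd _ _).
have cc (r : R) : continuous (fun _ : Y * I => r) by exact: cst_continuous.
have cN : continuous (fun z : Y * I => (box_scale z.1 z.2)^-1).
  apply: cont_invr => [z|]; first exact: scale_neq0.
  apply: cont_minr => //; apply: cont_addr => //.
  exact: cont_comp (@cont_fst _ _) cont_gauge.
apply: cont_pair.
  apply: (@cont_prod 'I_k (fun=> I)) => i; apply: cont_comp (@cont_clamp R).
  apply: cont_addr => //; apply: cont_mulr => //; apply: cont_addr => //.
  apply: cont_comp (@cont_ival R).
  have c3 : continuous (fun z : Y * I => z.1.1).
    exact: cont_comp (@cont_fst _ _) (@cont_fst _ _).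
  exact: cont_comp c3 (@cont_coord _ (fun _ : 'I_k => I) i).
apply: cont_comp (@cont_clamp R).
by apply: cont_addr => //; apply/cont_oppr/cont_mulr => //; apply/cont_addr/cont_oppr.
Qed.

End Projection.

(** The plain lifting property, in dimension [k.+1], is applied to the homotopy
[K] pulled back along [box_push]: at time 0 it lies over the open box, where
the lift is prescribed by [a].  The lift of [K] at [y] is read off at the time at
which the pushed point arrives at [y]; on the open box this is time 0. *)
Lemma rel_lift (E B : topologicalType) (p : E -> B) k
    (a : cube R k -> E) (K : cube R k * I -> B) :
  fibration R p -> continuous a -> continuous K ->
  (forall s, K (s, I0 R) = p (a s)) ->
  (forall s t, cube_boundary s -> K (s, t) = p (a s)) ->
  exists H : cube R k * I -> E,
    [/\ continuous H, forall s, H (s, I0 R) = a s, forall z, p (H z) = K z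
      & forall s t, cube_boundary s -> H (s, t) = a s].
Proof.
move=> fp ca cK K0 Kb.
pose y (s : cube R k.+1) : cube R k * I := (cube_tail s, s ord0).
have cy : continuous y by apply: cont_pair; [exact: cont_cube_tail|exact: cont_first].
pose r (z : cube R k.+1 * I) := box_push (y z.1) z.2.
have cr : continuous r.
  have c : continuous (fun z : cube R k.+1 * I => (y z.1, z.2)).
    apply: cont_pair; last exact: cont_snd.
    exact: cont_comp (@cont_fst _ _) cy.
  exact: cont_comp c (@cont_box_push k).
have c0 : continuous (fun s => a (r (s, I0 R)).1).
  apply: cont_comp ca; apply: cont_comp (@cont_fst _ _); apply: cont_comp cr.
  by apply: cont_pair; [move=> s|exact: cst_continuous].
have [|G [cG G0 pG]] := fp _ _ _ c0 (cont_comp cr cK).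
  move=> s; rewrite /r /=; case: (box_push0 (y s)) => [b2|b1]; last first.
    by rewrite [X in K X]surjective_pairing Kb.
  by rewrite [X in K X]surjective_pairing b2 K0.
pose time (z : cube R k * I) : I := clamp (1 - open_box_gauge z).
have timeE z : ival (time z) = 1 - open_box_gauge z.
  rewrite ival_clamp //; have := gauge_half z; have := gauge_le1 z => ? ?.
  by apply/andP; split; lra.
pose cons (z : cube R k * I) := cube_cons z.2 z.1.
have consK z : y (cons z) = z.
  by rewrite /y /cons cube_tail_cons cube_cons0 -surjective_pairing.
have rE z : r (cons z, time z) = z.
  rewrite /r consK; apply: box_push_id.
  by rewrite /box_scale timeE addrC subrK minxx.
have box z : open_box_gauge z = 1 -> G (cons z, time z) = a z.1.
  move=> z1; have t0 : time z = I0 R by apply: ival_inj; rewrite timeE z1 ival0 subrr.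
  by rewrite t0 G0 -t0 rE.
exists (fun z => G (cons z, time z)); split.
- apply: cont_comp cG; apply: cont_pair.
    by apply: cont_cube_cons; [exact: cont_snd|exact: cont_fst].
  apply: cont_comp (@cont_clamp R); apply: cont_addr; first exact: cst_continuous.
  exact: cont_oppr (@cont_gauge k).
- by move=> s; rewrite box // gauge_bottom.
- by move=> z; rewrite pG rE.
- by move=> s t bs; rewrite box // gauge_bdry.
Qed.

End RelativeLifting.

(** * Homotopies of spheres as paths *)

Section Tracks.
Variables (R : realType) (k : nat).
Notation I := (unit_interval R).
Notation T := (cube R k).

Section InSpace.
Variable X : topologicalType.
Implicit Types H L : T * I -> X.

(** Stationary boundary values, instead of values at a base point, let the notion
apply between any maps on the cube and make it stable under continuous maps. *)
Definition is_track H : Prop :=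
  continuous H /\ forall s t, cube_boundary s -> H (s, t) = H (s, I0 R).

Definition track_homotopic H L : Prop :=
  exists K : (T * I) * I -> X,
    [/\ continuous K, forall z, K (z, I0 R) = H z, forall z, K (z, I1 R) = L z,
        forall s t u, cube_boundary s -> K ((s, t), u) = H (s, I0 R)
      & forall s t u, endpoint t -> K ((s, t), u) = H (s, t)].

Definition tcat H L (z : T * I) : X :=
  if ival z.2 <= 2^-1 then H (z.1, lo_half z.2) else L (z.1, hi_half z.2).

Definition trev H (z : T * I) : X := H (z.1, flip z.2).

Lemma homotopic_trackl H L : track_homotopic H L -> is_track H.
Proof.
move=> [K [cK K0 K1 Kb _]]; split; last by move=> s t bs; rewrite -K0 Kb.
have -> : H = fun z => K (z, I0 R) by apply/funext => z.
by apply: cont_comp cK; apply: cont_pair; [move=> z|exact: cst_continuous].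
Qed.

Lemma track_homotopic_sym H L : track_homotopic H L -> track_homotopic L H.
Proof.
move=> [K [cK K0 K1 Kb Ke]]; exists (fun z => K (z.1, flip z.2)); split.
- apply: cont_comp cK; apply: cont_pair; first exact: cont_fst.
  exact: cont_comp (@cont_snd _ _) (@cont_flip R).
- by move=> z; rewrite /= flip0.
- by move=> z; rewrite /= flip1.
- by move=> s t u bs /=; rewrite -K1 !Kb.
- by move=> s t u et /=; rewrite -K1 !Ke.
Qed.

Lemma homotopic_trackr H L : track_homotopic H L -> is_track L.
Proof. by move=> /track_homotopic_sym/homotopic_trackl. Qed.

Lemma track_homotopic_end H L s t : track_homotopic H L -> endpoint t ->
  H (s, t) = L (s, t).
Proof. by move=> [K [cK K0 K1 Kb Ke]] et; rewrite -K1 Ke. Qed.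

Lemma track_homotopic_refl H : is_track H -> track_homotopic H H.
Proof.
move=> [cH Hb]; exists (fun z => H z.1); split=> // [|s t u].
- exact: cont_comp (@cont_fst _ _) cH.
- exact: Hb.
Qed.

Lemma track_homotopic_trans L H N :
  track_homotopic H L -> track_homotopic L N -> track_homotopic H N.
Proof.
move=> [K [cK K0 K1 Kb Ke]] [M [cM M0 M1 Mb Me]].
have KMb s : cube_boundary s -> L (s, I0 R) = H (s, I0 R).
  by move=> bs; rewrite -K1 Kb.
exists (fun z => if ival z.2 <= 2^-1 then K (z.1, lo_half z.2)
                 else M (z.1, hi_half z.2)); split.
- apply: cont_glue_half.
  + apply: cont_comp cK; apply: cont_pair; first exact: cont_fst.
    exact: cont_comp (@cont_snd _ _) (@cont_lo R).
  + apply: cont_comp cM; apply: cont_pair; first exact: cont_fst.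
    exact: cont_comp (@cont_snd _ _) (@cont_hi R).
  + exact: cont_snd.
  + by move=> [s t] /= t2; rewrite lo_half1 // hi_half0 // K1 M0.
- by move=> s /=; rewrite half_I0 lo0 K0.
- by move=> s /=; rewrite half_I1 hi1 M1.
- by move=> s t u bs /=; case: ifP => _; [rewrite Kb|rewrite Mb ?KMb].
- by move=> s t u et /=; case: ifP => _; [rewrite Ke|rewrite Me // -K1 Ke].
Qed.

(** Linear interpolation between the two reparametrizations. *)
Lemma track_reparam (F : T * (R * R) -> X) (phi psi : I -> R * R) :
  continuous F -> (forall s q q', cube_boundary s -> F (s, q) = F (s, q')) ->
  continuous phi -> continuous psi ->
  phi (I0 R) = psi (I0 R) -> phi (I1 R) = psi (I1 R) ->
  track_homotopic (fun z => F (z.1, phi z.2)) (fun z => F (z.1, psi z.2)).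
Proof.
move=> cF Fb cphi cpsi e0 e1.
pose mx (a b : R) (u : I) := (1 - ival u) * a + ival u * b.
have mx0 a b : mx a b (I0 R) = a by rewrite /mx ival0; ring.
have mx1 a b : mx a b (I1 R) = b by rewrite /mx ival1; ring.
have mxx a u : mx a a u = a by rewrite /mx; ring.
have cmx (f g : I -> R) : continuous f -> continuous g ->
    continuous (fun z : (T * I) * I => mx (f z.1.2) (g z.1.2) z.2).
  move=> cf cg.
  have c1 : continuous (fun z : (T * I) * I => ival z.2).
    exact: cont_comp (@cont_snd _ _) (@cont_ival R).
  have c2 h : continuous h -> continuous (fun z : (T * I) * I => h z.1.2 : R).
    have c : continuous (fun z : (T * I) * I => z.1.2).
      exact: cont_comp (@cont_fst _ _) (@cont_snd _ _).
    by move=> ch; exact: cont_comp c ch.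
  apply: cont_addr; apply: cont_mulr => //; try exact: c2.
  by apply: cont_addr; [exact: cst_continuous|exact: cont_oppr].
exists (fun z => F (z.1.1, (mx (phi z.1.2).1 (psi z.1.2).1 z.2,
                            mx (phi z.1.2).2 (psi z.1.2).2 z.2))); split.
- apply: cont_comp cF; apply: cont_pair.
    exact: cont_comp (@cont_fst _ _) (@cont_fst _ _).
  apply: cont_pair.
    exact: cmx (cont_comp cphi (@cont_fst _ _)) (cont_comp cpsi (@cont_fst _ _)).
  exact: cmx (cont_comp cphi (@cont_snd _ _)) (cont_comp cpsi (@cont_snd _ _)).
- by move=> z /=; rewrite !mx0 -surjective_pairing.
- by move=> z /=; rewrite !mx1 -surjective_pairing.
- by move=> s t u bs /=; exact: Fb.
- by move=> s t u [] -> /=; rewrite -?e0 -?e1 !mxx -surjective_pairing.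
Qed.

Lemma track_reparam1 (F : T * R -> X) (phi psi : I -> R) :
  continuous F -> (forall s q q', cube_boundary s -> F (s, q) = F (s, q')) ->
  continuous phi -> continuous psi ->
  phi (I0 R) = psi (I0 R) -> phi (I1 R) = psi (I1 R) ->
  track_homotopic (fun z => F (z.1, phi z.2)) (fun z => F (z.1, psi z.2)).
Proof.
move=> cF Fb cphi cpsi e0 e1.
have cp (f : I -> R) : continuous f -> continuous (fun t => (f t, 0 : R)).
  by move=> cf; apply: cont_pair => //; exact: cst_continuous.
apply: (@track_reparam (fun z => F (z.1, z.2.1)) (fun t => (phi t, 0))
  (fun t => (psi t, 0))); try exact: cp.
- apply: cont_comp cF; apply: cont_pair; first exact: cont_fst.
  exact: cont_comp (@cont_snd _ _) (@cont_fst _ _).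
- by move=> s q q'; exact: Fb.
- by rewrite e0.
- by rewrite e1.
Qed.

(** Extension by the end values, so that parameters may be any reals. *)
Definition extend H (z : T * R) : X := H (z.1, clamp z.2).

Lemma cont_extend H : continuous H -> continuous (extend H).
Proof.
move=> cH; apply: cont_comp cH; apply: cont_pair; first exact: cont_fst.
exact: cont_comp (@cont_snd _ _) (@cont_clamp R).
Qed.

Lemma extend_bdry H : is_track H ->
  forall s q q', cube_boundary s -> extend H (s, q) = extend H (s, q').
Proof. by move=> [_ Hb] s q q' bs; rewrite /extend /= Hb // [RHS]Hb. Qed.

Lemma tcat_track H L : is_track H -> is_track L ->
  (forall s, H (s, I1 R) = L (s, I0 R)) -> is_track (tcat H L).
Proof.
move=> [cH Hb] [cL Lb] e; split.
  apply: cont_glue_half.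
  - apply: cont_comp cH; apply: cont_pair; first exact: cont_fst.
    exact: cont_comp (@cont_snd _ _) (@cont_lo R).
  - apply: cont_comp cL; apply: cont_pair; first exact: cont_fst.
    exact: cont_comp (@cont_snd _ _) (@cont_hi R).
  - exact: cont_snd.
  - by move=> [s t] /= t2; rewrite lo_half1 // hi_half0 // e.
move=> s t bs; rewrite /tcat /= half_I0 lo0; case: ifP => _; first exact: Hb.
by rewrite Lb // -e Hb.
Qed.

Lemma tcat0 H L s : tcat H L (s, I0 R) = H (s, I0 R).
Proof. by rewrite /tcat /= half_I0 lo0. Qed.

Lemma tcat1 H L s : tcat H L (s, I1 R) = L (s, I1 R).
Proof. by rewrite /tcat /= half_I1 hi1. Qed.

Lemma trev_track H : is_track H -> is_track (trev H).
Proof.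
move=> [cH Hb]; split.
  apply: cont_comp cH; apply: cont_pair; first exact: cont_fst.
  exact: cont_comp (@cont_snd _ _) (@cont_flip R).
by move=> s t bs; rewrite /trev /= Hb // [RHS]Hb.
Qed.

Lemma trev0 H s : trev H (s, I0 R) = H (s, I1 R).
Proof. by rewrite /trev /= flip0. Qed.

Lemma trev1 H s : trev H (s, I1 R) = H (s, I0 R).
Proof. by rewrite /trev /= flip1. Qed.

Lemma tcat_homotopic H H' L L' :
  track_homotopic H H' -> track_homotopic L L' ->
  (forall s, H (s, I1 R) = L (s, I0 R)) ->
  track_homotopic (tcat H L) (tcat H' L').
Proof.
move=> hH hL e; have tH := homotopic_trackl hH; have tL := homotopic_trackl hL.
have [_ bdcat] := tcat_track tH tL e.
move: hH hL => [K [cK K0 K1 Kb Ke]] [M [cM M0 M1 Mb Me]].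
exists (fun z => if ival z.1.2 <= 2^-1 then K ((z.1.1, lo_half z.1.2), z.2)
                 else M ((z.1.1, hi_half z.1.2), z.2)).
have c1 : continuous (fun z : (T * I) * I => z.1.1).
  exact: cont_comp (@cont_fst _ _) (@cont_fst _ _).
have c2 : continuous (fun z : (T * I) * I => z.1.2).
  exact: cont_comp (@cont_fst _ _) (@cont_snd _ _).
split.
- apply: cont_glue_half.
  + apply: cont_comp cK; apply: cont_pair; last exact: cont_snd.
    apply: cont_pair => //; exact: cont_comp c2 (@cont_lo R).
  + apply: cont_comp cM; apply: cont_pair; last exact: cont_snd.
    apply: cont_pair => //; exact: cont_comp c2 (@cont_hi R).
  + exact: c2.
  + move=> [[s t] u] /= t2; rewrite lo_half1 // hi_half0 //.
    by rewrite Ke ?Me //; [left|right].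
- by move=> [s t] /=; rewrite K0 M0.
- by move=> [s t] /=; rewrite K1 M1.
- move=> s t u bs /=; rewrite tcat0; case: ifP => _; first by rewrite Kb.
  by rewrite Mb // -e (proj2 tH).
- move=> s t u et /=; rewrite /tcat /=; case: ifP => _.
    by rewrite Ke //; exact: lo_endpoint.
  by rewrite Me //; exact: hi_endpoint.
Qed.

Lemma trev_homotopic H L : track_homotopic H L ->
  track_homotopic (trev H) (trev L).
Proof.
move=> hH; have [_ tH] := homotopic_trackl hH.
move: hH => [K [cK K0 K1 Kb Ke]].
exists (fun z => K ((z.1.1, flip z.1.2), z.2)); split.
- apply: cont_comp cK; apply: cont_pair; last exact: cont_snd.
  apply: cont_pair; first exact: cont_comp (@cont_fst _ _) (@cont_fst _ _).
  have c2 : continuous (fun z : (T * I) * I => z.1.2).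
    exact: cont_comp (@cont_fst _ _) (@cont_snd _ _).
  exact: cont_comp c2 (@cont_flip R).
- by move=> [s t] /=; rewrite K0.
- by move=> [s t] /=; rewrite K1.
- by move=> s t u bs /=; rewrite Kb // trev0 tH.
- by move=> s t u et /=; rewrite Ke //; exact: flip_endpoint.
Qed.

Lemma cont_affine_ival (u v : R) : continuous (fun t : I => u * ival t + v).
Proof.
apply: cont_addr; last exact: cst_continuous.
by apply: cont_mulr; [exact: cst_continuous|exact: cont_ival].
Qed.

Lemma tcatA H L N : is_track H -> is_track L -> is_track N ->
  (forall s, H (s, I1 R) = L (s, I0 R)) -> (forall s, L (s, I1 R) = N (s, I0 R)) ->
  track_homotopic (tcat H (tcat L N)) (tcat (tcat H L) N).
Proof.
move=> tH tL tN eHL eLN.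
(* The three tracks, one after the other, over the interval [0, 3]; the two
   bracketings run through it by different piecewise linear functions. *)
pose F (z : T * R) : X := if z.2 - 1 <= 0 then extend H z else
  if z.2 - 2 <= 0 then extend L (z.1, z.2 - 1) else extend N (z.1, z.2 - 2).
have cshift r : continuous (fun z : T * R => z.2 - r).
  by apply: cont_addr; [exact: cont_snd|exact: cst_continuous].
have cpair r : continuous (fun z : T * R => (z.1, z.2 - r)).
  by apply: cont_pair => //; exact: cont_fst.
have cF : continuous F.
  apply: cont_glue => //; first exact: cont_extend (proj1 tH).
  - apply: cont_glue => //.
    + exact: cont_comp (cpair _) (cont_extend (proj1 tL)).
    + exact: cont_comp (cpair _) (cont_extend (proj1 tN)).
    + move=> [s r] /= r2; have -> : r = 2 by lra.
      rewrite /extend /= clamp_ge1; last by lra.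
      by rewrite clamp_le0; [exact: eLN|lra].
  - move=> [s r] /= r1; have -> : r = 1 by lra.
    rewrite ifT; last by lra.
    rewrite /extend /= clamp_ge1; last by lra.
    by rewrite clamp_le0; [exact: eHL|lra].
have Fb s q q' : cube_boundary s -> F (s, q) = F (s, q').
  move=> bs; have N0 q1 : F (s, q1) = H (s, I0 R).
    rewrite /F /extend /=; case: ifP => _; first by rewrite (proj2 tH).
    have LE : L (s, I0 R) = H (s, I0 R) by rewrite -eHL (proj2 tH).
    case: ifP => _; first by rewrite (proj2 tL).
    by rewrite (proj2 tN) // -eLN (proj2 tL).
  by rewrite !N0.
pose phi (t : I) := Num.max (2 * ival t + 0) (4 * ival t + -1).
pose psi (t : I) := Num.min (4 * ival t + 0) (2 * ival t + 1).
have -> : tcat H (tcat L N) = fun z => F (z.1, phi z.2).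
  apply/funext => -[s t]; rewrite /tcat /F /extend /phi /=.
  have t0 := ival_ge0 t; have t1 := ival_le1 t.
  have [t2|t2] := leP (ival t) 2^-1.
    rewrite max_l; last by lra.
    by rewrite ifT //; lra.
  rewrite max_r; last by lra.
  rewrite [RHS]ifF; last by apply/negbTE; rewrite -ltNge; lra.
  have hE := ival_hi (ltW t2); rewrite hE.
  have [t3|t3] := leP (2 * ival t - 1) 2^-1.
    rewrite ifT; last by lra.
    by rewrite /lo_half hE; congr (L (s, clamp _)); lra.
  rewrite ifF; last by apply/negbTE; rewrite -ltNge; lra.
  by rewrite /hi_half -/(hi_half t) hE; congr (N (s, clamp _)); lra.
have -> : tcat (tcat H L) N = fun z => F (z.1, psi z.2).
  apply/funext => -[s t]; rewrite /tcat /F /extend /psi /=.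
  have t0 := ival_ge0 t; have t1 := ival_le1 t.
  have [t2|t2] := leP (ival t) 2^-1.
    rewrite min_l; last by lra.
    have lE := ival_lo t2; rewrite lE.
    have [t3|t3] := leP (2 * ival t) 2^-1.
      rewrite ifT; last by lra.
      by rewrite /lo_half -/(lo_half t) lE; congr (H (s, clamp _)); lra.
    rewrite ifF; last by apply/negbTE; rewrite -ltNge; lra.
    rewrite ifT; last by lra.
    by rewrite /hi_half lE; congr (L (s, clamp _)); lra.
  rewrite min_r; last by lra.
  rewrite ifF; last by apply/negbTE; rewrite -ltNge; lra.
  rewrite ifF; last by apply/negbTE; rewrite -ltNge; lra.
  by rewrite /hi_half; congr (N (s, clamp _)); lra.
apply: track_reparam1 => //.
- by apply: cont_maxr; exact: cont_affine_ival.
- by apply: cont_minr; exact: cont_affine_ival.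
- by rewrite /phi /psi ival0 max_l ?min_l; lra.
- by rewrite /phi /psi ival1 max_r ?min_r; lra.
Qed.

Lemma track_reparamI H (phi psi : I -> I) : is_track H ->
  continuous phi -> continuous psi ->
  phi (I0 R) = psi (I0 R) -> phi (I1 R) = psi (I1 R) ->
  track_homotopic (fun z => H (z.1, phi z.2)) (fun z => H (z.1, psi z.2)).
Proof.
move=> tH cphi cpsi e0 e1.
have E (f : I -> I) : (fun z => H (z.1, f z.2)) =
    fun z => extend H (z.1, ival (f z.2)).
  by apply/funext => -[s t]; rewrite /extend /= clamp_ival.
rewrite (E phi) (E psi); apply: (@track_reparam1 (extend H) (fun t => ival (phi t))
  (fun t => ival (psi t))); rewrite ?e0 ?e1 //.
- exact: cont_extend (proj1 tH).
- exact: extend_bdry.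
- exact: cont_comp cphi (@cont_ival R).
- exact: cont_comp cpsi (@cont_ival R).
Qed.

Lemma tcat1l H (a : T -> X) : is_track H -> (forall s, H (s, I0 R) = a s) ->
  track_homotopic (tcat (fun z => a z.1) H) H.
Proof.
move=> tH aE.
have -> : tcat (fun z => a z.1) H = fun z => H (z.1, hi_half z.2).
  apply/funext => -[s t]; rewrite /tcat /=.
  by case: ifP => // t2; rewrite /hi_half clamp_le0 ?aE //; lra.
have {2}-> : H = fun z => H (z.1, id z.2) by apply/funext => -[].
apply: (@track_reparamI H (@hi_half R) id) => //; [exact: cont_hi|by move=> t|exact: hi0|exact: hi1].
Qed.

Lemma tcat1r H (a : T -> X) : is_track H -> (forall s, H (s, I1 R) = a s) ->
  track_homotopic (tcat H (fun z => a z.1)) H.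
Proof.
move=> tH aE.
have -> : tcat H (fun z => a z.1) = fun z => H (z.1, lo_half z.2).
  apply/funext => -[s t]; rewrite /tcat /=.
  by case: leP => // t2; rewrite /lo_half clamp_ge1 ?aE //; lra.
have {2}-> : H = fun z => H (z.1, id z.2) by apply/funext => -[].
apply: (@track_reparamI H (@lo_half R) id) => //; [exact: cont_lo|by move=> t|exact: lo0|exact: lo1].
Qed.

Lemma tcatV H : is_track H ->
  track_homotopic (tcat H (trev H)) (fun z => H (z.1, I0 R)).
Proof.
move=> tH.
have -> : tcat H (trev H) = fun z => H
    (z.1, if ival z.2 <= 2^-1 then lo_half z.2 else flip (hi_half z.2)).
  by apply/funext => -[s t]; rewrite /tcat /trev /=; case: ifP.
apply: (@track_reparamI H (fun t => if ival t <= 2^-1 then lo_half t else flip (hi_half t)) (fun=> I0 R)) => //.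
- apply: cont_glue_half; first exact: cont_lo.
  + exact: cont_comp (@cont_hi R) (@cont_flip R).
  + by move=> t.
  + by move=> t t2; rewrite lo_half1 // hi_half0 // flip0.
- exact: cst_continuous.
- by rewrite half_I0 lo0.
- by rewrite half_I1 hi1 flip1.
Qed.

Lemma trevK H : trev (trev H) = H.
Proof.
apply/funext => -[s t]; rewrite /trev /=; congr (H (s, _)).
by apply: ival_inj; rewrite !ival_flip opprB addrC subrK.
Qed.

Lemma tcatVl H : is_track H ->
  track_homotopic (tcat (trev H) H) (fun z => H (z.1, I1 R)).
Proof.
move=> /trev_track/tcatV; rewrite trevK.
suff -> : (fun z : T * I => trev H (z.1, I0 R)) = (fun z => H (z.1, I1 R)) by [].
by apply/funext => -[s t]; rewrite trev0.
Qed.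

(** Both sides are the restrictions of one map of the square to two paths with
common ends, and the square is convex. *)
Lemma track_square (K : (T * I) * I -> X) : continuous K ->
  (forall s t u, cube_boundary s -> K ((s, t), u) = K ((s, I0 R), I0 R)) ->
  track_homotopic
    (tcat (fun z => K (z, I0 R)) (fun z => K ((z.1, I1 R), z.2)))
    (tcat (fun z => K ((z.1, I0 R), z.2)) (fun z => K (z, I1 R))).
Proof.
move=> cK Kb.
pose F (z : T * (R * R)) := K ((z.1, clamp z.2.1), clamp z.2.2).
have cF : continuous F.
  have c1 : continuous (fun z : T * (R * R) => z.2.1).
    exact: cont_comp (@cont_snd _ _) (@cont_fst _ _).
  have c2 : continuous (fun z : T * (R * R) => z.2.2).
    exact: cont_comp (@cont_snd _ _) (@cont_snd _ _).
  apply: cont_comp cK; apply: cont_pair; last exact: cont_comp c2 (@cont_clamp R).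
  by apply: cont_pair; [exact: cont_fst|exact: cont_comp c1 (@cont_clamp R)].
have -> : tcat (fun z => K (z, I0 R)) (fun z => K ((z.1, I1 R), z.2)) =
    fun z => F (z.1, (ival (lo_half z.2), ival (hi_half z.2))).
  apply/funext => -[s t]; rewrite /tcat /F /= !clamp_ival.
  case: leP => t2.
    by have -> : hi_half t = I0 R by apply: clamp_le0; lra.
  by have -> : lo_half t = I1 R by apply: clamp_ge1; lra.
have -> : tcat (fun z => K ((z.1, I0 R), z.2)) (fun z => K (z, I1 R)) =
    fun z => F (z.1, (ival (hi_half z.2), ival (lo_half z.2))).
  apply/funext => -[s t]; rewrite /tcat /F /= !clamp_ival.
  case: leP => t2.
    by have -> : hi_half t = I0 R by apply: clamp_le0; lra.
  by have -> : lo_half t = I1 R by apply: clamp_ge1; lra.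
have clo := cont_comp (@cont_lo R) (@cont_ival R).
have chi := cont_comp (@cont_hi R) (@cont_ival R).
apply: (@track_reparam F (fun t => (ival (lo_half t), ival (hi_half t)))
  (fun t => (ival (hi_half t), ival (lo_half t)))) => //.
- by move=> s q q' bs; rewrite /F /= Kb // [RHS]Kb.
- exact: cont_pair.
- exact: cont_pair.
- by rewrite lo0 hi0.
- by rewrite lo1 hi1.
Qed.

End InSpace.

Lemma track_map (X Y : topologicalType) (f : X -> Y) (H : T * I -> X) :
  continuous f -> is_track H -> is_track (fun z => f (H z)).
Proof.
move=> cf [cH Hb]; split; first exact: cont_comp cH cf.
by move=> s t bs; rewrite Hb.
Qed.

Lemma track_homotopic_map (X Y : topologicalType) (f : X -> Y) (H L : T * I -> X) :
  continuous f -> track_homotopic H L ->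
  track_homotopic (fun z => f (H z)) (fun z => f (L z)).
Proof.
move=> cf [K [cK K0 K1 Kb Ke]]; exists (fun z => f (K z)); split.
- exact: cont_comp cK cf.
- by move=> z; rewrite K0.
- by move=> z; rewrite K1.
- by move=> s t u bs; rewrite Kb.
- by move=> s t u et; rewrite Ke.
Qed.

End Tracks.

(** * The groupoid of tracks up to homotopy *)

Section TrackClasses.
Variables (R : realType) (k : nat).
Notation I := (unit_interval R).
Notation T := (cube R k).

(** A class is the set of its members.  All operations are then total functions
on one type, whatever the ends of the tracks are; the product of classes whose
ends do not match is empty, which makes [tmul] associative without hypotheses. *)
Definition tclass (X : topologicalType) (H : T * I -> X) : set (T * I -> X) :=
  [set L | track_homotopic H L].

Definition tid (X : topologicalType) (a : T -> X) := tclass (fun z => a z.1).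

Definition tmul (X : topologicalType) (A B : set (T * I -> X)) :
    set (T * I -> X) :=
  [set N | exists H L, [/\ A H /\ is_track H, B L /\ is_track L,
     forall s, H (s, I1 R) = L (s, I0 R) & track_homotopic (tcat H L) N]].

Definition tinv (X : topologicalType) (A : set (T * I -> X)) : set (T * I -> X) :=
  [set N | exists H, A H /\ track_homotopic (trev H) N].

Definition tmap (X Y : topologicalType) (f : X -> Y) (A : set (T * I -> X)) :
    set (T * I -> Y) :=
  [set N | exists H, A H /\ track_homotopic (fun z => f (H z)) N].

Definition tpair (X Y : topologicalType) (A : set (T * I -> X))
    (B : set (T * I -> Y)) : set (T * I -> X * Y) :=
  [set N | exists H L, [/\ A H, B L & track_homotopic (fun z => (H z, L z)) N]].

(** The ends belong to a judgment about the class and not to its type: the ends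
of arrows in a tower agree only by an equation, and no transport is needed. *)
Definition arrow (X : topologicalType) (a b : T -> X) (A : set (T * I -> X)) : Prop :=
  exists H, [/\ is_track H, forall s, H (s, I0 R) = a s,
                forall s, H (s, I1 R) = b s & A = tclass H].

End TrackClasses.

Notation "A ** B" := (tmul A B) (at level 40, left associativity).

Section TrackAlgebra.
Variables (R : realType) (k : nat).
Notation I := (unit_interval R).
Notation T := (cube R k).

Section InSpace.
Variable X : topologicalType.
Implicit Types (H L : T * I -> X) (a b c : T -> X) (A B C : set (T * I -> X)).

Lemma tclass_refl H : is_track H -> tclass H H.
Proof. exact: track_homotopic_refl. Qed.

Lemma tclassE H L : track_homotopic H L -> tclass H = tclass L.
Proof.
move=> HL; apply/seteqP; split=> N; last exact: track_homotopic_trans.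
exact: track_homotopic_trans (track_homotopic_sym HL).
Qed.

Lemma tclassP H L : is_track L -> tclass H = tclass L -> track_homotopic H L.
Proof. by move=> tL; rewrite -[track_homotopic H L]/(tclass H L) => ->; exact: tclass_refl. Qed.

Lemma arrow_class H a b : is_track H -> (forall s, H (s, I0 R) = a s) ->
  (forall s, H (s, I1 R) = b s) -> arrow a b (tclass H).
Proof. by move=> tH H0 H1; exists H. Qed.

Lemma tmulE H L : is_track H -> is_track L ->
  (forall s, H (s, I1 R) = L (s, I0 R)) ->
  tclass H ** tclass L = tclass (tcat H L).
Proof.
move=> tH tL e; apply/seteqP; split=> N.
  move=> [H' [L' [[HH' tH'] [LL' tL'] _ h]]].
  exact: track_homotopic_trans (tcat_homotopic HH' LL' e) h.
by move=> h; exists H, L; split=> //; split=> //; exact: tclass_refl.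
Qed.

Lemma tinvE H : is_track H -> tinv (tclass H) = tclass (trev H).
Proof.
move=> tH; apply/seteqP; split=> N.
  by move=> [H' [/trev_homotopic HH']]; exact: track_homotopic_trans.
by move=> h; exists H; split=> //; exact: tclass_refl.
Qed.

Lemma tmulA A B C : A ** (B ** C) = A ** B ** C.
Proof.
apply/seteqP; split=> N.
  move=> [H [M [[AH tH] [[K [L [[BK tK] [CL tL] eKL hKL]]] tM] eHM hHM]]].
  have eHK s : H (s, I1 R) = K (s, I0 R).
    by rewrite eHM -(track_homotopic_end s hKL) ?tcat0 //; left.
  have tHK := tcat_track tH tK eHK.
  exists (tcat H K), L; split=> //.
  - split=> //; exists H, K; split=> //; exact: track_homotopic_refl.
  - by move=> s; rewrite tcat1.
  - apply: track_homotopic_trans (track_homotopic_sym (tcatA tH tK tL eHK eKL)) _.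
    apply: track_homotopic_trans hHM; apply: tcat_homotopic hKL _.
      exact: track_homotopic_refl.
    by move=> s; rewrite tcat0.
move=> [M [L [[[H [K [[AH tH] [BK tK] eHK hHK]]] tM] [CL tL] eML hML]]].
have eKL s : K (s, I1 R) = L (s, I0 R).
  by rewrite -eML -(track_homotopic_end s hHK) ?tcat1 //; right.
exists H, (tcat K L); split=> //.
- by split; [exists K, L; split=> //; apply: track_homotopic_refl|];
    exact: tcat_track.
- by move=> s; rewrite tcat0.
- apply: track_homotopic_trans (tcatA tH tK tL eHK eKL) _.
  apply: track_homotopic_trans hML; apply: tcat_homotopic hHK _ _.
    exact: track_homotopic_refl.
  by move=> s; rewrite tcat1.
Qed.

Lemma id_track a : continuous a -> is_track (fun z : T * I => a z.1).
Proof. by move=> ca; split=> //; exact: cont_comp (@cont_fst _ _) ca. Qed.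

Lemma arrow_id a : continuous a -> arrow a a (tid a).
Proof. by move=> ca; apply: arrow_class => //; exact: id_track. Qed.

Lemma arrow_mul a b c A B : arrow a b A -> arrow b c B -> arrow a c (A ** B).
Proof.
move=> [H [tH H0 H1 ->]] [L [tL L0 L1 ->]].
have e s : H (s, I1 R) = L (s, I0 R) by rewrite H1 L0.
rewrite tmulE //; apply: arrow_class; first exact: tcat_track.
  by move=> s; rewrite tcat0.
by move=> s; rewrite tcat1.
Qed.

Lemma arrow_inv a b A : arrow a b A -> arrow b a (tinv A).
Proof.
move=> [H [tH H0 H1 ->]]; rewrite tinvE //; apply: arrow_class.
- exact: trev_track.
- by move=> s; rewrite trev0.
- by move=> s; rewrite trev1.
Qed.

Lemma arrow_contl a b A : arrow a b A -> continuous a.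
Proof.
move=> [H [[cH _] H0 _ _]].
have -> : a = fun s => H (s, I0 R) by apply/funext => s; rewrite H0.
by apply: cont_comp cH; apply: cont_pair; [move=> s|exact: cst_continuous].
Qed.

Lemma arrow_contr a b A : arrow a b A -> continuous b.
Proof. by move=> /arrow_inv/arrow_contl. Qed.

Lemma tmul1l a b A : arrow a b A -> tid a ** A = A.
Proof.
move=> hA; have ta := id_track (arrow_contl hA); move: hA => [H [tH H0 H1 ->]].
by rewrite tmulE //; exact: tclassE (tcat1l tH H0).
Qed.

Lemma tmul1r a b A : arrow a b A -> A ** tid b = A.
Proof.
move=> hA; have tb := id_track (arrow_contr hA); move: hA => [H [tH H0 H1 ->]].
by rewrite tmulE //; exact: tclassE (tcat1r tH H1).
Qed.

Lemma tmulV a b A : arrow a b A -> A ** tinv A = tid a.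
Proof.
move=> [H [tH H0 H1 ->]]; rewrite tinvE // tmulE //; last first.
- by move=> s; rewrite trev0.
- exact: trev_track.
have -> : a = fun s => H (s, I0 R) by apply/funext => s; rewrite H0.
exact: tclassE (tcatV tH).
Qed.

Lemma tmulVl a b A : arrow a b A -> tinv A ** A = tid b.
Proof.
move=> [H [tH H0 H1 ->]]; rewrite tinvE // tmulE //; last first.
- by move=> s; rewrite trev1.
- exact: trev_track.
have -> : b = fun s => H (s, I1 R) by apply/funext => s; rewrite H1.
exact: tclassE (tcatVl tH).
Qed.

Lemma tinvK a b A : arrow a b A -> tinv (tinv A) = A.
Proof.
move=> [H [tH H0 H1 ->]]; rewrite !tinvE ?trevK //; exact: trev_track.
Qed.

Lemma tmulK a b c A B : arrow a b A -> arrow b c B -> tinv A ** (A ** B) = B.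
Proof. by move=> hA hB; rewrite tmulA (tmulVl hA) (tmul1l hB). Qed.

Lemma tmulKV a b c A B : arrow a b A -> arrow a c B -> A ** (tinv A ** B) = B.
Proof. by move=> hA hB; rewrite tmulA (tmulV hA) (tmul1l hB). Qed.

Lemma tmulrK a b c A B : arrow a b A -> arrow b c B -> A ** B ** tinv B = A.
Proof. by move=> hA hB; rewrite -tmulA (tmulV hB) (tmul1r hA). Qed.

Lemma tmulrKV a b c A B : arrow a b A -> arrow c b B -> A ** tinv B ** B = A.
Proof. by move=> hA hB; rewrite -tmulA (tmulVl hB) (tmul1r hA). Qed.

Lemma tinv_mul a b c A B : arrow a b A -> arrow b c B ->
  tinv (A ** B) = tinv B ** tinv A.
Proof.
move=> hA hB; have hAB := arrow_mul hA hB; have hV := arrow_inv hAB.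
rewrite -[LHS](tmulrK hV hA) -!tmulA.
have -> : tinv (A ** B) ** (A ** tinv A) = tinv (A ** B) ** (A ** B) ** (tinv B ** tinv A).
  by rewrite -!tmulA [B ** _]tmulA (tmulV hB) (tmul1l (arrow_inv hA)).
by rewrite (tmulVl hAB) (tmul1l (arrow_mul (arrow_inv hB) (arrow_inv hA))).
Qed.

End InSpace.

Section Map.
Variables (X Y : topologicalType) (f : X -> Y).
Hypothesis cf : continuous f.
Implicit Types (H L : T * I -> X) (a b c : T -> X) (A B C : set (T * I -> X)).

Lemma tmapE H : is_track H -> tmap f (tclass H) = tclass (fun z => f (H z)).
Proof.
move=> tH; apply/seteqP; split=> N.
  by move=> [L [/(track_homotopic_map cf)]]; exact: track_homotopic_trans.
by move=> h; exists H; split=> //; exact: tclass_refl.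
Qed.

Lemma arrow_map a b A : arrow a b A -> arrow (f \o a) (f \o b) (tmap f A).
Proof.
move=> [H [tH H0 H1 ->]]; rewrite tmapE //; apply: arrow_class.
- exact: track_map.
- by move=> s; rewrite H0.
- by move=> s; rewrite H1.
Qed.

Lemma tmap_mul a b c A B : arrow a b A -> arrow b c B ->
  tmap f (A ** B) = tmap f A ** tmap f B.
Proof.
move=> [H [tH H0 H1 ->]] [L [tL L0 L1 ->]].
have e s : H (s, I1 R) = L (s, I0 R) by rewrite H1 L0.
rewrite (tmulE tH tL e) (tmapE (tcat_track tH tL e)) (tmapE tH) (tmapE tL).
rewrite (tmulE (track_map cf tH) (track_map cf tL)); last by move=> s; rewrite e.
by congr tclass; apply/funext => z; rewrite /tcat; case: ifP.
Qed.

Lemma tmap_inv a b A : arrow a b A -> tmap f (tinv A) = tinv (tmap f A).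
Proof.
move=> [H [tH H0 H1 ->]]; rewrite (tinvE tH) (tmapE tH).
by rewrite (tmapE (trev_track tH)) (tinvE (track_map cf tH)).
Qed.

Lemma tmap_id a : continuous a -> tmap f (tid a) = tid (f \o a).
Proof. by move=> ca; rewrite tmapE //; exact: id_track. Qed.

End Map.

Lemma tmap_comp (X Y Z : topologicalType) (f : X -> Y) (g : Y -> Z)
    (a b : T -> X) (A : set (T * I -> X)) :
  continuous f -> continuous g -> arrow a b A ->
  tmap g (tmap f A) = tmap (g \o f) A.
Proof.
move=> cf cg [H [tH H0 H1 ->]]; rewrite (tmapE cf tH).
by rewrite (tmapE cg (track_map cf tH)) (tmapE (cont_comp cf cg) tH).
Qed.

Section Pair.
Variables (X Y : topologicalType).

Lemma track_homotopic_pair (H H' : T * I -> X) (L L' : T * I -> Y) :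
  track_homotopic H H' -> track_homotopic L L' ->
  track_homotopic (fun z => (H z, L z)) (fun z => (H' z, L' z)).
Proof.
move=> [K [cK K0 K1 Kb Ke]] [M [cM M0 M1 Mb Me]].
exists (fun z => (K z, M z)); split.
- exact: cont_pair.
- by move=> z; rewrite K0 M0.
- by move=> z; rewrite K1 M1.
- by move=> s t u bs; rewrite Kb // Mb.
- by move=> s t u et; rewrite Ke // Me.
Qed.

Lemma track_pair (H : T * I -> X) (L : T * I -> Y) :
  is_track H -> is_track L -> is_track (fun z => (H z, L z)).
Proof.
move=> [cH Hb] [cL Lb]; split; first exact: cont_pair.
by move=> s t bs; rewrite Hb // Lb.
Qed.

Lemma tpairE (H : T * I -> X) (L : T * I -> Y) :
  is_track H -> is_track L ->
  tpair (tclass H) (tclass L) = tclass (fun z => (H z, L z)).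
Proof.
move=> tH tL; apply/seteqP; split=> N.
  move=> [H' [L' [HH' LL']]]; apply: track_homotopic_trans.
  exact: track_homotopic_pair.
by move=> h; exists H, L; split=> //; exact: tclass_refl.
Qed.

Lemma arrow_pair (a b : T -> X) (a' b' : T -> Y) A B :
  arrow a b A -> arrow a' b' B ->
  arrow (fun s => (a s, a' s)) (fun s => (b s, b' s)) (tpair A B).
Proof.
move=> [H [tH H0 H1 ->]] [L [tL L0 L1 ->]]; rewrite tpairE //.
apply: arrow_class; first exact: track_pair.
- by move=> s; rewrite H0 L0.
- by move=> s; rewrite H1 L1.
Qed.

Lemma tpair_mul (a b c : T -> X) (a' b' c' : T -> Y) A B A' B' :
  arrow a b A -> arrow b c B -> arrow a' b' A' -> arrow b' c' B' ->
  tpair (A ** B) (A' ** B') = tpair A A' ** tpair B B'.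
Proof.
move=> [H [tH H0 H1 ->]] [L [tL L0 L1 ->]] [H' [tH' H'0 H'1 ->]] [L' [tL' L'0 L'1 ->]].
have e s : H (s, I1 R) = L (s, I0 R) by rewrite H1 L0.
have e' s : H' (s, I1 R) = L' (s, I0 R) by rewrite H'1 L'0.
rewrite !tmulE // !tpairE //; try exact: tcat_track.
rewrite tmulE //; try exact: track_pair; last by move=> s; rewrite e e'.
by congr tclass; apply/funext => z; rewrite /tcat; case: ifP.
Qed.

End Pair.

Lemma sphere_homotopicP (X : topologicalType) (x : X) (a b : sphere R k x) :
  sphere_homotopic a b <-> exists A, arrow a b A.
Proof.
split.
  move=> [h [ch h0 h1 hb]]; exists (tclass h); apply: arrow_class => //.
  by split=> // s t bs; rewrite !hb.
move=> [_ [H [[cH Hb] H0 H1 _]]]; exists H; split=> // s t bs.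
by rewrite Hb // H0 sphere_bdry.
Qed.

End TrackAlgebra.

(** * Homotopy groups as automorphism groups *)

Section HomotopyGroupArrows.
Variables (R : realType) (k : nat).
Notation I := (unit_interval R).
Notation T := (cube R k).

Section InSpace.
Variables (X : topologicalType) (x : X).
Notation cst := (fun _ : T => x).

(** The first coordinate becomes the time, because the product of the homotopy
group juxtaposes along it. *)
Definition sphere_track (a : sphere R k.+1 x) (z : T * I) : X :=
  a (cube_cons z.2 z.1).

Lemma sphere_track_track a : is_track (sphere_track a).
Proof.
split.
  apply: cont_comp (sphere_cont a).
  by apply: cont_cube_cons; [exact: cont_snd|exact: cont_fst].
by move=> s t bs; rewrite /sphere_track !sphere_bdry //; apply/cube_cons_bdry; right.
Qed.

Lemma sphere_track_end a s t : endpoint t -> sphere_track a (s, t) = x.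
Proof. by move=> et; apply: sphere_bdry; apply/cube_cons_bdry; left. Qed.

Lemma sphere_track_homotopic a b :
  sphere_homotopic a b <-> track_homotopic (sphere_track a) (sphere_track b).
Proof.
split.
  move=> [h [ch h0 h1 hb]].
  exists (fun z => h (cube_cons z.1.2 z.1.1, z.2)); split.
  - apply: cont_comp ch; apply: cont_pair; last exact: cont_snd.
    apply: cont_cube_cons.
      exact: cont_comp (@cont_fst _ _) (@cont_snd _ _).
    exact: cont_comp (@cont_fst _ _) (@cont_fst _ _).
  - by move=> z; rewrite h0.
  - by move=> z; rewrite h1.
  - move=> s t u bs /=; rewrite hb; last by apply/cube_cons_bdry; right.
    by rewrite sphere_track_end //; left.
  - move=> s t u et; rewrite sphere_track_end // hb //.
    by apply/cube_cons_bdry; left.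
move=> [K [cK K0 K1 Kb Ke]].
exists (fun z => K ((cube_tail z.1, z.1 ord0), z.2)); split.
- apply: cont_comp cK; apply: cont_pair; last exact: cont_snd.
  apply: cont_pair; first exact: cont_comp (@cont_fst _ _) (@cont_cube_tail _ _).
  exact: cont_comp (@cont_fst _ _) (@cont_first _ _).
- by move=> s; rewrite K0 /sphere_track cube_cons_tail.
- by move=> s; rewrite K1 /sphere_track cube_cons_tail.
move=> s t; rewrite -{1}[s]cube_cons_tail => /cube_cons_bdry[es|bs] /=.
  by rewrite Ke // sphere_track_end.
by rewrite Kb // sphere_track_end //; left.
Qed.

Definition hg_arrow (A : homotopy_group R k.+1 x) : set (T * I -> X) :=
  tclass (sphere_track (repr A)).

Lemma hg_arrowE a : hg_arrow (sphere_class a) = tclass (sphere_track a).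
Proof. by apply: tclassE; apply/sphere_track_homotopic; exact: repr_class. Qed.

Lemma hg_arrow_inj : injective hg_arrow.
Proof.
move=> A B; rewrite -[A]repr_classK -[B]repr_classK !hg_arrowE => e.
apply/sphere_classP/sphere_track_homotopic/tclassP => //.
exact: sphere_track_track.
Qed.

Lemma arrow_hg A : arrow cst cst (hg_arrow A).
Proof.
apply: arrow_class; first exact: sphere_track_track.
- by move=> s; rewrite sphere_track_end //; left.
- by move=> s; rewrite sphere_track_end //; right.
Qed.

Lemma hg_arrow_onto C : arrow cst cst C -> exists A, hg_arrow A = C.
Proof.
move=> [H [[cH Hb] H0 H1 ->]].
have c : continuous (fun s : cube R k.+1 => H (cube_tail s, s ord0)).
  apply: cont_comp cH; apply: cont_pair; first exact: cont_cube_tail.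
  exact: cont_first.
have b s : cube_boundary s -> H (cube_tail s, s ord0) = x.
  rewrite -{1}[s]cube_cons_tail => /cube_cons_bdry[[]->|bs]; rewrite ?H0 ?H1 //.
  by rewrite Hb // H0.
exists (sphere_class (Sphere c b)); rewrite hg_arrowE; congr tclass.
by apply/funext => -[s t]; rewrite /sphere_track /= cube_tail_cons cube_cons0.
Qed.

Lemma hg_arrow_mul A B : hg_arrow (A * B)%g = hg_arrow A ** hg_arrow B.
Proof.
rewrite -[A]repr_classK -[B]repr_classK [(_ * _)%g]hg_mulE !hg_arrowE.
rewrite tmulE; try exact: sphere_track_track; last first.
  by move=> s; rewrite !sphere_track_end //; [left|right].
congr tclass; apply/funext => -[s t].
by rewrite /tcat /sphere_track /= /cat_fun !cube_cons0 !set_first_cons.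
Qed.

Lemma hg_arrow1 : hg_arrow 1%g = tid cst.
Proof. by rewrite [1%g]/(hg_base R k.+1 x) hg_arrowE. Qed.

Lemma hg_arrowV A : hg_arrow A^-1%g = tinv (hg_arrow A).
Proof.
have hV := arrow_inv (arrow_hg A).
rewrite -[LHS](tmul1r (arrow_hg _)) -(tmulV (arrow_hg A)) tmulA -hg_arrow_mul.
by rewrite mulVg hg_arrow1 (tmul1l hV).
Qed.

End InSpace.

Lemma hg_arrow_map (X Y : topologicalType) (x : X) (y : Y)
    (f : pointed_map x y) (A : homotopy_group R k.+1 x) :
  hg_arrow (hg_map f A) = tmap f (hg_arrow A).
Proof.
rewrite -[A]repr_classK hg_mapE !hg_arrowE tmapE //; first exact: pmap_cont.
exact: sphere_track_track.
Qed.

End HomotopyGroupArrows.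

(** * The Eckmann-Hilton argument for homotopy groups *)

Section EckmannHilton.
Variables (R : realType) (k : nat) (X : topologicalType) (x : X).
Implicit Types (a b c d : sphere R k.+2 x) (A B C D : homotopy_group R k.+2 x).

Definition cube_swap (s : cube R k.+2) : cube R k.+2 :=
  cube_cons (cube_tail s ord0) (cube_cons (s ord0) (cube_tail (cube_tail s))).

Lemma cube_swap_cons t u (r : cube R k) :
  cube_swap (cube_cons t (cube_cons u r)) = cube_cons u (cube_cons t r).
Proof. by rewrite /cube_swap !cube_tail_cons !cube_cons0. Qed.

Lemma cube_swap_bdry s : cube_boundary s -> cube_boundary (cube_swap s).
Proof.
rewrite -{1}[s]cube_cons_tail -{1}[cube_tail s]cube_cons_tail.
move=> /cube_cons_bdry[e|/cube_cons_bdry[e|e]]; apply/cube_cons_bdry.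
- by right; apply/cube_cons_bdry; left.
- by left.
- by right; apply/cube_cons_bdry; right.
Qed.

Lemma cont_cube_swap : continuous cube_swap.
Proof.
have ct := @cont_cube_tail R k.+1.
have ct2 := cont_comp ct (@cont_cube_tail R k).
apply: cont_cube_cons; first exact: cont_comp ct (@cont_first _ _).
by apply: cont_cube_cons => //; exact: cont_first.
Qed.

Lemma sphere_swap_bdry a s : cube_boundary s -> a (cube_swap s) = x.
Proof. by move=> /cube_swap_bdry; exact: sphere_bdry. Qed.

Definition sphere_swap a : sphere R k.+2 x :=
  Sphere (cont_comp cont_cube_swap (sphere_cont a)) (@sphere_swap_bdry a).

Lemma sphere_swap_homotopic a b :
  sphere_homotopic a b -> sphere_homotopic (sphere_swap a) (sphere_swap b).
Proof.
move=> [h [ch h0 h1 hb]]; exists (fun z => h (cube_swap z.1, z.2)); split=> //.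
- apply: cont_comp ch; apply: cont_pair; last exact: cont_snd.
  exact: cont_comp (@cont_fst _ _) cont_cube_swap.
- by move=> s t bs /=; rewrite hb //; exact: cube_swap_bdry.
Qed.

Definition hg_swap A : homotopy_group R k.+2 x :=
  sphere_class (sphere_swap (repr A)).

Lemma hg_swapE a : hg_swap (sphere_class a) = sphere_class (sphere_swap a).
Proof. by apply/sphere_classP; apply: sphere_swap_homotopic; exact: repr_class. Qed.

Lemma hg_swapK : involutive hg_swap.
Proof.
move=> A; rewrite -[A]repr_classK !hg_swapE; apply/sphere_classP.
apply: sphere_homotopic_ext => s /=.
by rewrite -[s]cube_cons_tail -[cube_tail s]cube_cons_tail !cube_swap_cons.
Qed.

Lemma hg_swap1 : hg_swap 1%g = 1%g.
Proof.
rewrite [1%g]/(hg_base R k.+2 x) hg_swapE.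
by apply/sphere_classP; exact: sphere_homotopic_ext.
Qed.

(** Juxtaposition along the second coordinate of the cube.  As a conjugate of the
product by an involution that fixes the constant sphere, it inherits the
unit laws. *)
Definition sphere_cat2 a b : sphere R k.+2 x :=
  sphere_swap (sphere_cat (sphere_swap a) (sphere_swap b)).

Definition hg_mul2 A B := hg_swap (hg_swap A * hg_swap B)%g.

Lemma hg_mul2E a b :
  hg_mul2 (sphere_class a) (sphere_class b) = sphere_class (sphere_cat2 a b).
Proof. by rewrite /hg_mul2 (hg_swapE a) (hg_swapE b) [(_ * _)%g]hg_mulE hg_swapE. Qed.

Lemma sphere_cat_cons m (f g : sphere R m.+1 x) t (r : cube R m) :
  sphere_cat f g (cube_cons t r) = if ival t <= 2^-1
    then f (cube_cons (lo_half t) r) else g (cube_cons (hi_half t) r).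
Proof. by rewrite /= /cat_fun cube_cons0 !set_first_cons. Qed.

Lemma sphere_cat2_cons a b t u (r : cube R k) :
  sphere_cat2 a b (cube_cons t (cube_cons u r)) = if ival u <= 2^-1
    then a (cube_cons t (cube_cons (lo_half u) r))
    else b (cube_cons t (cube_cons (hi_half u) r)).
Proof.
transitivity (sphere_cat (sphere_swap a) (sphere_swap b)
    (cube_swap (cube_cons t (cube_cons u r)))) => //.
rewrite cube_swap_cons sphere_cat_cons /=.
by rewrite !cube_swap_cons.
Qed.

(** The two juxtapositions divide the square into four pieces, in either order. *)
Lemma hg_interchange A B C D :
  (hg_mul2 A B * hg_mul2 C D)%g = hg_mul2 (A * C)%g (B * D)%g.
Proof.
rewrite -[A]repr_classK -[B]repr_classK -[C]repr_classK -[D]repr_classK.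
move: (repr A) (repr B) (repr C) (repr D) => a b c d.
have mE e f : (sphere_class e * sphere_class f)%g =
  sphere_class (sphere_cat e f) :> homotopy_group R k.+2 x := hg_mulE e f.
rewrite (hg_mul2E a b) (hg_mul2E c d) (mE a c) (mE b d) mE hg_mul2E.
apply/sphere_classP; apply: sphere_homotopic_ext => s.
rewrite -[s]cube_cons_tail -[cube_tail s]cube_cons_tail.
rewrite sphere_cat_cons !sphere_cat2_cons !sphere_cat_cons.
by case: ifP; case: ifP.
Qed.

Lemma hg_mul21 A : hg_mul2 A 1%g = A.
Proof. by rewrite /hg_mul2 hg_swap1 mulg1 hg_swapK. Qed.

Lemma hg_mul12 A : hg_mul2 1%g A = A.
Proof. by rewrite /hg_mul2 hg_swap1 mul1g hg_swapK. Qed.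

Lemma hg_mul2_mul A B : hg_mul2 A B = (A * B)%g.
Proof.
rewrite -{1}[A]mulg1 -{1}[B]mul1g -hg_interchange.
by rewrite hg_mul21 hg_mul12.
Qed.

Lemma hg_mulC A B : (A * B)%g = (B * A)%g.
Proof.
by rewrite -hg_mul2_mul -{1}[A]mul1g -{1}[B]mulg1 -hg_interchange hg_mul12 hg_mul21.
Qed.

End EckmannHilton.

(** * Lifting in towers *)

(** Sequences whose terms have varying types are built by choosing each term
compatible with the preceding one. *)
Lemma dep_choice_seq (T : nat -> Type) (P : forall n, T n -> Prop)
    (Q : forall n, T n -> T n.+1 -> Prop) :
  (exists t, P 0 t) ->
  (forall n t, P n t -> exists t', P n.+1 t' /\ Q n t t') ->
  exists f : forall n, T n, forall n, P n (f n) /\ Q n (f n) (f n.+1).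
Proof.
move=> /cid[t0 Pt0] step.
have stepT n (u : {t | P n t}) : {t' : {t' | P n.+1 t'} | Q n (sval u) (sval t')}.
  case: u => t Pt /=; have [t' [Pt' Qtt']] := cid (step n t Pt).
  by exists (exist _ t' Pt').
pose fix f n : {t | P n t} :=
  if n is m.+1 then sval (stepT m (f m)) else exist _ t0 Pt0.
exists (fun n => sval (f n)) => n; split; first exact: svalP (f n).
exact: svalP (stepT n (f n)).
Qed.

Section Lifting.
Variables (R : realType) (E B : topologicalType) (p : E -> B).
Hypotheses (cp : continuous p) (fp : fibration R p).
Variable k : nat.
Notation I := (unit_interval R).
Notation T := (cube R k).

(** The target upstairs is the end of the lifted track. *)
Lemma lift_arrow (a : T -> E) (b : T -> B) (C : set (T * I -> B)) :
  continuous a -> arrow (p \o a) b C ->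
  exists e A, [/\ arrow a e A, p \o e = b & tmap p A = C].
Proof.
move=> ca [L [tL L0 L1 ->]].
have [|H [cH H0 pH Hb]] := rel_lift fp ca (proj1 tL) L0.
  by move=> s t bs; rewrite (proj2 tL) // L0.
have tH : is_track H by split=> // s t bs; rewrite Hb // H0.
exists (fun s => H (s, I1 R)), (tclass H); split; first exact: arrow_class.
- by apply/funext => s; rewrite /= pH L1.
- by rewrite tmapE //; congr tclass; apply/funext => z; rewrite pH.
Qed.

(** A homotopy of tracks is stationary on the boundary of the cube of one
dimension more, with the time of the track as first coordinate, so that
relative lifting applies to it. *)
Lemma lift_track_homotopy (H : T * I -> E) (L : T * I -> B) :
  track_homotopic (fun z => p (H z)) L ->
  is_track H -> exists H', track_homotopic H H' /\ forall z, p (H' z) = L z.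
Proof.
move=> [K [cK K0 K1 Kb Ke]] [cH Hb].
have cy : continuous (fun s : cube R k.+1 => (cube_tail s, s ord0)).
  by apply: cont_pair; [exact: cont_cube_tail|exact: cont_first].
have cK' : continuous (fun z : cube R k.+1 * I => K ((cube_tail z.1, z.1 ord0), z.2)).
  apply: cont_comp cK; apply: cont_pair; last exact: cont_snd.
  exact: cont_comp (@cont_fst _ _) cy.
have [||M [cM M0 pM Mb]] := rel_lift fp (cont_comp cy cH) cK'.
- by move=> s; rewrite K0.
- move=> s t; rewrite -{1}[s]cube_cons_tail => /cube_cons_bdry[es|bs] /=.
    by rewrite Ke.
  by rewrite Kb // [in RHS]Hb.
exists (fun z => M (cube_cons z.2 z.1, I1 R)); split; last first.
  by move=> z; rewrite pM /= cube_tail_cons cube_cons0 -surjective_pairing K1.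
exists (fun z => M (cube_cons z.1.2 z.1.1, z.2)); split.
- apply: cont_comp cM; apply: cont_pair; last exact: cont_snd.
  apply: cont_cube_cons; first exact: cont_comp (@cont_fst _ _) (@cont_snd _ _).
  exact: cont_comp (@cont_fst _ _) (@cont_fst _ _).
- by move=> [s t]; rewrite M0 /= cube_tail_cons cube_cons0.
- by [].
- move=> s t u bs; rewrite Mb /= ?cube_tail_cons ?cube_cons0 ?Hb //.
  by apply/cube_cons_bdry; right.
- move=> s t u et; rewrite Mb /= ?cube_tail_cons ?cube_cons0 //.
  by apply/cube_cons_bdry; left.
Qed.

End Lifting.

Section LimitArrows.
Variables (R : realType) (X : fibration_tower R).
Notation I := (unit_interval R).

Definition lim_tuple (Y : Type) (f : forall n, Y -> X n)
    (fP : forall n u, ft_map X (f n.+1 u) = f n u) (u : Y) : lim_space X :=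
  mk_lim (fun n => fP n u).

Lemma cont_lim_tuple (Y : topologicalType) (f : forall n, Y -> X n) fP :
  (forall n, continuous (f n)) -> continuous (@lim_tuple Y f fP).
Proof. by move=> cf; apply: cont_sub; apply: cont_prod. Qed.

Lemma lim_space_eqP (u v : lim_space X) :
  (forall n, lim_coord u n = lim_coord v n) -> u = v.
Proof. exact: lim_eqP. Qed.

Variable k : nat.
Notation T := (cube R k).

(** Tracks that agree under the maps of the tower up to homotopy can be
replaced, one stage after the other, by homotopic tracks that agree exactly:
a homotopy downstairs from the image of the next track to the one already
corrected lifts to a correction of the next track. *)
Lemma lim_arrow (v w : T -> lim_space X) (A : forall n, set (T * I -> X n)) :
  (forall n, arrow (fun s => lim_coord (v s) n) (fun s => lim_coord (w s) n) (A n)) ->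
  (forall n, tmap (@ft_map R X n) (A n.+1) = A n) -> exists C, arrow v w C.
Proof.
move=> hA pA.
have [|n H AH|H HP] := @dep_choice_seq (fun n => T * I -> X n)
    (fun n H => A n H) (fun n H H' => forall z, ft_map X (H' z) = H z).
- by have [H [tH _ _ ->]] := hA 0; exists H; exact: tclass_refl.
- have [H1 [tH1 _ _ AE]] := hA n.+1.
  have := pA n; rewrite AE (tmapE (ft_cont X n) tH1) => pE.
  have [|H' [HH' pH']] := lift_track_homotopy (@ft_fib R X n) _ tH1 (L := H).
    by move: AH; rewrite -pE.
  by exists H'.
have HA n : [/\ is_track (H n), forall s, H n (s, I0 R) = lim_coord (v s) n
    & forall s, H n (s, I1 R) = lim_coord (w s) n].
  have [H' [tH' H'0 H'1 AE]] := hA n; have [+ _] := HP n; rewrite AE => HH'.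
  split; first exact: homotopic_trackr HH'.
  - by move=> s; rewrite -(track_homotopic_end s HH') //; left.
  - by move=> s; rewrite -(track_homotopic_end s HH') //; right.
pose L := lim_tuple (fun n u => (HP n).2 u).
exists (tclass L); apply: arrow_class.
- split; first by apply: cont_lim_tuple => n; have [[]] := HA n.
  move=> s t bs; apply: lim_space_eqP => n; have [[_ Hb] _ _] := HA n.
  exact: Hb.
- by move=> s; apply: lim_space_eqP => n; have [_ H0 _] := HA n; exact: H0.
- by move=> s; apply: lim_space_eqP => n; have [_ _ H1] := HA n; exact: H1.
Qed.

End LimitArrows.

(** * The exact sequence *)

Section Lim1Groups.
Variables (G : nat -> groupType) (q : forall n, {multiplicative G n.+1 -> G n}).

Lemma lim1_abelian_group : (forall n (u v : G n), commute u v) ->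
  is_abelian_group (@lim1_mul G q) (lim1_base q).
Proof.
move=> cG; have mulE := @lim1_mulE G q _ _ cG.
have onto (A : lim1 q) : exists a, A = lim1_class q a by exists (repr A); rewrite [RHS]reprK.
split; last first.
  move=> A B; have [[a ->] [b ->]] := (onto A, onto B); rewrite !mulE.
  by congr lim1_class; apply: functional_extensionality_dep => n; exact: cG.
split.
- move=> A B C; have [[a ->] [b ->] [c ->]] := And3 (onto A) (onto B) (onto C).
  rewrite (mulE b c) (mulE a b) !mulE; congr lim1_class.
  by apply: functional_extensionality_dep => n; exact: mulgA.
- move=> A; have [a ->] := onto A; rewrite mulE; congr lim1_class.
  by apply: functional_extensionality_dep => n; exact: mul1g.
- move=> A; have [a ->] := onto A; rewrite mulE; congr lim1_class.
  by apply: functional_extensionality_dep => n; exact: mulg1.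
exists (fun A => lim1_class q (fun n => (repr A n)^-1)%g); split=> A.
- rewrite -{2}[A]reprK mulE; congr lim1_class.
  by apply: functional_extensionality_dep => n; exact: mulVg.
- rewrite -{1}[A]reprK mulE; congr lim1_class.
  by apply: functional_extensionality_dep => n; exact: mulgV.
Qed.

End Lim1Groups.

Lemma arrow_bdry (R : realType) k (X : topologicalType) (a b : cube R k -> X) A s :
  arrow a b A -> cube_boundary s -> b s = a s.
Proof. by move=> [H [[_ Hb] H0 H1 _]] bs; rewrite -H1 Hb. Qed.

Section MilnorSequence.
Variables (R : realType) (X : fibration_tower R).
Notation I := (unit_interval R).
Notation "w '`_[' n ]" := (fun s => lim_coord (w s) n) (at level 3, format "w '`_[' n ]").

Section Arrows.
Variable k : nat.
Notation T := (cube R k).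
Implicit Types (v w : T -> lim_space X).

Lemma ft_coord w n : @ft_map R X n \o w`_[n.+1] = w`_[n].
Proof. by apply/funext => s; exact: coordP. Qed.

Lemma ft_arrow v w n A : arrow v`_[n.+1] w`_[n.+1] A ->
  arrow v`_[n] w`_[n] (tmap (@ft_map R X n) A).
Proof. by move=> /(arrow_map (ft_cont X n)); rewrite !ft_coord. Qed.

Lemma proj_arrow v w n A : arrow v w A ->
  arrow v`_[n] w`_[n] (tmap (fun u => lim_coord u n) A).
Proof. exact: (arrow_map (@cont_lim_coord R X n)). Qed.

Lemma ft_proj_arrow v w n A : arrow v w A ->
  tmap (@ft_map R X n) (tmap (fun u => lim_coord u n.+1) A) =
  tmap (fun u => lim_coord u n) A.
Proof.
move=> hA; rewrite (tmap_comp (@cont_lim_coord R X n.+1) (ft_cont X n) hA).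
by congr tmap; apply/funext => u; exact: coordP.
Qed.

End Arrows.

Variable x : lim_space X.

Section Fixed.
Variable k : nat.
Notation T := (cube R k).
Notation pi1 n := (homotopy_group R k.+1 (lim_coord x n)).
Notation base := (fun _ : T => x).

(** [C] contracts the coordinates of [w], and the loops [om] measure by how much
these contractions fail to form a contraction in the limit. *)
Definition contractions (om : forall n, pi1 n) (w : T -> lim_space X)
    (C : forall n, set (T * I -> X n)) : Prop :=
  forall n, arrow base`_[n] w`_[n] (C n) /\
    hg_arrow (om n) ** tmap (@ft_map R X n) (C n.+1) = C n.

Definition represents (om : forall n, pi1 n) (w : sphere R k x) : Prop :=
  exists C, contractions om w C.

(** Given the contraction [C_n], a contraction [C_(n+1)] is a lift of
[om_n^-1 C_n] that starts at the constant sphere; its end is the next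
coordinate of [w]. *)
Lemma represents_ex om : exists w, represents om w.
Proof.
have [||C CP] := @dep_choice_seq (fun n => (T -> X n) * set (T * I -> X n))%type
  (fun n D => arrow base`_[n] D.1 D.2)
  (fun n D D' => @ft_map R X n \o D'.1 = D.1 /\
     hg_arrow (om n) ** tmap (@ft_map R X n) D'.2 = D.2).
- exists (base`_[0], tid base`_[0]); apply: arrow_id; exact: cst_continuous.
- move=> n [b D] /= hD; have hW := arrow_hg (om n).
  have c : continuous base`_[n.+1] by exact: cst_continuous.
  have := arrow_mul (arrow_inv hW) hD; rewrite -{1}ft_coord.
  move=> /(lift_arrow (ft_cont X n) (@ft_fib R X n) c)[e [A [hA eb pA]]].
  by exists (e, A); split=> //; split=> //=; rewrite pA (tmulKV hW hD).
pose w := lim_tuple (fun n s => congr1 (@^~ s) (CP n).2.1).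
have cw : continuous w.
  by apply: cont_lim_tuple => n; exact: arrow_contr (CP n).1.
have wb s : cube_boundary s -> w s = x.
  by move=> bs; apply: lim_space_eqP => n; exact: (arrow_bdry (CP n).1 bs).
exists (Sphere cw wb), (fun n => (C n).2) => n.
by have [hC [_ CE]] := CP n; split.
Qed.

(** If [om'] is the translate of [om] by [g], the arrows [C_n^-1 g_n^-1 C'_n] from
[w_n] to [w'_n] match in the tower, so they come from the limit.  Conversely, an
arrow [A] from [w] to [w'] has coordinates [A_n] that match, and the loops
[g_n = C'_n A_n^-1 C_n^-1] translate [om] to [om']. *)
Lemma represents_class om om' w w' : represents om w -> represents om' w' ->
  lim1_class _ om = lim1_class _ om' :> hg_lim1 x k <->
  sphere_homotopic w w'.
Proof.
move=> [C CP] [C' CP']; rewrite lim1_classP sphere_homotopicP.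
have hW n := arrow_hg (om n); have hW' n := arrow_hg (om' n).
have hC n := (CP n).1; have hC' n := (CP' n).1.
have hPC n := ft_arrow (hC n.+1); have hPC' n := ft_arrow (hC' n.+1).
split.
  move=> [g omE].
  have hg n := arrow_hg (g n); have hPg n := @ft_arrow k base base n _ (hg n.+1).
  have WE n : hg_arrow (om' n) = hg_arrow (g n) ** hg_arrow (om n) **
      tinv (tmap (@ft_map R X n) (hg_arrow (g n.+1))).
    rewrite omE /lim1_act !hg_arrow_mul; congr (_ ** _).
    by rewrite hg_arrow_map hg_arrowV (tmap_inv (ft_cont X n) (hg n.+1)).
  apply: (@lim_arrow R X k w w'
    (fun n => tinv (C n) ** (tinv (hg_arrow (g n)) ** C' n))) => n.
    exact: arrow_mul (arrow_inv (hC n)) (arrow_mul (arrow_inv (hg n)) (hC' n)).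
  have cf := ft_cont X n.
  have hgC := arrow_mul (arrow_inv (hg n.+1)) (hC' n.+1).
  rewrite (tmap_mul cf (arrow_inv (hC _)) hgC).
  rewrite (tmap_mul cf (arrow_inv (hg _)) (hC' _)).
  rewrite (tmap_inv cf (hC _)) (tmap_inv cf (hg _)).
  have [_ <-] := CP n; have [_ <-] := CP' n.
  have hgC' := arrow_mul (arrow_inv (hPg n)) (hPC' n).
  rewrite WE (tinv_mul (hW n) (hPC n)) -!tmulA.
  by rewrite (tmulK (hg n) (arrow_mul (hW n) hgC')) (tmulK (hW n) hgC').
move=> [A hA].
pose G n := tmap (fun u => lim_coord u n) A.
have hG n : arrow w`_[n] w'`_[n] (G n) := proj_arrow n hA.
have pG n : tmap (@ft_map R X n) (G n.+1) = G n := ft_proj_arrow n hA.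
have hGC n := arrow_mul (arrow_inv (hG n)) (arrow_inv (hC n)).
pose g n := sval (cid (hg_arrow_onto (arrow_mul (hC' n) (hGC n)))).
have gE n : hg_arrow (g n) = C' n ** (tinv (G n) ** tinv (C n)).
  exact: svalP (cid (hg_arrow_onto (arrow_mul (hC' n) (hGC n)))).
exists g; apply: functional_extensionality_dep => n; apply: hg_arrow_inj.
rewrite /lim1_act !hg_arrow_mul hg_arrow_map hg_arrowV gE.
have hVg := arrow_hg (g n.+1).
rewrite (tmap_inv (ft_cont X n) hVg) gE.
have cf := ft_cont X n.
rewrite (tmap_mul cf (hC' n.+1) (hGC n.+1)).
rewrite (tmap_mul cf (arrow_inv (hG _)) (arrow_inv (hC _))).
rewrite (tmap_inv cf (hG _)) (tmap_inv cf (hC _)) pG.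
have [_ {1}<-] := CP n; have [_ {1}<-] := CP' n.
set PC := tmap _ (C n.+1); set PC' := tmap _ (C' n.+1); set W := hg_arrow _.
have hGPC := arrow_mul (arrow_inv (hG n)) (arrow_inv (hPC n)).
rewrite (tinv_mul (hPC' n) hGPC) (tinv_mul (arrow_inv (hG n)) (arrow_inv (hPC n))).
rewrite (tinvK (hPC n)) (tinvK (hG n)) (tinv_mul (hW n) (hPC n)) -!tmulA.
have hGPC' := arrow_mul (hG n) (arrow_inv (hPC' n)).
rewrite (tmulK (hW n) (arrow_mul (hPC n) hGPC')) (tmulK (hPC n) hGPC').
by rewrite (tmulK (hG n) (arrow_inv (hPC' n))) (tmulV (hPC' n)) (tmul1r (hW' n)).
Qed.

Definition lim1_iota (A : hg_lim1 x k) : homotopy_group R k x :=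
  sphere_class (sval (cid (represents_ex (fun n => repr A n)))).

Lemma lim1_iotaE om w : represents om w ->
  lim1_iota (lim1_class _ om) = sphere_class w.
Proof.
move=> Dw; rewrite /lim1_iota; case: cid => w0 /= Dw0; apply/sphere_classP.
by apply/(represents_class Dw0 Dw); exact: reprK.
Qed.

Lemma lim1_surj (A : hg_lim1 x k) : exists om, A = lim1_class _ om.
Proof. by exists (repr A); rewrite [RHS]reprK. Qed.

Lemma represents_base : represents (fun=> 1%g) (sphere_cst R k x).
Proof.
have c n : continuous base`_[n] by exact: cst_continuous.
exists (fun n => tid base`_[n]) => n; split; first exact: arrow_id.
have -> : tmap (@ft_map R X n) (tid base`_[n.+1]) = tid base`_[n].
  by rewrite tmap_id ?ft_coord //; exact: ft_cont.
by rewrite hg_arrow1 (tmul1l (arrow_id (c n))).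
Qed.

(** The loops are [C_n p(C_(n+1))^-1]. *)
Lemma represents_contractible (w : sphere R k x) :
  (forall n, exists C, arrow base`_[n] w`_[n] C) -> exists om, represents om w.
Proof.
move=> hC; pose C n := sval (cid (hC n)).
have arrC n : arrow base`_[n] w`_[n] (C n) := svalP (cid (hC n)).
have hPC n := ft_arrow (arrC n.+1).
have hD n := arrow_mul (arrC n) (arrow_inv (hPC n)).
exists (fun n => sval (cid (hg_arrow_onto (hD n)))), C => n; split=> //.
by case: cid => g /= ->; exact: tmulrKV (arrC n) (hPC n).
Qed.

Lemma hg_to_lim_sphere (w : sphere R k x) n :
  lim_proj n (hg_to_lim (sphere_class w)) =
  sphere_class (sphere_map (proj_pmap x n) w).
Proof. exact: hg_mapE. Qed.

Lemma hg_to_lim_baseP (w : sphere R k x) :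
  hg_to_lim (sphere_class w) = hg_lim_base x k <->
  forall n, exists C, arrow base`_[n] w`_[n] C.
Proof.
have E n : sphere_class (sphere_map (proj_pmap x n) w) = hg_base R k _ <->
    exists C, arrow base`_[n] w`_[n] C.
  by split=> [/esym|h]; [|apply/esym]; [move=> /sphere_classP|apply/sphere_classP];
    [move=> /sphere_homotopicP|apply/sphere_homotopicP].
split=> [e n|h]; last by apply: lim_eqP => n; rewrite hg_to_lim_sphere; exact/E.
by apply/E; rewrite -hg_to_lim_sphere e.
Qed.

(** Each representative is moved, by lifting a homotopy, to one that lies exactly
over the representative chosen one stage below. *)
Lemma hg_to_lim_onto (A : hg_lim x k) : exists B, hg_to_lim B = A.
Proof.
have [||w wP] := @dep_choice_seq (fun n => sphere R k (lim_coord x n))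
  (fun n w => sphere_class w = lim_proj n A)
  (fun n w w' => forall s, ft_map X (w' s) = w s).
- by exists (repr (lim_proj 0 A)); exact: repr_classK.
- move=> n w wA; set v := repr (lim_proj n.+1 A).
  have vA : sphere_class v = lim_proj n.+1 A by exact: repr_classK.
  have := lim_projP n A; rewrite -vA hg_mapE -wA => /sphere_classP.
  move=> /sphere_homotopicP[C /(lift_arrow (ft_cont X n) (@ft_fib R X n)
    (sphere_cont v))[e [D [hD eb _]]]].
  have be s : cube_boundary s -> e s = lim_coord x n.+1.
    by move=> bs; rewrite (arrow_bdry hD bs) sphere_bdry.
  exists (Sphere (arrow_contr hD) be); split.
    by apply/esym/sphere_classP/sphere_homotopicP; exists D.
  by move=> s; rewrite -eb.
pose w0 := lim_tuple (fun n => (wP n).2).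
have cw : continuous w0 by apply: cont_lim_tuple => n; exact: sphere_cont.
have bw s : cube_boundary s -> w0 s = x.
  by move=> bs; apply: lim_space_eqP => n; exact: (sphere_bdry (w n)).
exists (sphere_class (Sphere cw bw)); apply: lim_eqP => n.
rewrite hg_to_lim_sphere -(wP n).1; apply/sphere_classP.
exact: sphere_homotopic_ext.
Qed.

Lemma milnor_exact : short_exact (hg_lim1_base x k) (hg_base R k x)
  (hg_lim_base x k) lim1_iota (@hg_to_lim R X x k).
Proof.
split.
- exact: lim1_iotaE represents_base.
- by apply: lim_eqP => n; exact: hg_map_base.
- move=> A B; have [[om ->] [om' ->]] := (lim1_surj A, lim1_surj B).
  have [[w Dw] [w' Dw']] := (represents_ex om, represents_ex om').
  rewrite (lim1_iotaE Dw) (lim1_iotaE Dw') => /sphere_classP.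
  by move=> /(represents_class Dw Dw').
- apply/seteqP; split=> B.
    move=> [A _ <-]; have [om ->] := lim1_surj A.
    have [w Dw] := represents_ex om; rewrite /= (lim1_iotaE Dw).
    move: Dw => [C CP]; apply/hg_to_lim_baseP => n; exists (C n).
    exact: (CP n).1.
  rewrite /= -[B]repr_classK => /hg_to_lim_baseP/represents_contractible[om Dw].
  by exists (lim1_class _ om) => //; exact: lim1_iotaE.
- by apply/seteqP; split=> // A _; have [B <-] := hg_to_lim_onto A; exists B.
Qed.

End Fixed.

End MilnorSequence.

(** * Naturality and multiplicativity *)

Section Naturality.
Variables (R : realType) (X Y : fibration_tower R) (x : lim_space X)
  (y : lim_space Y) (f : tower_map x y) (k : nat).

(** The images of contractions are contractions, with the images of the loops as
defects. *)
Lemma lim1_iota_natural (A : hg_lim1 x k) :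
  hg_map (lim_pmap f) (lim1_iota A) = lim1_iota (hg_lim1_map f A).
Proof.
have [om ->] := lim1_surj A; have [w Dw] := represents_ex om.
rewrite (lim1_iotaE Dw) hg_mapE hg_lim1_mapE; apply/esym/lim1_iotaE.
have [C CP] := Dw; exists (fun n => tmap (f n) (C n)) => n.
have [hC CE] := CP n; have hC' := (CP n.+1).1; have cf m := pmap_cont (f m).
split.
  have := arrow_map (cf n) hC.
  by congr arrow; apply/funext => s //=; exact: pmap_pt.
rewrite hg_arrow_map -CE.
rewrite (tmap_mul (cf n) (arrow_hg (om n)) (ft_arrow hC')); congr (_ ** _).
rewrite (tmap_comp (cf n.+1) (ft_cont Y n) hC').
rewrite (tmap_comp (ft_cont X n) (cf n) hC'); congr tmap.
by apply/funext => u; exact: tm_comm.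
Qed.

Lemma hg_to_lim_natural (A : homotopy_group R k x) :
  hg_lim_map f (hg_to_lim A) = hg_to_lim (hg_map (lim_pmap f) A).
Proof.
apply: lim_eqP => n; rewrite -[A]repr_classK.
transitivity (hg_map (f n) (hg_map (proj_pmap x n) (sphere_class (repr A)))) => //.
transitivity (hg_map (proj_pmap y n) (hg_map (lim_pmap f) (sphere_class (repr A)))) => //.
rewrite !hg_mapE; apply/sphere_classP; exact: sphere_homotopic_ext.
Qed.

End Naturality.

Section Juxtaposition.
Variables (R : realType) (k : nat).
Notation I := (unit_interval R).
Notation T := (cube R k.+1).

(** Juxtaposition along the first coordinate of the sphere, which commutes on
the nose with concatenation of tracks. *)
Definition jux (X : Type) (H L : T * I -> X) (z : T * I) : X :=
  if ival (z.1 ord0) <= 2^-1 then H (set_first z.1 (lo_half (z.1 ord0)), z.2)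
  else L (set_first z.1 (hi_half (z.1 ord0)), z.2).

Definition tjux (X : topologicalType) (A B : set (T * I -> X)) : set (T * I -> X) :=
  [set N | exists H L, [/\ A H, B L & track_homotopic (jux H L) N]].

Section InSpace.
Variables (X : topologicalType) (x : X).
Implicit Types (H L : T * I -> X) (A B : set (T * I -> X)).

Definition based_track H : Prop :=
  is_track H /\ forall s, cube_boundary s -> H (s, I0 R) = x.

Lemma based_track_bdry H s t : based_track H -> cube_boundary s -> H (s, t) = x.
Proof. by move=> [[_ Hb] H0] bs; rewrite Hb ?H0. Qed.

Lemma set_first_lo_bdry (s : T) : cube_boundary s ->
  cube_boundary (set_first s (lo_half (s ord0))).
Proof. by move=> bs; apply: set_first_bdry => //; exact: lo_endpoint. Qed.

Lemma set_first_hi_bdry (s : T) : cube_boundary s ->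
  cube_boundary (set_first s (hi_half (s ord0))).
Proof. by move=> bs; apply: set_first_bdry => //; exact: hi_endpoint. Qed.

Lemma jux_bdry H L s t : based_track H -> based_track L -> cube_boundary s ->
  jux H L (s, t) = x.
Proof.
move=> bH bL bs; rewrite /jux /=; case: ifP => _; apply: based_track_bdry => //.
  exact: set_first_lo_bdry.
exact: set_first_hi_bdry.
Qed.

(** The parameter space [Z] is the time for tracks, and the square for homotopies
of tracks. *)
Lemma cont_jux (Z : topologicalType) (h l : T * Z -> X) :
  continuous h -> continuous l ->
  (forall s z, cube_boundary s -> h (s, z) = l (s, z)) ->
  (forall s s' z, cube_boundary s -> cube_boundary s' -> h (s, z) = h (s', z)) ->
  continuous (fun z : T * Z => if ival (z.1 ord0) <= 2^-1
    then h (set_first z.1 (lo_half (z.1 ord0)), z.2)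
    else l (set_first z.1 (hi_half (z.1 ord0)), z.2)).
Proof.
move=> ch cl hl hh; have cs (phi : I -> I) : continuous phi ->
    continuous (fun z : T * Z => (set_first z.1 (phi (z.1 ord0)), z.2)).
  move=> cphi; apply: cont_pair; last exact: cont_snd.
  exact: cont_comp (@cont_fst _ _) (cont_set_first_map cphi).
apply: cont_glue_half.
- exact: cont_comp (cs _ (@cont_lo R)) ch.
- exact: cont_comp (cs _ (@cont_hi R)) cl.
- exact: cont_comp (@cont_fst _ _) (@cont_first _ _).
- move=> [s z] /= s2; rewrite lo_half1 // hi_half0 //.
  by rewrite -hl; [apply: hh|]; apply: set_first_endpoint; [right|left|left].
Qed.

Lemma jux_track H L : based_track H -> based_track L -> based_track (jux H L).
Proof.
move=> bH bL; split; last by move=> s bs; exact: jux_bdry.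
split; last by move=> s t bs; rewrite !jux_bdry.
apply: cont_jux; first exact: bH.1.1.
- exact: bL.1.1.
- by move=> s t bs; rewrite !based_track_bdry.
- by move=> s s' t bs bs'; rewrite !based_track_bdry.
Qed.

Lemma jux_homotopic H H' L L' : based_track H -> based_track L ->
  track_homotopic H H' -> track_homotopic L L' ->
  track_homotopic (jux H L) (jux H' L').
Proof.
move=> bH bL [K [cK K0 K1 Kb Ke]] [M [cM M0 M1 Mb Me]].
pose K' (z : T * (I * I)) := K ((z.1, z.2.1), z.2.2).
pose M' (z : T * (I * I)) := M ((z.1, z.2.1), z.2.2).
have Kx s z : cube_boundary s -> K' (s, z) = x by move=> bs; rewrite /K' Kb ?bH.2.
have Mx s z : cube_boundary s -> M' (s, z) = x by move=> bs; rewrite /M' Mb ?bL.2.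
have ca : continuous (fun z : T * (I * I) => ((z.1, z.2.1), z.2.2)).
  apply: cont_pair; last exact: cont_comp (@cont_snd _ _) (@cont_snd _ _).
  by apply: cont_pair; [exact: cont_fst|exact: cont_comp (@cont_snd _ _) (@cont_fst _ _)].
have cJ := cont_jux (cont_comp ca cK) (cont_comp ca cM).
have {}cJ := cJ (fun s z bs => etrans (Kx s z bs) (esym (Mx s z bs)))
  (fun s s' z bs bs' => etrans (Kx s z bs) (esym (Kx s' z bs'))).
exists (fun z => if ival (z.1.1 ord0) <= 2^-1
  then K' (set_first z.1.1 (lo_half (z.1.1 ord0)), (z.1.2, z.2))
  else M' (set_first z.1.1 (hi_half (z.1.1 ord0)), (z.1.2, z.2))); split.
- have cb : continuous (fun z : (T * I) * I => (z.1.1, (z.1.2, z.2))).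
    apply: cont_pair; first exact: cont_comp (@cont_fst _ _) (@cont_fst _ _).
    by apply: cont_pair; [exact: cont_comp (@cont_fst _ _) (@cont_snd _ _)|exact: cont_snd].
  exact: cont_comp cb cJ.
- by move=> [s t]; rewrite /jux /K' /M' /= K0 M0.
- by move=> [s t]; rewrite /jux /K' /M' /= K1 M1.
- move=> s t u bs; rewrite jux_bdry //=; case: ifP => _; rewrite ?Kx ?Mx //.
    exact: set_first_lo_bdry.
  exact: set_first_hi_bdry.
- by move=> s t u et; rewrite /jux /K' /M' /= Ke // Me.
Qed.

Lemma tjuxE H L : based_track H -> based_track L ->
  tjux (tclass H) (tclass L) = tclass (jux H L).
Proof.
move=> bH bL; apply/seteqP; split=> N.
  move=> [H' [L' [HH' LL' h]]].
  exact: track_homotopic_trans (jux_homotopic bH bL HH' LL') h.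
by move=> h; exists H, L; split=> //; apply: tclass_refl; [exact: bH.1|exact: bL.1].
Qed.

Definition based (a : T -> X) : Prop := forall s, cube_boundary s -> a s = x.

Lemma arrow_based a b A : based a -> arrow a b A ->
  exists H, [/\ based_track H, forall s, H (s, I0 R) = a s,
    forall s, H (s, I1 R) = b s & A = tclass H].
Proof.
move=> ba [H [tH H0 H1 AE]]; exists H; split=> //; split=> // s bs.
by rewrite H0 ba.
Qed.

Lemma arrow_based_end a b A : based a -> arrow a b A -> based b.
Proof. by move=> ba hA s bs; rewrite (arrow_bdry hA bs) ba. Qed.

Definition jux0 (a b : T -> X) (s : T) : X :=
  if ival (s ord0) <= 2^-1 then a (set_first s (lo_half (s ord0)))
  else b (set_first s (hi_half (s ord0))).

Lemma arrow_jux a b a' b' A A' : based a -> based a' ->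
  arrow a b A -> arrow a' b' A' -> arrow (jux0 a a') (jux0 b b') (tjux A A').
Proof.
move=> ba ba' /(arrow_based ba)[H [bH H0 H1 ->]].
move=> /(arrow_based ba')[L [bL L0 L1 ->]]; rewrite tjuxE //.
apply: arrow_class; first exact: (jux_track bH bL).1.
- by move=> s; rewrite /jux /jux0 /= H0 L0.
- by move=> s; rewrite /jux /jux0 /= H1 L1.
Qed.

Lemma tjux_mul a b c a' b' c' A B A' B' : based a -> based a' ->
  arrow a b A -> arrow b c B -> arrow a' b' A' -> arrow b' c' B' ->
  tjux (A ** B) (A' ** B') = tjux A A' ** tjux B B'.
Proof.
move=> ba ba' hA hB hA' hB'.
have bb := arrow_based_end ba hA; have bb' := arrow_based_end ba' hA'.
move: hA hB => /(arrow_based ba)[H [bH H0 H1 ->]] /(arrow_based bb)[L [bL L0 L1 ->]].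
move: hA' hB' => /(arrow_based ba')[H' [bH' H'0 H'1 ->]].
move=> /(arrow_based bb')[L' [bL' L'0 L'1 ->]].
have e s : H (s, I1 R) = L (s, I0 R) by rewrite H1 L0.
have e' s : H' (s, I1 R) = L' (s, I0 R) by rewrite H'1 L'0.
have bHL : based_track (tcat H L).
  by split; [exact: tcat_track bH.1 bL.1 e|move=> s bs; rewrite tcat0 bH.2].
have bHL' : based_track (tcat H' L').
  by split; [exact: tcat_track bH'.1 bL'.1 e'|move=> s bs; rewrite tcat0 bH'.2].
rewrite (tmulE bH.1 bL.1 e) (tmulE bH'.1 bL'.1 e').
rewrite !tjuxE // tmulE; try exact: (jux_track _ _).1; last first.
  by move=> s; rewrite /jux /= e e'.
by congr tclass; apply/funext => z; rewrite /jux /tcat /=; case: ifP; case: ifP.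
Qed.

End InSpace.

Lemma tmap_jux (X Y : topologicalType) (x : X) (y : Y) (f : pointed_map x y)
    (a b a' b' : T -> X) A A' : based x a -> based x a' ->
  arrow a b A -> arrow a' b' A' ->
  tmap f (tjux A A') = tjux (tmap f A) (tmap f A').
Proof.
move=> ba ba' /(arrow_based ba)[H [bH H0 H1 ->]].
move=> /(arrow_based ba')[L [bL L0 L1 ->]].
have cf := pmap_cont f; have bf K : based_track x K -> based_track y (fun z => f (K z)).
  move=> bK; split; first exact: track_map cf bK.1.
  by move=> s bs; rewrite bK.2 ?pmap_pt.
rewrite (tjuxE bH bL) (tmapE cf (jux_track bH bL).1) (tmapE cf bH.1) (tmapE cf bL.1).
rewrite (tjuxE (bf _ bH) (bf _ bL)); congr tclass.
by apply/funext => z; rewrite /jux; case: ifP.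
Qed.

(** The first coordinate of the sphere is the second one of the sphere of one
dimension more. *)
Lemma hg_arrow_jux (X : topologicalType) (x : X) (A B : homotopy_group R k.+2 x) :
  tjux (hg_arrow A) (hg_arrow B) = hg_arrow (A * B)%g.
Proof.
rewrite -hg_mul2_mul -[A]repr_classK -[B]repr_classK.
move: (repr A) (repr B) => a b; rewrite hg_mul2E !hg_arrowE.
have bs (c : sphere R k.+2 x) : based_track x (sphere_track c).
  by split; [exact: sphere_track_track|move=> s _; apply: sphere_track_end; left].
rewrite (tjuxE (bs a) (bs b)); congr tclass; apply/funext => -[s t].
rewrite /jux /sphere_track -[s]cube_cons_tail sphere_cat2_cons /=.
by rewrite !cube_cons0 !set_first_cons.
Qed.

End Juxtaposition.

Section Multiplicativity.
Variables (R : realType) (X : fibration_tower R) (x : lim_space X) (k : nat).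

Lemma represents_mul (om om' : forall n, homotopy_group R k.+2 (lim_coord x n))
    (w w' : sphere R k.+1 x) : represents om w -> represents om' w' ->
  represents (fun n => om n * om' n)%g (sphere_cat w w').
Proof.
move=> [C CP] [C' CP']; exists (fun n => tjux (C n) (C' n)) => n.
have [hC CE] := CP n; have [hC' CE'] := CP' n.
have hD := (CP n.+1).1; have hD' := (CP' n.+1).1.
have bx m : based (lim_coord x m) (fun _ : cube R k.+1 => lim_coord x m) by [].
split.
  have := arrow_jux (bx n) (bx n) hC hC'; congr arrow.
    by apply/funext => s; rewrite /jux0; case: ifP.
  by apply/funext => s; rewrite /jux0 /= /cat_fun; case: ifP.
rewrite (tmap_jux (ft_pmap x n) (bx n.+1) (bx n.+1) hD hD') -hg_arrow_jux.
have hW := arrow_hg (om n); have hW' := arrow_hg (om' n).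
by rewrite -(tjux_mul (bx n) (bx n) hW (ft_arrow hD) hW' (ft_arrow hD')) CE CE'.
Qed.

Lemma lim1_iota_mul (A B : hg_lim1 x k.+1) :
  lim1_iota (hg_lim1_mul A B) = (lim1_iota A * lim1_iota B)%g.
Proof.
have [[om ->] [om' ->]] := (lim1_surj A, lim1_surj B).
have [[w Dw] [w' Dw']] := (represents_ex om, represents_ex om').
rewrite (lim1_iotaE Dw) (lim1_iotaE Dw') [RHS]hg_mulE.
rewrite -(lim1_iotaE (represents_mul Dw Dw')); congr lim1_iota.
by apply: lim1_mulE => n; exact: hg_mulC.
Qed.

End Multiplicativity.

(** * Paths, and tracks of points under a homotopy *)

Section PathClasses.
Variable R : realType.
Notation I := (unit_interval R).
Notation T0 := (cube R 0).
Notation pt u := (fun _ : T0 => u).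

Section InSpace.
Variable X : topologicalType.
Implicit Types (g : I -> X) (u v : X).

(** For k = 0 a track is a path. *)
Definition pclass g : set (T0 * I -> X) := tclass (fun z : T0 * I => g z.2).

Lemma cube0_eq (s s' : T0) : s = s'.
Proof. by apply/funext => -[]. Qed.

Lemma path_track g : continuous g -> is_track (fun z : T0 * I => g z.2).
Proof.
by move=> cg; split=> [|s t /no_boundary//]; exact: cont_comp (@cont_snd _ _) cg.
Qed.

Lemma path_homotopicP g g' : path_homotopic g g' <->
  track_homotopic (fun z : T0 * I => g z.2) (fun z => g' z.2).
Proof.
split=> [[h [ch h0 h1 he]]|[K [cK K0 K1 _ Ke]]].
  exists (fun z => h (z.1.2, z.2)); split.
  - apply: cont_comp ch; apply: cont_pair; last exact: cont_snd.
    exact: cont_comp (@cont_fst _ _) (@cont_snd _ _).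
  - by move=> [s t]; exact: h0.
  - by move=> [s t]; exact: h1.
  - by move=> s t u /no_boundary.
  - by move=> s t u [] -> /=; have [] := he u.
pose s0 : T0 := fun=> I0 R.
exists (fun z => K ((s0, z.1), z.2)); split.
- apply: cont_comp cK; apply: cont_pair; last exact: cont_snd.
  by apply: cont_pair; [exact: cst_continuous|exact: cont_fst].
- by move=> s; rewrite K0.
- by move=> s; rewrite K1.
- by move=> t; split; rewrite Ke //; [left|right].
Qed.

Lemma pclassE g g' : path_homotopic g g' -> pclass g = pclass g'.
Proof. by move=> /path_homotopicP/tclassE. Qed.

Lemma pclassP g g' : continuous g' -> pclass g = pclass g' -> path_homotopic g g'.
Proof. by move=> cg' e; apply/path_homotopicP/tclassP => //; exact: path_track. Qed.

Lemma arrow_path g u v : continuous g -> g (I0 R) = u -> g (I1 R) = v ->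
  arrow (pt u) (pt v) (pclass g).
Proof. by move=> cg g0 g1; apply: arrow_class => //; exact: path_track. Qed.

Lemma arrow_pathP u v A : arrow (pt u) (pt v) A ->
  exists g, [/\ continuous g, g (I0 R) = u, g (I1 R) = v & A = pclass g].
Proof.
move=> [H [[cH _] H0 H1 ->]]; pose s0 : T0 := fun=> I0 R.
exists (fun t => H (s0, t)); split=> //.
  by apply: cont_comp cH; apply: cont_pair; [exact: cst_continuous|move=> t].
congr tclass; apply/funext => -[s t]; congr (H (_, t)); exact: cube0_eq.
Qed.

Lemma pclass_cat g g' : continuous g -> continuous g' -> g (I1 R) = g' (I0 R) ->
  pclass (path_cat g g') = pclass g ** pclass g'.
Proof. by move=> cg cg' e; rewrite /pclass tmulE //; exact: path_track. Qed.

Lemma pi0_classP (x u v : X) :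
  pi0_class R x u = pi0_class R x v <-> exists A, arrow (pt u) (pt v) A.
Proof. by rewrite -(sphere_homotopicP (pt_sphere R x u) (pt_sphere R x v)); exact: sphere_classP. Qed.

End InSpace.

Lemma pt_eta (X : Type) (a : T0 -> X) : a = pt (a (fun=> I0 R)).
Proof. by apply/funext => s; rewrite [s](cube0_eq _ (fun=> I0 R)). Qed.

Section Trace.
Variables (X Y : topologicalType) (F : Y * I -> X).
Hypothesis cF : continuous F.

(** The path that a point runs through under a homotopy. *)
Definition trace (u : Y) : set (T0 * I -> X) := pclass (fun t => F (u, t)).

Lemma cont_slice (t : I) : continuous (fun u => F (u, t)).
Proof. by apply: cont_comp cF; apply: cont_pair; [move=> u|exact: cst_continuous]. Qed.

Lemma cont_trace (u : Y) : continuous (fun t => F (u, t)).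
Proof. by apply: cont_comp cF; apply: cont_pair; [exact: cst_continuous|move=> t]. Qed.

Lemma arrow_trace u : arrow (pt (F (u, I0 R))) (pt (F (u, I1 R))) (trace u).
Proof. by apply: arrow_path => //; exact: cont_trace. Qed.

(** A homotopy applied to a path fills a square. *)
Lemma trace_natural u v A : arrow (pt u) (pt v) A ->
  tmap (fun w => F (w, I0 R)) A ** trace v =
  trace u ** tmap (fun w => F (w, I1 R)) A.
Proof.
move=> /arrow_pathP[g [cg g0 g1 ->]].
have tg := path_track cg; have c0 := @cont_slice (I0 R); have c1 := @cont_slice (I1 R).
rewrite (tmapE c0 tg) (tmapE c1 tg).
rewrite (tmulE (track_map c0 tg) (path_track (@cont_trace v))) /= ?g1 //.
rewrite (tmulE (path_track (@cont_trace u)) (track_map c1 tg)) /= ?g0 //.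
apply: tclassE.
have := @track_square R 0 X (fun z => F (g z.1.2, z.2)); rewrite /= g0 g1; apply.
  apply: cont_comp cF; apply: cont_pair; last exact: cont_snd.
  have c : continuous (fun z : (T0 * I) * I => z.1.2).
    exact: cont_comp (@cont_fst _ _) (@cont_snd _ _).
  exact: cont_comp c cg.
by move=> s t w /no_boundary.
Qed.

End Trace.

Definition hcat (X Y : topologicalType) (F G : Y * I -> X) (z : Y * I) : X :=
  if ival z.2 <= 2^-1 then F (z.1, lo_half z.2) else G (z.1, hi_half z.2).

Definition hrev (X Y : topologicalType) (F : Y * I -> X) (z : Y * I) : X :=
  F (z.1, flip z.2).

Lemma cont_hcat (X Y : topologicalType) (F G : Y * I -> X) :
  continuous F -> continuous G -> (forall u, F (u, I1 R) = G (u, I0 R)) ->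
  continuous (hcat F G).
Proof.
move=> cF cG e; apply: cont_glue_half.
- apply: cont_comp cF; apply: cont_pair; first exact: cont_fst.
  exact: cont_comp (@cont_snd _ _) (@cont_lo R).
- apply: cont_comp cG; apply: cont_pair; first exact: cont_fst.
  exact: cont_comp (@cont_snd _ _) (@cont_hi R).
- exact: cont_snd.
- by move=> [u t] /= t2; rewrite lo_half1 // hi_half0.
Qed.

Lemma hcat0 (X Y : topologicalType) (F G : Y * I -> X) u :
  hcat F G (u, I0 R) = F (u, I0 R).
Proof. by rewrite /hcat /= half_I0 lo0. Qed.

Lemma hcat1 (X Y : topologicalType) (F G : Y * I -> X) u :
  hcat F G (u, I1 R) = G (u, I1 R).
Proof. by rewrite /hcat /= half_I1 hi1. Qed.

Lemma trace_hcat (X Y : topologicalType) (F G : Y * I -> X) u :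
  continuous F -> continuous G -> F (u, I1 R) = G (u, I0 R) ->
  trace (hcat F G) u = trace F u ** trace G u.
Proof. by move=> cF cG e; rewrite -pclass_cat //; exact: cont_trace. Qed.

Lemma cont_hrev (X Y : topologicalType) (F : Y * I -> X) :
  continuous F -> continuous (hrev F).
Proof.
move=> cF; apply: cont_comp cF; apply: cont_pair; first exact: cont_fst.
exact: cont_comp (@cont_snd _ _) (@cont_flip R).
Qed.

Lemma trace_hrev (X Y : topologicalType) (F : Y * I -> X) u :
  continuous F -> trace (hrev F) u = tinv (trace F u).
Proof. by move=> cF; rewrite tinvE //; exact: path_track (cont_trace cF (u := u)). Qed.

Lemma tmap_pair (X Y X' Y' : topologicalType) (f : X -> X') (g : Y -> Y')
    k (a b : cube R k -> X) (a' b' : cube R k -> Y) A B :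
  continuous f -> continuous g -> arrow a b A -> arrow a' b' B ->
  tmap (fun u => (f u.1, g u.2)) (tpair A B) = tpair (tmap f A) (tmap g B).
Proof.
move=> cf cg [H [tH _ _ ->]] [L [tL _ _ ->]].
have cfg : continuous (fun u : X * Y => (f u.1, g u.2)).
  apply: cont_pair; first exact: cont_comp (@cont_fst _ _) cf.
  exact: cont_comp (@cont_snd _ _) cg.
rewrite (tpairE tH tL) (tmapE cfg (track_pair tH tL)) (tmapE cf tH) (tmapE cg tL).
by rewrite (tpairE (track_map cf tH) (track_map cg tL)).
Qed.

End PathClasses.

(** * Loops in an H-space *)

Section HSpaces.
Variable R : realType.
Notation I := (unit_interval R).
Notation T0 := (cube R 0).
Notation pt u := (fun _ : T0 => u).
Variables (X : topologicalType) (x : X) (m : hspace R x).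
Implicit Types (A B : set (T0 * I -> X)).

Definition hmul A B : set (T0 * I -> X) := tmap m (tpair A B).

Lemma arrow_hmul u v u' v' A B : arrow (pt u) (pt v) A -> arrow (pt u') (pt v') B ->
  arrow (pt (m (u, u'))) (pt (m (v, v'))) (hmul A B).
Proof. by move=> hA hB; exact: (arrow_map (@hs_cont _ _ _ m) (arrow_pair hA hB)). Qed.

Lemma hmul_mul u v w u' v' w' A B A' B' :
  arrow (pt u) (pt v) A -> arrow (pt v) (pt w) B ->
  arrow (pt u') (pt v') A' -> arrow (pt v') (pt w') B' ->
  hmul (A ** B) (A' ** B') = hmul A A' ** hmul B B'.
Proof.
move=> hA hB hA' hB'; rewrite /hmul (tpair_mul hA hB hA' hB').
exact: (tmap_mul (@hs_cont _ _ _ m) (arrow_pair hA hA') (arrow_pair hB hB')).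
Qed.

Notation loop A := (arrow (pt x) (pt x) A).
Notation e := (@tid R 0 X (pt x)).

Lemma loop_id : loop e.
Proof. by apply: arrow_id; exact: cst_continuous. Qed.

Lemma tmap_idfun (u v : X) A : arrow (pt u) (pt v) A -> tmap id A = A.
Proof. by move=> [H [tH _ _ ->]]; rewrite tmapE //; move=> ?. Qed.

Lemma hmul_idl u v A : arrow (pt u) (pt v) A ->
  hmul e A = tmap (fun w => m (x, w)) A.
Proof.
move=> [H [tH _ _ ->]]; have te := id_track (k := 0) (@cst_continuous T0 X x).
have cm : continuous (fun w => m (x, w)).
  by apply: cont_comp (@hs_cont _ _ _ m); apply: cont_pair; [exact: cst_continuous|move=> ?].
rewrite /hmul (tpairE te tH) (tmapE cm tH).
by rewrite (tmapE (@hs_cont _ _ _ m) (track_pair te tH)).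
Qed.

Lemma hmul_idr u v A : arrow (pt u) (pt v) A ->
  hmul A e = tmap (fun w => m (w, x)) A.
Proof.
move=> [H [tH _ _ ->]]; have te := id_track (k := 0) (@cst_continuous T0 X x).
have cm : continuous (fun w => m (w, x)).
  by apply: cont_comp (@hs_cont _ _ _ m); apply: cont_pair; [move=> ?|exact: cst_continuous].
rewrite /hmul (tpairE tH te) (tmapE cm tH).
by rewrite (tmapE (@hs_cont _ _ _ m) (track_pair tH te)).
Qed.

(** The loop [L] is the one through which the fixed base point runs. *)
Lemma loop_conjugation (f : X -> X) : f x = x -> homotopic R f id ->
  exists2 L, loop L & forall A, loop A -> tmap f A = L ** A ** tinv L.
Proof.
move=> fx [h [ch h0 h1]].
have hL : loop (trace h x) by have := arrow_trace ch x; rewrite h0 h1 fx.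
exists (trace h x) => // A hA; have := trace_natural ch hA.
have -> : (fun w => h (w, I1 R)) = id by apply/funext.
have -> : (fun w => h (w, I0 R)) = f by apply/funext.
have cf : continuous f by rewrite (_ : f = fun w => h (w, I0 R)); [exact: cont_slice|apply/funext].
have hfA : loop (tmap f A) by have := arrow_map cf hA; rewrite /comp fx.
by rewrite (tmap_idfun hA) => <-; rewrite (tmulrK hfA hL).
Qed.

(** The Eckmann-Hilton argument works although the unit laws hold up to
homotopy only: multiplication by
the base point is conjugation by a loop, and conjugates of all loops are all
loops. *)
Lemma loop_mulC A B : loop A -> loop B -> A ** B = B ** A.
Proof.
have [L hL LE] := loop_conjugation (hs_pt m) (hs_unitl m).
have [M hM ME] := loop_conjugation (hs_pt m) (hs_unitr m).
have comm A' B' : loop A' -> loop B' ->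
    (M ** A' ** tinv M) ** (L ** B' ** tinv L) = (L ** B' ** tinv L) ** (M ** A' ** tinv M).
  move=> hA hB; rewrite -(LE B' hB) -(ME A' hA) -(hmul_idr hA) -(hmul_idl hB).
  rewrite -(hmul_mul hA loop_id loop_id hB) -(hmul_mul loop_id hA hB loop_id).
  by rewrite (tmul1r hA) (tmul1l hA) (tmul1r hB) (tmul1l hB).
have conjK N C : loop N -> loop C -> loop (tinv N ** C ** N) /\
    N ** (tinv N ** C ** N) ** tinv N = C.
  move=> hN hC; split; first exact: arrow_mul (arrow_mul (arrow_inv hN) hC) hN.
  by rewrite -!tmulA (tmulV hN) (tmul1r hC) (tmulKV hN hC).
move=> hA hB; have [hA' AE] := conjK M A hM hA; have [hB' BE] := conjK L B hL hB.
by have := comm _ _ hA' hB'; rewrite AE BE.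
Qed.

Lemma conj_loop L A : loop L -> loop A -> L ** A ** tinv L = A.
Proof. by move=> hL hA; rewrite (loop_mulC hL hA) (tmulrK hA hL). Qed.

Lemma hmul_loop A B : loop A -> loop B -> hmul A B = A ** B.
Proof.
move=> hA hB; rewrite -{1}(tmul1r hA) -{1}(tmul1l hB).
rewrite (hmul_mul hA loop_id loop_id hB) (hmul_idr hA) (hmul_idl hB).
have [L hL ->] // := loop_conjugation (hs_pt m) (hs_unitl m).
have [M hM ->] // := loop_conjugation (hs_pt m) (hs_unitr m).
by rewrite !conj_loop.
Qed.

Lemma hspace_pi1_commute (A B : homotopy_group R 1 x) : commute A B.
Proof.
apply: hg_arrow_inj; rewrite !hg_arrow_mul.
exact: loop_mulC (arrow_hg A) (arrow_hg B).
Qed.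

(** Multiplication by the points of a loop is a homotopy from the identity to
itself, up to the homotopy that makes the base point a unit. *)
Lemma self_homotopy A : loop A -> exists K : X * I -> X,
  [/\ continuous K, forall u, K (u, I0 R) = u, forall u, K (u, I1 R) = u
    & trace K x = A].
Proof.
move=> hA; have [g [cg g0 g1 AE]] := arrow_pathP hA.
have [h [ch h0 h1]] := hs_unitl m.
pose K1 (z : X * I) := m (g z.2, z.1).
have cK1 : continuous K1.
  apply: cont_comp (@hs_cont _ _ _ m); apply: cont_pair; last exact: cont_fst.
  exact: cont_comp (@cont_snd _ _) cg.
have e1 u : hrev h (u, I1 R) = K1 (u, I0 R) by rewrite /hrev /K1 /= flip1 h0 g0.
have cK2 := cont_hcat (cont_hrev ch) cK1 e1.
have e2 u : hcat (hrev h) K1 (u, I1 R) = h (u, I0 R).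
  by rewrite hcat1 /K1 /= g1 h0.
exists (hcat (hcat (hrev h) K1) h); split.
- exact: cont_hcat.
- by move=> u; rewrite !hcat0 /hrev /= flip0 h1.
- by move=> u; rewrite hcat1 h1.
have hL : loop (trace h x) by have := arrow_trace ch x; rewrite h0 h1 hs_pt.
have K1E : trace K1 x = A.
  transitivity (tmap (fun w => m (w, x)) A).
    have cm : continuous (fun w => m (w, x)).
      by apply: cont_comp (@hs_cont _ _ _ m); apply: cont_pair; [move=> ?|exact: cst_continuous].
    by rewrite AE (tmapE cm (path_track cg)).
  by rewrite -(hmul_idr hA) (hmul_loop hA loop_id) (tmul1r hA).
rewrite trace_hcat // trace_hcat //; last exact: cont_hrev.
by rewrite trace_hrev // K1E (loop_mulC (arrow_inv hL) hA) (tmulrKV hA hL).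
Qed.

End HSpaces.

(** * Products on the limit of a tower of H-spaces *)

Section LimitProducts.
Variables (R : realType) (X : fibration_tower R) (x : lim_space X).
Variable m : forall n, hspace R (lim_coord x n).
Notation I := (unit_interval R).
Notation T0 := (cube R 0).
Notation pt u := (fun _ : T0 => u).
Notation p := (@ft_map R X _).

(** The loop of the base point is undone by composing the given homotopy with a
homotopy of the identity of the target under which the base point runs
through the inverse loop. *)
Lemma hmap_homotopies_ex :
  (forall n, is_hmap (ft_pmap x n) (m n.+1) (m n)) ->
  exists h, hmap_homotopies m h.
Proof.
move=> hm; suff H n : exists h : (X n.+1 * X n.+1) * I -> X n,
    hmap_homotopy (ft_pmap x n) (m n.+1) (m n) h /\
    path_homotopic (fun t => h ((lim_coord x n.+1, lim_coord x n.+1), t))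
                   (fun=> lim_coord x n).
  by exists (fun n => sval (cid (H n))) => n; exact: svalP (cid (H n)).
have [h [ch h0 h1]] := hm n; pose xx := (lim_coord x n.+1, lim_coord x n.+1).
have hL : arrow (pt (lim_coord x n)) (pt (lim_coord x n)) (trace h xx).
  by have := arrow_trace ch xx; rewrite h0 h1 /= hs_pt !coordP hs_pt.
have [K [cK K0 K1 KE]] := self_homotopy (m n) (arrow_inv hL).
pose F (z : (X n.+1 * X n.+1) * I) := K (m n (p z.1.1, p z.1.2), z.2).
have cF : continuous F.
  apply: cont_comp cK; apply: cont_pair; last exact: cont_snd.
  apply: cont_comp (@hs_cont _ _ _ (m n)); apply: cont_pair.
    apply: cont_comp (ft_cont X n); exact: cont_comp (@cont_fst _ _) (@cont_fst _ _).
  apply: cont_comp (ft_cont X n); exact: cont_comp (@cont_fst _ _) (@cont_snd _ _).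
have e u : h (u, I1 R) = F (u, I0 R) by rewrite h1 /F /= K0.
exists (hcat h F); split.
  split; first exact: cont_hcat.
  - by move=> u; rewrite hcat0 h0.
  - by move=> u; rewrite hcat1 /F /= K1.
apply: pclassP; first exact: cst_continuous.
transitivity (trace h xx ** trace F xx); first exact: trace_hcat.
have -> : trace F xx = trace K (lim_coord x n).
  by congr pclass; apply/funext => t; rewrite /F /= !coordP hs_pt.
by rewrite KE (tmulV hL).
Qed.

Variable h : forall n, (X n.+1 * X n.+1) * I -> X n.
Hypothesis hP : hmap_homotopies m h.

Let ch n : continuous (@h n). Proof. by have [[]] := hP n. Qed.
Let h0 n u : h (u, I0 R) = ft_map X (m n.+1 u).
Proof. by have [[_ + _] _] := hP n; exact. Qed.
Let h1 n u : h (u, I1 R) = m n (ft_map X u.1, ft_map X u.2).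
Proof. by have [[_ _ +] _] := hP n; exact. Qed.

Lemma arrow_hmap n u v : arrow (pt (ft_map X (m n.+1 (u, v))))
  (pt (m n (ft_map X u, ft_map X v))) (trace (@h n) (u, v)).
Proof. by have := arrow_trace (@ch n) (u, v); rewrite h0 h1. Qed.

Lemma trace_base n : trace (@h n) (lim_coord x n.+1, lim_coord x n.+1) =
  tid (pt (lim_coord x n)).
Proof. exact: pclassE (proj2 (hP n)). Qed.

Lemma hmap_natural n u v u' v' A B :
  arrow (pt u) (pt v) A -> arrow (pt u') (pt v') B ->
  tmap (@ft_map R X n) (hmul (m n.+1) A B) ** trace (@h n) (v, v') =
  trace (@h n) (u, u') ** hmul (m n) (tmap (@ft_map R X n) A) (tmap (@ft_map R X n) B).
Proof.
move=> hA hB; have hAB := arrow_pair hA hB.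
have := trace_natural (@ch n) hAB.
have -> : (fun w => h (w, I0 R)) = (@ft_map R X n) \o (m n.+1) by apply/funext.
rewrite -(tmap_comp (@hs_cont _ _ _ (m n.+1)) (ft_cont X n) hAB) /hmul => ->.
have cp2 : continuous (fun u : X n.+1 * X n.+1 => (ft_map X u.1, ft_map X u.2)).
  apply: cont_pair; first exact: cont_comp (@cont_fst _ _) (ft_cont X n).
  exact: cont_comp (@cont_snd _ _) (ft_cont X n).
rewrite -(tmap_pair (ft_cont X n) (ft_cont X n) hA hB).
rewrite (tmap_comp cp2 (@hs_cont _ _ _ (m n)) hAB).
by congr (_ ** tmap _ _); apply/funext.
Qed.

(** Only the classes of the paths matter. *)
Lemma lim_productP u v w : lim_product m h u v w <->
  exists G : forall n, set (T0 * I -> X n), forall n,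
    arrow (pt (lim_coord w n)) (pt (m n (lim_coord u n, lim_coord v n))) (G n) /\
    tmap (@ft_map R X n) (G n.+1) **
      trace (@h n) (lim_coord u n.+1, lim_coord v n.+1) = G n.
Proof.
have catE n (g : I -> X n.+1) (cg : continuous g) : g (I1 R) = m n.+1 (lim_coord u n.+1, lim_coord v n.+1) ->
    pclass (path_cat (fun t => ft_map X (g t))
      (fun t => h ((lim_coord u n.+1, lim_coord v n.+1), t))) =
    tmap (@ft_map R X n) (pclass g) ** trace (@h n) (lim_coord u n.+1, lim_coord v n.+1).
  move=> g1; rewrite pclass_cat; last by rewrite g1 h0.
  - by congr (_ ** _); rewrite (tmapE (ft_cont X n) (path_track cg)).
  - exact: cont_comp cg (ft_cont X n).
  - exact: (@cont_trace R (X n) _ (@h n) (@ch n)).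
split.
  move=> [g gP]; exists (fun n => pclass (g n)) => n.
  have [cg g0 g1 gh] := gP n; have [cg' _ g1' _] := gP n.+1.
  by split; [exact: arrow_path|rewrite -catE //; exact: pclassE].
move=> [G GP]; pose gP n := cid (arrow_pathP (GP n).1).
exists (fun n => sval (gP n)) => n.
have [cg g0 g1 GE] := svalP (gP n); have [cg' _ g1' GE'] := svalP (gP n.+1).
split=> //; apply: pclassP => //.
by rewrite catE // -GE' -GE; exact: (GP n).2.
Qed.

Lemma lim_product_ex u v : exists w, lim_product m h u v w.
Proof.
pose uv n := (lim_coord u n, lim_coord v n).
have [||C CP] := @dep_choice_seq (fun n => X n * set (T0 * I -> X n))%type
  (fun n D => arrow (pt D.1) (pt (m n (uv n))) D.2)
  (fun n D D' => ft_map X D'.1 = D.1 /\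
     tmap (@ft_map R X n) D'.2 ** trace (@h n) (uv n.+1) = D.2).
- exists (m 0 (uv 0), tid (pt (m 0 (uv 0)))) => /=.
  by apply: arrow_id; exact: cst_continuous.
- move=> n [w G] /= hG.
  have hh : arrow (pt (ft_map X (m n.+1 (uv n.+1)))) (pt (m n (uv n))) (trace (@h n) (uv n.+1)).
    by have := @arrow_hmap n (uv n.+1).1 (uv n.+1).2; rewrite /= !coordP.
  have c : continuous (pt (m n.+1 (uv n.+1))) by exact: cst_continuous.
  have [e [A [hA eb pA]]] := lift_arrow (ft_cont X n) (@ft_fib R X n) c
    (arrow_mul hh (arrow_inv hG)).
  (* The lift starts at the product of u and v and ends at the new point of the
     limit; the path from the limit to the product is its inverse. *)
  rewrite (pt_eta e) in hA eb; exists (e (fun=> I0 R), tinv A); split=> /=.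
    exact: arrow_inv.
  split; first exact: (congr1 (@^~ (fun=> I0 R)) eb).
  rewrite (tmap_inv (ft_cont X n) hA) pA (tinv_mul hh (arrow_inv hG)) (tinvK hG).
  exact: tmulrKV hG hh.
exists (lim_tuple (fun n (_ : unit) => (CP n).2.1) tt).
by apply/lim_productP; exists (fun n => (C n).2) => n; have [? []] := CP n.
Qed.

(** With [M_n] the product of the coordinates of [A] and [B], the paths
[G_n M_n G'_n^-1] from [w_n] to [w'_n] match in the tower by naturality of [h]. *)
Lemma lim_product_arrow u v w u' v' w' A B :
  lim_product m h u v w -> lim_product m h u' v' w' ->
  arrow (pt u) (pt u') A -> arrow (pt v) (pt v') B ->
  exists C, arrow (pt w) (pt w') C.
Proof.
move=> /lim_productP[G GP] /lim_productP[G' GP'] hA hB.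
pose Q n (D : set (T0 * I -> lim_space X)) := tmap (fun u => lim_coord u n) D.
have hQA n : arrow (pt (lim_coord u n)) (pt (lim_coord u' n)) (Q n A) := proj_arrow n hA.
have hQB n : arrow (pt (lim_coord v n)) (pt (lim_coord v' n)) (Q n B) := proj_arrow n hB.
have hM n := arrow_hmul (m n) (hQA n) (hQB n).
have hG n := (GP n).1; have hG' n := (GP' n).1.
have hMG n := arrow_mul (hM n) (arrow_inv (hG' n)).
apply: (@lim_arrow R X 0 (pt w) (pt w')
  (fun n => G n ** (hmul (m n) (Q n A) (Q n B) ** tinv (G' n)))) => n.
  exact: arrow_mul (hG n) (hMG n).
have cf := ft_cont X n.
rewrite (tmap_mul cf (hG n.+1) (hMG n.+1)).
rewrite (tmap_mul cf (hM n.+1) (arrow_inv (hG' n.+1))) (tmap_inv cf (hG' n.+1)).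
have [_ <-] := GP n; have [_ <-] := GP' n.
have hPG' := arrow_map cf (hG' n.+1); rewrite /comp /= coordP in hPG'.
have hh := @arrow_hmap n (lim_coord u n.+1) (lim_coord v n.+1).
have hh' := @arrow_hmap n (lim_coord u' n.+1) (lim_coord v' n.+1).
rewrite (tinv_mul hPG' hh').
have nat := hmap_natural (hQA n.+1) (hQB n.+1).
rewrite [tmap _ (Q n.+1 A)](ft_proj_arrow n hA) in nat.
rewrite [tmap _ (Q n.+1 B)](ft_proj_arrow n hB) in nat.
have hPM := arrow_map cf (hM n.+1).
rewrite -!tmulA; congr (_ ** _).
by rewrite [RHS]tmulA -nat !tmulA (tmulrK hPM hh').
Qed.

Definition lim_mul (A B : homotopy_group R 0 x) : homotopy_group R 0 x :=
  pi0_class R x (sval (cid (lim_product_ex (pi0_point A) (pi0_point B)))).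

Lemma lim_mulE u v w : lim_product m h u v w ->
  lim_mul (pi0_class R x u) (pi0_class R x v) = pi0_class R x w.
Proof.
move=> uvw; rewrite /lim_mul; case: cid => w' /= uvw'.
have [A hA] := (@pi0_classP R _ x _ _).1 (pi0_pointK (pi0_class R x u)).
have [B hB] := (@pi0_classP R _ x _ _).1 (pi0_pointK (pi0_class R x v)).
by apply/pi0_classP; exact: lim_product_arrow uvw' uvw hA hB.
Qed.

(** The contractions of [w] are [(C_n C'_n) G_n^-1], with the products of paths
given by the H-spaces; for loops these products are the concatenations. *)
Lemma represents_product om om' (u v w : lim_space X) :
  represents om (pt_sphere R x u) -> represents om' (pt_sphere R x v) ->
  lim_product m h u v w ->
  represents (fun n => om n * om' n)%g (pt_sphere R x w).
Proof.
move=> [C CP] [C' CP'] /lim_productP[G GP].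
have hC n : arrow (pt (lim_coord x n)) (pt (lim_coord u n)) (C n) := (CP n).1.
have hC' n : arrow (pt (lim_coord x n)) (pt (lim_coord v n)) (C' n) := (CP' n).1.
have hG n := (GP n).1.
have hM n := arrow_hmul (m n) (hC n) (hC' n).
have hM' n : arrow (pt (lim_coord x n)) (pt (m n (lim_coord u n, lim_coord v n)))
    (hmul (m n) (C n) (C' n)) by have := hM n; rewrite hs_pt.
exists (fun n => hmul (m n) (C n) (C' n) ** tinv (G n)) => n.
split; first exact: arrow_mul (hM' n) (arrow_inv (hG n)).
have cf := ft_cont X n.
rewrite (tmap_mul cf (hM n.+1) (arrow_inv (hG n.+1))) (tmap_inv cf (hG n.+1)).
have hW := arrow_hg (om n); have hW' := arrow_hg (om' n).
have [_ CE] := CP n; have [_ CE'] := CP' n; have [_ GE] := GP n.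
rewrite hg_arrow_mul -(hmul_loop (m n) hW hW').
have nat := hmap_natural (hC n.+1) (hC' n.+1); rewrite trace_base in nat.
have hPC := arrow_map cf (hC n.+1); have hPC' := arrow_map cf (hC' n.+1).
rewrite /comp !coordP in hPC hPC'.
have hPM := arrow_hmul (m n) hPC hPC'; rewrite hs_pt in hPM.
rewrite (tmul1l hPM) in nat.
have hh := @arrow_hmap n (lim_coord u n.+1) (lim_coord v n.+1); rewrite !coordP in hh.
have hPM' := arrow_map cf (hM n.+1); rewrite /comp in hPM'.
have hPG := arrow_map cf (hG n.+1); rewrite /comp coordP in hPG.
rewrite -(tmulrK hPM' hh) nat -!tmulA.
have hr := arrow_mul (arrow_inv hh) (arrow_inv hPG).
rewrite [LHS]tmulA -(hmul_mul (m n) hW hPC hW' hPC') CE CE' -GE.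
by rewrite (tinv_mul hPG hh).
Qed.

Lemma lim1_iota_lim_mul (A B : hg_lim1 x 0) :
  lim1_iota (hg_lim1_mul A B) = lim_mul (lim1_iota A) (lim1_iota B).
Proof.
have [[om ->] [om' ->]] := (lim1_surj A, lim1_surj B).
have pts (o : forall n, homotopy_group R 1 (lim_coord x n)) :
    exists u, represents o (pt_sphere R x u).
  have [w [C CP]] := represents_ex o; exists (w (fun=> I0 R)), C => n.
  have [hC CE] := CP n; split=> //; move: hC; congr arrow.
  by apply/funext => s /=; rewrite [s](cube0_eq _ (fun=> I0 R)).
have [[u Du] [v Dv]] := (pts om, pts om').
have [w uvw] := lim_product_ex u v.
rewrite (lim1_iotaE Du) (lim1_iotaE Dv) [RHS](lim_mulE uvw).
rewrite /pi0_class -(lim1_iotaE (represents_product Du Dv uvw)); congr lim1_iota.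
by apply: lim1_mulE => n; exact: hspace_pi1_commute (m n).
Qed.

Lemma hg_map_pi0 (Y Z : topologicalType) (y : Y) (z : Z) (f : pointed_map y z) u :
  hg_map f (pi0_class R y u) = pi0_class R z (f u).
Proof. by rewrite hg_mapE; apply/sphere_classP; exact: sphere_homotopic_ext. Qed.

Lemma hg_map_pi0_mul n (A B : homotopy_group R 0 (lim_coord x n.+1)) :
  hg_map (ft_pmap x n) (pi0_mul (m n.+1) A B) =
  pi0_mul (m n) (hg_map (ft_pmap x n) A) (hg_map (ft_pmap x n) B).
Proof.
rewrite -[A]pi0_pointK -[B]pi0_pointK; move: (pi0_point A) (pi0_point B) => u v.
rewrite pi0_mulE !hg_map_pi0 pi0_mulE; apply/pi0_classP.
by exists (trace (@h n) (u, v)); exact: arrow_hmap.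
Qed.

Lemma lim_pi0_mul_subproof (A B : hg_lim x 0) n :
  hg_map (ft_pmap x n) (pi0_mul (m n.+1) (lim_proj n.+1 A) (lim_proj n.+1 B)) =
  pi0_mul (m n) (lim_proj n A) (lim_proj n B).
Proof. by rewrite hg_map_pi0_mul; congr pi0_mul; exact: lim_projP. Qed.

Definition lim_pi0_mul (A B : hg_lim x 0) : hg_lim x 0 :=
  mk_lim (lim_pi0_mul_subproof A B).

Lemma hg_to_lim_mul (A B : homotopy_group R 0 x) :
  hg_to_lim (lim_mul A B) = lim_pi0_mul (hg_to_lim A) (hg_to_lim B).
Proof.
rewrite -[A]pi0_pointK -[B]pi0_pointK; move: (pi0_point A) (pi0_point B) => u v.
have [w uvw] := lim_product_ex u v; rewrite (lim_mulE uvw).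
have /lim_productP[G GP] := uvw; apply: lim_eqP => n.
transitivity (hg_map (proj_pmap x n) (pi0_class R x w)) => //.
transitivity (pi0_mul (m n) (hg_map (proj_pmap x n) (pi0_class R x u))
  (hg_map (proj_pmap x n) (pi0_class R x v))) => //.
rewrite !hg_map_pi0 pi0_mulE; apply/pi0_classP.
by exists (G n); exact: (GP n).1.
Qed.

Lemma lim_pi0_group :
  (forall n, is_group (pi0_mul (m n)) (hg_base R 0 (lim_coord x n))) ->
  is_group lim_pi0_mul (hg_lim_base x 0).
Proof.
move=> gm.
pose inv n : homotopy_group R 0 (lim_coord x n) -> homotopy_group R 0 (lim_coord x n) :=
  sval (cid (let: And4 _ _ _ e := gm n in e)).
have invP n : left_inverse (hg_base R 0 _) (inv n) (pi0_mul (m n)) /\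
    right_inverse (hg_base R 0 _) (inv n) (pi0_mul (m n)).
  by rewrite /inv; case: cid.
have inv_comm (A : hg_lim x 0) n : hg_map (ft_pmap x n) (inv n.+1 (lim_proj n.+1 A)) =
    inv n (lim_proj n A).
  have [mA m1 mr1 _] := gm n; have [Vl Vr] := invP n; have [Vl' Vr'] := invP n.+1.
  (* The image of an inverse is an inverse, and inverses are unique. *)
  rewrite -[LHS]mr1 -(Vr (lim_proj n A)) mA; rewrite -{1}(lim_projP n A).
  have -> := esym (hg_map_pi0_mul (inv n.+1 (lim_proj n.+1 A)) (lim_proj n.+1 A)).
  by rewrite Vl' hg_map_base m1.
split.
- by move=> A B C; apply: lim_eqP => n; have [mA _ _ _] := gm n; exact: mA.
- by move=> A; apply: lim_eqP => n; have [_ m1 _ _] := gm n; exact: m1.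
- by move=> A; apply: lim_eqP => n; have [_ _ mr1 _] := gm n; exact: mr1.
exists (fun A => mk_lim (inv_comm A)); split=> A; apply: lim_eqP => n.
- by have [Vl _] := invP n; exact: Vl.
- by have [_ Vr] := invP n; exact: Vr.
Qed.

(** If [B] lies over the inverse of the image of [A], the product of [A] and [B]
is in the image of lim^1, where it has an inverse.  So there are right
inverses, which suffice in a monoid. *)
Lemma lim_mul_group :
  is_group lim_pi0_mul (hg_lim_base x 0) ->
  associative lim_mul -> left_id (hg_base R 0 x) lim_mul ->
  right_id (hg_base R 0 x) lim_mul -> is_group lim_mul (hg_base R 0 x).
Proof.
move=> [_ _ _ [linv [_ linvr]]] mA m1 mr1.
have [i1 _ _ ri rP] := @milnor_exact R X x 0.
have [[_ _ _ [inv1 [_ inv1r]]] _] :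
    is_abelian_group (@hg_lim1_mul R X x 0) (hg_lim1_base x 0).
  by apply: lim1_abelian_group => n; exact: hspace_pi1_commute (m n).
have rinv (A : homotopy_group R 0 x) : exists B, lim_mul A B = hg_base R 0 x.
  have : range (@hg_to_lim R X x 0) (linv (hg_to_lim A)) by rewrite rP.
  move=> [B _ BE].
  have : (@hg_to_lim R X x 0 @^-1` [set hg_lim_base x 0]) (lim_mul A B).
    by rewrite /= hg_to_lim_mul BE linvr.
  rewrite -ri => -[C _ CE]; exists (lim_mul B (lim1_iota (inv1 C : hg_lim1 x 0))).
  by rewrite mA -CE -lim1_iota_lim_mul -i1; congr lim1_iota; exact: inv1r.
pose inv A := sval (cid (rinv A)).
have invr A : lim_mul A (inv A) = hg_base R 0 x := svalP (cid (rinv A)).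
split=> //; exists inv; split=> A //.
rewrite -[LHS]mr1 -{1}(invr (inv A)) mA.
by rewrite -[lim_mul (lim_mul (inv A) A) _]mA invr mr1 invr.
Qed.

End LimitProducts.

Theorem theorem2p1 (R : realType) :
  exists iota : forall (X : fibration_tower R) (x : lim_space X) (k : nat),
      hg_lim1 x k -> homotopy_group R k x,
  [/\ forall (X : fibration_tower R) (x : lim_space X) (k : nat),
        short_exact (hg_lim1_base x k) (hg_base R k x) (hg_lim_base x k)
          (iota X x k) (@hg_to_lim R X x k),
      forall (X Y : fibration_tower R) (x : lim_space X) (y : lim_space Y)
          (f : tower_map x y) (k : nat),
        (forall A : hg_lim1 x k,
          hg_map (lim_pmap f) (iota X x k A) = iota Y y k (hg_lim1_map f A)) /\
        (forall A : homotopy_group R k x,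
          hg_lim_map f (hg_to_lim A) = hg_to_lim (hg_map (lim_pmap f) A)),
      forall (X : fibration_tower R) (x : lim_space X) (k : nat),
        [/\ is_abelian_group (@hg_lim1_mul R X x k.+1) (hg_lim1_base x k.+1),
            forall A B : hg_lim1 x k.+1,
              iota X x k.+1 (hg_lim1_mul A B) =
              (iota X x k.+1 A * iota X x k.+1 B)%g
          & forall A B : homotopy_group R k.+1 x,
              hg_to_lim (A * B)%g = (hg_to_lim A * hg_to_lim B)%g],
      forall (X : fibration_tower R) (x : lim_space X) (k : nat),
        (forall A B : homotopy_group R k.+2 x, (A * B)%g = (B * A)%g) /\
        (forall A B : hg_lim x k.+2, (A * B)%g = (B * A)%g)
    & forall (X : fibration_tower R) (x : lim_space X)
          (m : forall n, hspace R (lim_coord x n)),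
        (forall n, is_hmap (ft_pmap x n) (m n.+1) (m n)) ->
        (exists h, hmap_homotopies m h) /\
        forall h, hmap_homotopies m h ->
        exists (mul : homotopy_group R 0 x -> homotopy_group R 0 x ->
                      homotopy_group R 0 x)
               (lmul : hg_lim x 0 -> hg_lim x 0 -> hg_lim x 0),
          [/\ forall u v : lim_space X, exists w, lim_product m h u v w,
              forall u v w : lim_space X, lim_product m h u v w ->
                mul (pi0_class R x u) (pi0_class R x v) = pi0_class R x w,
              forall (A B : hg_lim x 0) (n : nat),
                lim_proj n (lmul A B) =
                pi0_mul (m n) (lim_proj n A) (lim_proj n B),
              [/\ is_abelian_group (@hg_lim1_mul R X x 0) (hg_lim1_base x 0),
                  forall A B : hg_lim1 x 0,
                    iota X x 0 (hg_lim1_mul A B) =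
                    mul (iota X x 0 A) (iota X x 0 B)
                & forall A B : homotopy_group R 0 x,
                    hg_to_lim (mul A B) = lmul (hg_to_lim A) (hg_to_lim B)]
            & (* An H-space product need not make pi_0 a group, so group laws are
                 claimed only where the products on pi_0 can satisfy them. *)
              (forall n, is_group (pi0_mul (m n)) (hg_base R 0 (lim_coord x n))) ->
              is_group lmul (hg_lim_base x 0) /\
              (associative mul -> left_id (hg_base R 0 x) mul ->
               right_id (hg_base R 0 x) mul -> is_group mul (hg_base R 0 x))]].
Proof.
exists (fun X x k => @lim1_iota R X x k); split.
- exact: milnor_exact.
- move=> X Y x y f k; split; [exact: lim1_iota_natural|exact: hg_to_lim_natural].
- move=> X x k; split.
  + by apply: lim1_abelian_group => n; exact: hg_mulC.
  + exact: lim1_iota_mul.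
  + by move=> A B; apply: lim_eqP => n; exact: hg_map_mul.
- move=> X x k; split; first exact: hg_mulC.
  by move=> A B; apply: lim_eqP => n; exact: hg_mulC.
- move=> X x m hm; split; first exact: hmap_homotopies_ex.
  move=> h hP; exists (lim_mul hP), (lim_pi0_mul hP); split.
  + exact: lim_product_ex.
  + exact: lim_mulE.
  + by [].
  + split; last exact: hg_to_lim_mul.
      by apply: lim1_abelian_group => n; exact: hspace_pi1_commute (m n).
    exact: lim1_iota_lim_mul.
  + move=> gm; have gl := lim_pi0_group hP gm; split=> //.
    exact: lim_mul_group.
Qed.
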